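(* Let $a=\begin{pmatrix}-1&0\\0&-1\end{pmatrix}$ and $b=\begin{pmatrix}0&1\\1&0\end{pmatrix}$ in $\operatorname{Aut}(H_2(S^2\times S^2;\mathbb{Z}))=GL(2,\mathbb{Z})$, let $G$ be a finite group, and let $1\to K\to G\xrightarrow{\varphi}Q\to1$ be an extension with $Q\subset\langle a\rangle\times\langle b\rangle$ a subgroup. Put $G_a=\varphi^{-1}(\langle a\rangle)$ and $G_b=\varphi^{-1}(\langle b\rangle)$, so that the homology representation $\varphi$ of $G$ is described by the tuple $(G,K,G_a,G_b)$. Then $(G,K,G_a,G_b)$ admits a linear, pseudofree action on $S^2\times S^2$ if and only if all of the following hold: (1) $K$ is polyhedral. (2) If $G_a\ne K$, then $G_a$ is abelian and $K$ is cyclic. (3) If $G_b\ne K$, then the extension $1\to G_a\to G\to\mathbb{Z}_2\to1$ does not split. (4) If $\varphi(q_a)=a$, $\varphi(q_b)=b$ and $q_a^2=1$ (with $q_a,q_b\in G$), then $q_a$ and $q_b$ do not commute.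
   Context: An action of a finite group on a compact space is pseudofree if only finitely many points have nontrivial isotropy. View $S^2\times S^2\subset\mathbb{R}^3\times\mathbb{R}^3=\mathbb{R}^6$ as the product of unit spheres. All actions are orientation preserving. An action on $S^2\times S^2$ is linear if every group element acts as the restriction of an element of $O(6)$ that maps $S^2\times S^2$ to itself and preserves its orientation. The homology representation of an action is the induced action on $H_2(S^2\times S^2;\mathbb{Z})$, written with respect to the standard basis (the classes of the two factors). The tuple $(G,K,G_a,G_b)$ admits an action of a given kind if $G$ has such an action whose homology representation is $\varphi$. A group is polyhedral if it is cyclic, dihedral, or isomorphic to one of $A_4$, $S_4$, $A_5$ (the tetrahedral, octahedral and icosahedral groups). Here $\varphi^{-1}(\langle a\rangle)$ means the set of elements of $G$ whose image under $\varphi$ lies in $\langle a\rangle$, and similarly for $b$.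
   Formalization: The case Q = ⟨ab⟩ is excluded: there G_a = G_b = K, so (2)–(4) are vacuous, and the equivalence fails for G = Z_2, K = 1, φ(g) = ab, since every linear action of this kind fixes a 2-sphere pointwise. *)

(* Defs.v *)
From HB Require Import structures.
From mathcomp Require Import all_boot all_order all_algebra all_fingroup.
From mathcomp Require Import cyclic alt.
From mathcomp Require extremal.
From mathcomp Require Import mathcomp_extra boolp classical_sets functions.
From mathcomp Require Import cardinality reals topology normedtype trigo.
From mathcomp.multinomials Require Import freeg.

Set Implicit Arguments.
Unset Strict Implicit.
Unset Printing Implicit Defensive.
Import Order.TTheory GRing.Theory Num.Theory.
Import numFieldNormedType.Exports.
Local Open Scope classical_set_scope.
Local Open Scope ring_scope.

(* H_n(X; Z) is presented by singular cubes (Serre, Massey): the chains are the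
   free abelian group on the continuous maps I^n -> X, taken modulo the
   subgroup generated by the degenerate cubes. *)

Definition unit_interval (R : realType) : set R := [set x | 0 <= x <= 1].

Definition cube (R : realType) (n : nat) : topologicalType :=
  {ptws 'I_n -> set_type (@unit_interval R)}.

Lemma endpoint_subproof (R : realType) (e : bool) :
  (e%:R : R) \in @unit_interval R.
Proof. by rewrite inE /unit_interval /=; case: e; rewrite /= ?lexx ?ler01. Qed.

Definition endpoint (R : realType) (e : bool) : set_type (@unit_interval R) :=
  SigSub (endpoint_subproof R e).

Definition face_map (R : realType) n (i : 'I_n.+1) (e : bool)
    (t : cube R n) : cube R n.+1 :=
  fun j => if unlift i j is Some k then t k else endpoint R e.

Lemma face_map_continuous (R : realType) n (i : 'I_n.+1) (e : bool) :
  continuous (@face_map R n i e).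
Proof.
move=> t.
have ? := @fmap_filter _ _ (@face_map R n i e) (nbhs t) _.
apply/cvg_sup => j.
have ct : continuous (fun u : cube R n => face_map i e u j).
  rewrite /face_map; case: (unlift i j) => [k|]; last exact: cst_continuous.
  exact: (@proj_continuous 'I_n (fun=> set_type (@unit_interval R)) k).
exact: (@continuous_comp_initial _ _ _ (fun u : cube R n.+1 => u j)
          (@face_map R n i e) ct).
Qed.

HB.instance Definition _ (R : realType) n (i : 'I_n.+1) (e : bool) :=
  isContinuous.Build _ _ (@face_map R n i e) (@face_map_continuous R n i e).

Section Chains.
Context {R : realType}.
Implicit Types X Y : topologicalType.

Definition singular_cube n X := continuousType (cube R n) X.

Definition chain n X := {freeg (singular_cube n X) / int}.

Definition face n X (i : 'I_n.+1) (e : bool) (s : singular_cube n.+1 X) :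
  singular_cube n X := s \o @face_map R n i e.

(* With 0-based i, this is Massey's sum_(1 <= i <= n) (-1)^i (A_i s - B_i s),
   where A_i and B_i are the faces x_i = 0 and x_i = 1. *)
Definition boundary n X : chain n.+1 X -> chain n X :=
  fglift (fun s : singular_cube n.+1 X =>
    \sum_(i < n.+1) (-1) ^+ i *: (<< face i true s >> - << face i false s >>)).

Definition pushforward n X Y (f : continuousType X Y) : chain n X -> chain n Y :=
  fglift (fun s : singular_cube n X => << (f \o s : singular_cube n Y) >>).

(* s does not depend on its i-th coordinate *)
Definition degenerate n X (s : singular_cube n X) : Prop :=
  exists i : 'I_n, forall t u : cube R n,
    (forall j, j != i -> t j = u j) -> s t = s u.

(* The subgroup generated by the degenerate cubes: since the chain group is free
   on all cubes, membership can be read off the support. *)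
Definition degenerate_chain n X (z : chain n X) : Prop :=
  forall s, s \in dom z -> degenerate s.

(* For cycles z and w, this is equality of their classes in H_n(X; Z). *)
Definition homologous n X (z w : chain n X) : Prop :=
  exists (c : chain n.+1 X) (d : chain n X),
    degenerate_chain d /\ z - w = boundary c + d.

End Chains.

(* The library norm on 'cV[R]_3 is the sup norm, so the Euclidean one is spelled
   out. *)
Definition sphere (R : realType) : set 'cV[R]_3 :=
  [set x | \sum_i x i 0 ^+ 2 = 1].

Definition S2xS2 (R : realType) : topologicalType :=
  (set_type (@sphere R) * set_type (@sphere R))%type.

Definition in_R6 (R : realType) (p : S2xS2 R) : 'cV[R]_(3 + 3) :=
  col_mx (val p.1) (val p.2).

Lemma basepoint_subproof (R : realType) : delta_mx 0 0 \in @sphere R.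
Proof.
by rewrite inE /sphere /= !big_ord_recl big_ord0 !mxE /= !expr0n expr1n !addr0.
Qed.

Definition basepoint (R : realType) : set_type (@sphere R) :=
  SigSub (basepoint_subproof R).

Definition factor_incl (R : realType) (j : 'I_2) (x : set_type (@sphere R)) :
  S2xS2 R := if j == 0 then (x, basepoint R) else (basepoint R, x).

Lemma factor_incl_continuous (R : realType) (j : 'I_2) :
  continuous (@factor_incl R j).
Proof.
rewrite /factor_incl; case: (j == 0) => x A [[P Q] /= [Px Qx] PQA].
  by apply: filterS Px => u Pu; apply: PQA; split=> //; exact: nbhs_singleton.
by apply: filterS Qx => u Qu; apply: PQA; split=> //; exact: nbhs_singleton.
Qed.

HB.instance Definition _ (R : realType) (j : 'I_2) :=
  isContinuous.Build _ _ (@factor_incl R j) (@factor_incl_continuous R j).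

(* Spherical coordinates on the unit square: polar angle pi * t_0, longitude
   2 pi * t_1. *)
Definition spherical_vec (R : realType) (t : cube R 2) : 'cV[R]_3 :=
  let theta := pi * val (t 0) in let psi := pi *+ 2 * val (t 1) in
  \col_i [:: sin theta * cos psi; sin theta * sin psi; cos theta]`_i.

Lemma spherical_subproof (R : realType) (t : cube R 2) :
  spherical_vec t \in @sphere R.
Proof.
rewrite inE /sphere /= !big_ord_recl big_ord0 !mxE /= addr0.
by rewrite !exprMn addrA -mulrDr cos2Dsin2 mulr1 addrC cos2Dsin2.
Qed.

Definition spherical (R : realType) (t : cube R 2) : set_type (@sphere R) :=
  SigSub (spherical_subproof t).

Lemma mx_continuous (T : topologicalType) (R : realType) m n
    (f : T -> 'M[R]_(m, n)) :
  (forall i j, continuous (fun t => f t i j)) -> continuous f.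
Proof.
move=> cf t A [P nP PA].
suff PN : nbhs t (fun u => forall i j, P i j (f u i j)).
  by apply: (filterS _ PN) => u Pu; exact: PA.
apply: (@filter_forall _ _ (fun i u => forall j, P i j (f u i j))) => i.
apply: (@filter_forall _ _ (fun j u => P i j (f u i j))) => j.
exact: cf (nP i j).
Qed.

Lemma spherical_continuous (R : realType) : continuous (@spherical R).
Proof.
have ct (j : 'I_2) : continuous (fun t : cube R 2 => val (t j) : R).
  move=> t.
  apply: (@continuous_comp _ _ _ (fun t : cube R 2 => t j) val).
    exact: (@proj_continuous 'I_2 (fun=> set_type (@unit_interval R)) j).
  exact: initial_continuous.
have cv : continuous (@spherical_vec R).
  apply: mx_continuous => i j; under eq_fun do rewrite mxE.
  have cc k (a : R) : continuous (fun u : cube R 2 => a * val (u k)).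
    by move=> u; exact: (continuousM (@cst_continuous _ _ a u) (ct k u)).
  have cS k (a : R) : continuous (fun u : cube R 2 => sin (a * val (u k))).
    by move=> u; apply: (continuous_comp (cc k a u)); exact: continuous_sin.
  have cC k (a : R) : continuous (fun u : cube R 2 => cos (a * val (u k))).
    by move=> u; apply: (continuous_comp (cc k a u)); exact: continuous_cos.
  move=> t; move: (i); case=> [[|[|[|//]]] ? /=].
  - exact: (continuousM (cS 0 pi t) (cC 1 _ t)).
  - exact: (continuousM (cS 0 pi t) (cS 1 _ t)).
  - exact: cC.

apply: (@continuous_comp_initial _ _ _ (@set_val _ (@sphere R)) (@spherical R)).
exact: cv.
Qed.

HB.instance Definition _ (R : realType) :=
  isContinuous.Build _ _ (@spherical R) (@spherical_continuous R).

(* The fundamental class of S^2. As a map of pairs the spherical cube collapses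
   the boundary of I^2 onto a meridian and is injective on the interior, so it
   has degree 1; its boundary is carried by the constant cubes at the poles. *)
Definition sphere_class (R : realType) : @chain R 2 (set_type (@sphere R)) :=
  << (@spherical R : singular_cube 2 _) >>.

Lemma sphere_class_cycle (R : realType) :
  degenerate_chain (boundary (sphere_class R)).
Proof.
rewrite /boundary /sphere_class liftU scale1r !big_ord_recl big_ord0 addr0.
have -> : face (fintype.lift ord0 ord0) true (@spherical R : singular_cube 2 _) =
          face (fintype.lift ord0 ord0) false (@spherical R : singular_cube 2 _).
  apply/continuousEP => t; apply: val_inj; rewrite /= /spherical_vec.
  apply/matrixP=> i k; rewrite !mxE /face_map /=.
  have -> : unlift (fintype.lift ord0 ord0) (1 : 'I_2) = None.
    by case: unliftP => // j /(congr1 val); case: j => [[|]].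
  rewrite /= mulr0 mulr1 cos0 sin0 cos2pi sin2pi.
  by case: unliftP => [j _|/(congr1 val)].
rewrite subrr scaler0 addr0 expr0 scale1r => s.
move=> /domB; rewrite mem_cat !domU1 !inE.
have deg e : degenerate (face ord0 e (@spherical R : singular_cube 2 _)).
  exists 0 => t u _; apply: val_inj; apply/matrixP=> i k.
  rewrite /= /spherical_vec !mxE /face_map /=.
  have -> : unlift ord0 (0 : 'I_2) = None.
    by case: unliftP => // j /(congr1 val); case: j => [[|]].
  by case: e; rewrite /= ?mulr1 ?mulr0 ?sinpi ?sin0 !mul0r.
by case/orP=> /eqP ->.
Qed.

(* The standard basis of H_2(S^2 x S^2; Z): the classes of S^2 x pt (j = 0) and
   pt x S^2 (j = 1), both factors carrying the same orientation. *)
Definition factor_class (R : realType) (j : 'I_2) : @chain R 2 (S2xS2 R) :=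
  pushforward (@factor_incl R j) (sphere_class R).

Section Actions.
Context {R : realType} {G : finGroupType}.
Implicit Types (act : G -> continuousType (S2xS2 R) (S2xS2 R)).

Definition is_action act : Prop :=
  (forall p, act 1%g p = p) /\
  (forall g h p, act (g * h)%g p = act g (act h p)).

(* The columns (x, 0) and (0, y) span the normal space of S^2 x S^2 at
   p = (x, y). *)
Definition normal_frame (p : S2xS2 R) : 'M[R]_(3 + 3, 1 + 1) :=
  block_mx (val p.1) 0 0 (val p.2).

Definition tangent (p : S2xS2 R) m (T : 'M[R]_(3 + 3, m)) : Prop :=
  (normal_frame p)^T *m T = 0.

(* The columns of T are an oriented basis of the tangent space at p, for the
   orientation induced from R^6 by the normal framing. Orientation preservation
   on S^2 x S^2 is not det M = 1: the swap of the factors preserves the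
   orientation although it has determinant -1 on R^6. *)
Definition positive_frame (p : S2xS2 R) (T : 'M[R]_(3 + 3, 4)) : Prop :=
  tangent p T /\ 0 < \det (row_mx (normal_frame p) T : 'M[R]_6).

(* The second clause says in particular that M maps S^2 x S^2 to itself. *)
Definition is_linear act : Prop :=
  forall g, exists M : 'M[R]_(3 + 3),
    [/\ M^T *m M = 1%:M,
        forall p, in_R6 (act g p) = M *m in_R6 p &
        forall p T, positive_frame p T -> positive_frame (act g p) (M *m T)].

Definition is_pseudofree act : Prop :=
  finite_set [set p | exists2 g, g != 1%g & act g p = p].

(* The j-th column of phi g gives the image of the j-th basis class under the
   map induced by g. *)
Definition has_homology_rep act (phi : G -> 'M[int]_2) : Prop :=
  forall g j, homologous (pushforward (act g) (factor_class R j))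
                         (\sum_i phi g i j *: factor_class R i).

End Actions.

Definition admits_linear_pseudofree_action (R : realType) (G : finGroupType)
    (phi : G -> 'M[int]_2) : Prop :=
  exists act : G -> continuousType (S2xS2 R) (S2xS2 R),
    [/\ is_action act, is_linear act, is_pseudofree act
      & has_homology_rep act phi].

Definition mat_a : 'M[int]_2 := (- 1)%:M.
Definition mat_b : 'M[int]_2 := \matrix_(i, j) (i != j)%:R.

Definition powers (A : 'M[int]_2) : set 'M[int]_2 :=
  [set M | exists k : int, M = A ^ k].

Definition subgroup_ab : set 'M[int]_2 :=
  [set M | exists i j : int, M = mat_a ^ i *m mat_b ^ j].

Section Tuple.
Context {G : finGroupType} (phi : G -> 'M[int]_2).

Definition tuple_K : {set G} := [set g | phi g == 1%:M]%SET.
Definition tuple_a : {set G} := [set g | `[< powers mat_a (phi g) >]]%SET.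
Definition tuple_b : {set G} := [set g | `[< powers mat_b (phi g) >]]%SET.

End Tuple.

(* dihedral_gtype m is the dihedral group of order m, a Klein four-group for
   m = 4; it is only meaningful for even m >= 4. *)
Definition polyhedral (gT : finGroupType) (K : {set gT}) : Prop :=
  cyclic K
  \/ (exists2 n, (1 < n)%N & K \isog [set: extremal.dihedral_gtype n.*2]%SET)
  \/ K \isog Alt 'I_4 \/ K \isog Sym 'I_4 \/ K \isog Alt 'I_5.

(* Main.v *)
Require Import Defs.
From mathcomp Require Import all_boot all_order all_algebra all_fingroup.
From mathcomp Require Import cyclic pgroup sylow alt ring lra zify.
From mathcomp Require extremal complex.

(* An orientation-preserving linear map of S^2 x S^2 has the form
   (x, y) |-> (A x, D y) or (x, y) |-> (A y, D x) with A, D in O(3) and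
   det A = det D, and it acts on H_2 by det A, respectively det A * b: a product
   of k reflections deforms A to the k-th power of one coordinate reflection, and
   an integral degree cocycle on cubes shows that the two factor classes are
   independent. The theorem is then about pairs of orthogonal representations.
   A map fixing a circle pointwise in one factor and a point of the other is not
   allowed, so K acts faithfully by rotations on each factor, an involution
   outside K in G_a must be -1 on one of the factors, and no involution swaps the
   factors; a rotation group is polyhedral by counting the orbits of its poles.
   Conversely, G_a is represented by rotations times the sign of its action on
   H_2; one representation rho of G_a suffices if the factors are swapped, since
   conjugation by an element q over b gives the action on the second factor, and
   (4) says that q exchanges the two involutions of G_a outside K, so that each
   of them is -1 on one of the factors. *)

(** The map [phi] can be read off an action only because the factor classes are independent. The
    degree cochain makes sense only for cubes that are small on the sphere, so cubes are sampled on
    grids; boundaries have degree 0 on all fine grids, and one grid serves a whole chain because a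
    chain has finitely many cubes. In the classification the orbit count yields only the orders of K
    and of the pole stabilizers. The isomorphism types A_4, S_4, A_5 come from the conjugation
    action on Sylow subgroups: four Sylow 3-subgroups for orders 12 and 24, five Sylow 2-subgroups
    for order 60. In (2) the factors interact: an involution of G_a outside K is determined by the
    factor on which it is -1, so there are at most two. If -1 is missing on one factor, a sign twist
    makes G_a a rotation group with at most one involution outside K, and pole counting makes it
    cyclic. If -1 occurs on both, it comes from a central element and K has at most one involution.
    In (4), if q_b commutes with q_a then q_a is -1 on both factors; its product with an involution
    among the powers of q_b is a further involution outside K, for which no factor is left. *)

Set Implicit Arguments.
Unset Strict Implicit.
Unset Printing Implicit Defensive.
Import Order.TTheory GRing.Theory Num.Theory.

(** * Geometry of R^3 *)

Section Space.
Local Open Scope ring_scope.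
Variable R : rcfType.
Implicit Types (x y z u v w : 'cV[R]_3) (A B : 'M[R]_3) (a b c : R).

Lemma sum3 (V : nmodType) (F : 'I_3 -> V) : \sum_i F i = F 0 + F 1 + F 2.
Proof.
rewrite !big_ord_recl big_ord0 addr0 addrA; congr (_ + F _ + F _); exact: val_inj.
Qed.

Lemma ord3P (P : 'I_3 -> Prop) : P 0 -> P 1 -> P 2 -> forall i, P i.
Proof.
move=> P0 P1 P2 [[|[|[|//]]] Hi].
- by have -> : Ordinal Hi = 0 by exact: val_inj.
- by have -> : Ordinal Hi = 1 by exact: val_inj.
- by have -> : Ordinal Hi = 2 by exact: val_inj.
Qed.

Lemma cV3P x y : x 0 0 = y 0 0 -> x 1 0 = y 1 0 -> x 2 0 = y 2 0 -> x = y.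
Proof. by move=> *; apply/matrixP => i j; rewrite !ord1; elim/ord3P: i. Qed.

Definition dot x y : R := \sum_i x i 0 * y i 0.

Lemma dotE x y : dot x y = x 0 0 * y 0 0 + x 1 0 * y 1 0 + x 2 0 * y 2 0.
Proof. exact: sum3. Qed.

Lemma dotC x y : dot x y = dot y x.
Proof. by rewrite !dotE; ring. Qed.

Lemma dotDl x y z : dot (x + y) z = dot x z + dot y z.
Proof. by rewrite !dotE !mxE; ring. Qed.

Lemma dotZl a x y : dot (a *: x) y = a * dot x y.
Proof. by rewrite !dotE !mxE; ring. Qed.

Lemma dotNl x y : dot (- x) y = - dot x y.
Proof. by rewrite !dotE !mxE; ring. Qed.

Lemma dotDr x y z : dot z (x + y) = dot z x + dot z y.
Proof. by rewrite !dotE !mxE; ring. Qed.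

Lemma dotZr a x y : dot y (a *: x) = a * dot y x.
Proof. by rewrite !dotE !mxE; ring. Qed.

Lemma dotNr x y : dot y (- x) = - dot y x.
Proof. by rewrite !dotE !mxE; ring. Qed.

Definition dotE_lin := (dotDl, dotDr, dotNl, dotNr, dotZl, dotZr).

Lemma dot_mx x y : dot x y = (x^T *m y) 0 0.
Proof. by rewrite mxE; apply: eq_bigr => i _; rewrite mxE. Qed.

Lemma dot_mulmxl A x y : dot (A *m x) y = dot x (A^T *m y).
Proof. by rewrite !dot_mx trmx_mul mulmxA. Qed.

Lemma dot_ge0 x : 0 <= dot x x.
Proof. by apply: sumr_ge0 => i _; exact: sqr_ge0. Qed.

Lemma dot_eq0 x : (dot x x == 0) = (x == 0).
Proof.
apply/eqP/eqP => [|->]; last by rewrite dotE !mxE; ring.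
move=> /psumr_eq0P H; apply/matrixP => i j; rewrite !ord1 mxE.
by apply/eqP; rewrite -sqrf_eq0 expr2 H // => k _; exact: sqr_ge0.
Qed.

Lemma dot_gt0 x : (0 < dot x x) = (x != 0).
Proof. by rewrite lt_def dot_ge0 andbT dot_eq0. Qed.

Lemma dot_inj x y : (forall w, dot x w = dot y w) -> x = y.
Proof.
move=> H; apply/subr0_eq/eqP; rewrite -dot_eq0; apply/eqP.
by rewrite dotDl dotNl H subrr.
Qed.

Definition unitize x : 'cV[R]_3 := (Num.sqrt (dot x x))^-1 *: x.

Lemma dot_unitize x : x != 0 -> dot (unitize x) (unitize x) = 1.
Proof.
rewrite -dot_gt0 => x0; rewrite /unitize dotZl dotZr mulrA -expr2 exprVn.
by rewrite sqr_sqrtr ?ltW // mulVf ?gt_eqF.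
Qed.

Lemma unit_neq0 u : dot u u = 1 -> u != 0.
Proof. by rewrite -dot_eq0 => ->; exact: oner_neq0. Qed.

Lemma unit_neqN u : dot u u = 1 -> u != - u.
Proof.
move=> /unit_neq0; apply: contra => /eqP H; apply/eqP.
have : 2 *: u = 0 by rewrite scaler_nat mulr2n {1}H addNr.
by move/eqP; rewrite scaler_eq0 pnatr_eq0 => /eqP.
Qed.

Definition cross x y : 'cV[R]_3 :=
  \col_i [:: x 1 0 * y 2 0 - x 2 0 * y 1 0;
             x 2 0 * y 0 0 - x 0 0 * y 2 0;
             x 0 0 * y 1 0 - x 1 0 * y 0 0]`_i.

Lemma crossE x y :
  (cross x y 0 0 = x 1 0 * y 2 0 - x 2 0 * y 1 0) *
  (cross x y 1 0 = x 2 0 * y 0 0 - x 0 0 * y 2 0) *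
  (cross x y 2 0 = x 0 0 * y 1 0 - x 1 0 * y 0 0).
Proof. by rewrite !mxE. Qed.

Lemma cross_linr a b x y z :
  cross x (a *: y + b *: z) = a *: cross x y + b *: cross x z.
Proof. by apply: cV3P; rewrite !(crossE, mxE) /=; ring. Qed.

Definition cols3 x y z : 'M[R]_3 :=
  \matrix_(i, j) (if j == 0 then x else if j == 1 then y else z) i 0.

Lemma cols3E x y z i :
  (cols3 x y z i 0 = x i 0) * (cols3 x y z i 1 = y i 0) *
  (cols3 x y z i 2 = z i 0).
Proof. by rewrite !mxE. Qed.

Lemma mulmx_cols3 A x y z :
  A *m cols3 x y z = cols3 (A *m x) (A *m y) (A *m z).
Proof.
by apply/matrixP => i j; elim/ord3P: j; rewrite cols3E !mxE;
  apply: eq_bigr => k _; rewrite cols3E.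
Qed.

Lemma det3 A : \det A =
  A 0 0 * (A 1 1 * A 2 2 - A 1 2 * A 2 1)
  - A 0 1 * (A 1 0 * A 2 2 - A 1 2 * A 2 0)
  + A 0 2 * (A 1 0 * A 2 1 - A 1 1 * A 2 0).
Proof.
rewrite (expand_det_row _ 0) sum3 /cofactor.
rewrite !(expand_det_row _ ord0) !big_ord_recl !big_ord0 /cofactor !det_mx11 !mxE.
pose f m n := A (inord m) (inord n).
have Af i j : A i j = f i j by rewrite /f !inord_val.
rewrite !Af /= /bump /= !(addn0, add0n, add1n). ring.
Qed.

Lemma det_cols3 x y z : \det (cols3 x y z) = dot (cross x y) z.
Proof. rewrite det3 !cols3E dotE !crossE; ring. Qed.

Definition orth A := A^T *m A = 1%:M.

Lemma orth1 : orth 1%:M.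
Proof. by rewrite /orth trmx1 mulmx1. Qed.

Lemma orthM A B : orth A -> orth B -> orth (A *m B).
Proof.
by rewrite /orth => hA hB; rewrite trmx_mul mulmxA -(mulmxA B^T) hA mulmx1.
Qed.

Lemma orthN A : orth A -> orth (- A).
Proof. by rewrite /orth (linearN trmx) /= mulNmx mulmxN opprK. Qed.

Lemma orth_trmx A : orth A -> A *m A^T = 1%:M.
Proof. exact: mulmx1C. Qed.

Lemma orth_det A : orth A -> \det A = 1 \/ \det A = - 1.
Proof.
move=> /(congr1 determinant); rewrite det_mulmx det_tr det1 -expr2 => /eqP.
by rewrite sqrf_eq1 => /orP[] /eqP; [left | right].
Qed.

Lemma orth_dot A x y : orth A -> dot (A *m x) (A *m y) = dot x y.
Proof. by move=> oA; rewrite dot_mulmxl mulmxA oA mul1mx. Qed.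

Lemma orth_inj A x y : orth A -> A *m x = A *m y -> x = y.
Proof. by move=> oA /(congr1 (mulmx A^T)); rewrite !mulmxA oA !mul1mx. Qed.

(** [dot (cross x y) z] is the determinant of the three columns, so both sides have the same product
    with every [A *m v], and these are all vectors. *)
Lemma orth_cross A x y : orth A ->
  A *m cross x y = \det A *: cross (A *m x) (A *m y).
Proof.
move=> oA; apply: dot_inj => w.
have -> : w = A *m (A^T *m w) by rewrite mulmxA orth_trmx // mul1mx.
set v := A^T *m w; rewrite orth_dot // dotZl -!det_cols3 -mulmx_cols3.
rewrite det_mulmx mulrA.
by case: (orth_det oA) => ->; rewrite ?mulrNN mulr1 mul1r.
Qed.

Lemma detN3 A : \det (- A) = - \det A.
Proof. by rewrite -scaleN1r detZ -signr_odd /= expr1 mulN1r. Qed.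

Lemma cross_norm x y :
  dot (cross x y) (cross x y) = dot x x * dot y y - dot x y ^+ 2.
Proof. rewrite !dotE !crossE; ring. Qed.

Lemma cross_orthl x y : dot (cross x y) x = 0.
Proof. rewrite !dotE !crossE; ring. Qed.

Lemma cross_orthr x y : dot (cross x y) y = 0.
Proof. rewrite !dotE !crossE; ring. Qed.

Lemma unit_dot_eq1 u v : dot u u = 1 -> dot v v = 1 -> dot u v = 1 -> u = v.
Proof.
move=> u1 v1 uv; apply/subr0_eq/eqP; rewrite -dot_eq0.
by rewrite !dotE_lin (dotC v u) u1 v1 uv; apply/eqP; ring.
Qed.

Lemma cross_unit_eq0 u v : dot u u = 1 -> dot v v = 1 -> cross u v = 0 ->
  v = u \/ v = - u.
Proof.
move=> u1 v1 /eqP; rewrite -dot_eq0 cross_norm u1 v1 mulr1 subr_eq0 eq_sym sqrf_eq1.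
case/orP => /eqP uv; [left | right]; apply: unit_dot_eq1 => //.
- by rewrite dotC.
- by rewrite !dotE_lin opprK.
- by rewrite dotNr dotC uv opprK.
Qed.

Lemma cols3_inj A x y z : dot (cross x y) z != 0 ->
  A *m x = x -> A *m y = y -> A *m z = z -> A = 1%:M.
Proof.
move=> nz Ax Ay Az; have U : cols3 x y z \in unitmx.
  by rewrite unitmxE det_cols3 unitfE.
have : A *m cols3 x y z = cols3 x y z by rewrite mulmx_cols3 Ax Ay Az.
by move/(congr1 (mulmx^~ (invmx (cols3 x y z)))); rewrite mulmxK // mulmxV.
Qed.

(** If u and v are independent, A also fixes [cross u v], hence a basis. With [rot_axis], a
    nontrivial rotation fixes exactly one antipodal pair of the sphere. *)
Lemma rot_fix2 A u v : orth A -> \det A = 1 -> dot u u = 1 -> dot v v = 1 ->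
  A *m u = u -> A *m v = v -> A = 1%:M \/ v = u \/ v = - u.
Proof.
move=> oA dA u1 v1 Au Av; have [c0|c0] := eqVneq (cross u v) 0.
  by right; exact: cross_unit_eq0.
left; apply: (@cols3_inj _ u v (cross u v)) => //; first by rewrite dot_eq0.
by rewrite orth_cross // dA scale1r Au Av.
Qed.

(** [A - 1] is the product of A with minus its own transpose, so in odd dimension its determinant is
    its own negative. *)
Lemma rot_axis A : orth A -> \det A = 1 ->
  exists u, dot u u = 1 /\ A *m u = u.
Proof.
move=> oA dA.
have : \det (A - 1%:M)^T = 0.
  rewrite det_tr; have E : A - 1%:M = A *m (- (A - 1%:M)^T).
    by rewrite mulmxN linearB /= trmx1 mulmxBr mulmx1 orth_trmx // opprB.
  have : \det (A - 1%:M) = - \det (A - 1%:M).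
    by rewrite {1}E det_mulmx dA mul1r detN3 det_tr.
  by move=> H; lra.
move/eqP/det0P => [r r0 /(congr1 trmx)]; rewrite trmx_mul trmxK trmx0 => H.
exists (unitize r^T); split.
  by rewrite dot_unitize // -(inj_eq trmx_inj) trmxK trmx0.
move: H; rewrite mulmxBl mul1mx => /subr0_eq H.
by rewrite /unitize -scalemxAr H.
Qed.

Lemma orth_sqr_det A : orth A -> \det (A *m A) = 1.
Proof.
by move=> oA; rewrite det_mulmx; case: (orth_det oA) => ->; rewrite ?mulrNN mulr1.
Qed.

(** The square fixes u as well as the axis of A, and u is not on the axis because it is reversed. *)
Lemma rot_flip A u : orth A -> \det A = 1 -> dot u u = 1 -> A *m u = - u ->
  A *m A = 1%:M.
Proof.
move=> oA dA u1 Au; have [v [v1 Av]] := rot_axis oA dA.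
have Nu := unit_neqN u1; have Nv := unit_neqN v1.
case: (@rot_fix2 (A *m A) u v) => //.
- exact: orthM.
- exact: orth_sqr_det.
- by rewrite -mulmxA Au mulmxN Au opprK.
- by rewrite -mulmxA !Av.
have E0 : u = - u -> False by move=> E; move: Nu; rewrite -E eqxx.
by case=> E; move: Av; rewrite E ?mulmxN Au ?opprK => H; case: E0.
Qed.

Lemma refl_fix A u : orth A -> \det A = - 1 -> dot u u = 1 -> A *m u = u ->
  A *m A = 1%:M.
Proof.
move=> oA dA u1 Au; rewrite -[A *m A]opprK -mulmxN -mulNmx.
by apply: (@rot_flip _ u) => //; rewrite ?detN3 ?dA ?opprK ?mulNmx ?Au //; exact: orthN.
Qed.

Lemma orth_frame u : dot u u = 1 ->
  exists p, [/\ dot p p = 1, dot p u = 0, dot (cross u p) (cross u p) = 1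
    & dot (cross u p) p = 0 /\ dot (cross u p) u = 0].
Proof.
move=> u1.
have [w cw] : exists w, cross u w != 0.
  case: (eqVneq (cross u (delta_mx 0 0)) 0) => [H0|]; last by eexists; eassumption.
  case: (eqVneq (cross u (delta_mx 1 0)) 0) => [H1|]; last by eexists; eassumption.
  have := unit_neq0 u1; suff -> : u = 0 by rewrite eqxx.
  have e0 := crossE u (delta_mx 0 0); have e1 := crossE u (delta_mx 1 0).
  rewrite H0 H1 !mxE /= !mulr0 !mulr1 !(subr0, sub0r) in e0 e1.
  case: e0 => -[_ h1] h2; case: e1 => -[h3 _] h4.
  apply: cV3P; rewrite !mxE -?h1 -?h4 //.
  by apply/eqP; rewrite -oppr_eq0 -h2.
exists (unitize (cross u w)); have p1 := dot_unitize cw.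
have pu : dot (unitize (cross u w)) u = 0 by rewrite dotZl cross_orthl mulr0.
split => //; last by rewrite cross_orthl cross_orthr.
by rewrite cross_norm u1 p1 dotC pu; ring.
Qed.

Lemma frame_decomp u p x : dot u u = 1 -> dot p p = 1 -> dot p u = 0 ->
  x = dot x u *: u + dot x p *: p + dot x (cross u p) *: cross u p.
Proof.
move=> u1 p1 pu; set q := cross u p.
have q1 : dot q q = 1 by rewrite cross_norm u1 p1 dotC pu; ring.
have qu : dot q u = 0 by exact: cross_orthl.
have qp : dot q p = 0 by exact: cross_orthr.
apply/subr0_eq; set y := (X in X = 0).
have yu : dot u y = 0 by rewrite /y !dotE_lin u1 (dotC u p) pu (dotC u q) qu (dotC u x); ring.
have yp : dot p y = 0 by rewrite /y !dotE_lin p1 pu (dotC p q) qp (dotC p x); ring.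
have yq : dot q y = 0 by rewrite /y !dotE_lin q1 qu qp (dotC q x); ring.
apply/trmx_inj; rewrite trmx0.
have U : cols3 u p q \in unitmx by rewrite unitmxE det_cols3 unitfE q1 oner_neq0.
suff H : y^T *m cols3 u p q = 0.
  by move/(congr1 (mulmx^~ (invmx (cols3 u p q)))): H; rewrite mulmxK // mul0mx.
have T a w : y^T *m w = (dot w y)%:M.
  by apply/matrixP => i j; rewrite !ord1 [RHS]mxE mulr1n dotC dot_mx.
apply/matrixP => i j; rewrite ord1 !mxE.
under eq_bigr do rewrite mxE.
by elim/ord3P: j; under eq_bigr do rewrite cols3E mulrC; [exact: yu|exact: yp|exact: yq].
Qed.

(** [- A] is a half-turn about some u. For x orthogonal to u the vector [A *m x - x] is fixed by
    [- A] and orthogonal to u, hence zero. The plane found here later gives a circle of fixed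
    points. *)
Lemma refl_invol_plane A : orth A -> \det A = - 1 -> A *m A = 1%:M ->
  A <> - 1%:M -> exists p q, [/\ dot p p = 1, dot q q = 1, dot p q = 0,
    A *m p = p & A *m q = q].
Proof.
move=> oA dA A2 nA; have oB := orthN oA; have dB : \det (- A) = 1 by rewrite detN3 dA opprK.
have [u [u1 Bu]] := rot_axis oB dB.
have [p [p1 pu q1 [qp qu]]] := orth_frame u1; set q := cross u p in q1 qp qu.
have key x : dot x u = 0 -> A *m x = x.
  move=> xu; apply/eqP; rewrite -subr_eq0; apply/negPn/negP => y0.
  case: (@rot_fix2 (- A) u (unitize (A *m x - x))) => //.
  - exact: dot_unitize.
  - by rewrite -scalemxAr mulmxBr !mulNmx mulmxA A2 mul1mx opprK addrC.
  - by move=> H; apply: nA; rewrite -H opprK.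
  have yu : dot (unitize (A *m x - x)) u = 0.
    suff E : dot (A *m x) u = 0.
      have E1 : dot (A *m x - x) u = 0 by rewrite dotDl dotNl E xu subrr.
      by rewrite dotZl E1 mulr0.
    by rewrite -Bu mulNmx dotNr orth_dot // xu oppr0.
  case=> E; move: yu; rewrite E ?dotNl u1; lra.
by exists p, q; split => //; [rewrite dotC | exact: key | exact: key].
Qed.

End Space.

(** * Finite rotation groups *)

Section GroupFacts.
Local Open Scope group_scope.
Import GroupScope.

Lemma index2_mul (gT : finGroupType) (G H : {group gT}) x y :
  H \subset G -> #|G : H| = 2 -> x \in G -> y \in G -> x \notin H -> y \notin H ->
  x * y \in H.
Proof.
move=> sHG iHG Gx Gy nHx nHy.
have defD : H :* x = G :\: H.
  apply/eqP; rewrite eqEcard; apply/andP; split.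
    apply/subsetP => _ /rcosetP[h Hh ->]; rewrite inE groupMl // nHx /=.
    by rewrite groupM // (subsetP sHG).
  rewrite cardsD (setIidPr sHG) card_rcoset -(Lagrange sHG) iHG muln2 -addnn.
  by rewrite addnK.
have : y^-1 \in H :* x by rewrite defD inE !groupV nHy Gy.
by rewrite mem_rcoset -groupV invMg !invgK.
Qed.

(** A subgroup of index 2 is normal, so with one transposition it would contain all of them and be
    everything. It therefore contains none, and membership follows the parity of the number of
    transpositions. *)
Lemma index2_Alt (T : finType) (H : {group {perm T}}) :
  (#|H| * 2)%N = #|T|`! -> H :=: 'Alt_T.
Proof.
move=> oH; have sH : H \subset 'Sym_T by exact: subsetT.
have iH : #|'Sym_T : H| = 2.
  by apply/eqP; rewrite -(eqn_pmul2l (cardG_gt0 H)) (Lagrange sH) card_Sym oH.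
have /andP[_ nH] := index2_normal sH iH.
have HJ s t : (s ^ t \in H) = (s \in H) by rewrite memJ_norm // (subsetP nH) ?inE.
have conj x y z t : x != y -> z != t -> tperm x y \in H -> tperm z t \in H.
  move=> nxy nzt Hxy.
  have [u ux uy] : exists2 u : {perm T}, u x = z & u y = t.
    have [yz|nyz] := eqVneq y z.
      exists (tperm x y * tperm x t); rewrite permM ?tpermL ?tpermR ?yz.
        by rewrite tpermD // ?(eq_sym t) // -yz.
      by rewrite tpermL.
    exists (tperm x z * tperm y t); rewrite permM ?tpermL.
      by rewrite tpermD // eq_sym.
    by rewrite (tpermD nxy) ?tpermL // eq_sym.
  by rewrite -ux -uy -tpermJ HJ.
have notH x y : x != y -> tperm x y \notin H.
  move=> nxy; apply/negP => Hxy.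
  have HS : 'Sym_T \subset H.
    apply/subsetP => s _; have [ts -> /allP Hts] := prod_tpermP s.
    rewrite big_seq; apply: group_prod => p /Hts.
    by rewrite /dpair /= => np; exact: conj Hxy.
  move: iH; suff -> : #|'Sym_T : H| = 1%N by [].
  by apply/eqP; rewrite indexg_eq1.
apply/setP => s; rewrite Alt_even; have [ts -> Hts] := prod_tpermP s.
rewrite odd_perm_prod //; elim: ts Hts => [|p ts IH] /=; first by rewrite big_nil group1.
case/andP=> np /IH {}IH; rewrite big_cons negbK.
have /negbTE Hp := notH _ _ np.
case: (boolP (odd (size ts))) IH => /= _ IH; last first.
  by rewrite groupMr // Hp.
by apply: (index2_mul sH iH); rewrite ?inE ?Hp // IH.
Qed.

Lemma faithful_act_isog (aT : finGroupType) (X : finType)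
    (to : {action aT &-> X}) (K : {group aT}) (S : {set X}) :
  [acts K, on S | to] ->
  (forall g, g \in K -> (forall x, x \in S -> to x g = x) -> g = 1) ->
  exists H : {group {perm 'I_#|S|}}, K \isog H.
Proof.
move=> actKS ffulK.
(* Off K the map is the identity, so that it is a permutation for every g; on K the default of
   [odflt] is never taken because S is stable. *)
pose h g (i : 'I_#|S|) := if g \in K then
  odflt i [pick j | enum_val j == to (enum_val i) g] else i.
have hE g i : g \in K -> enum_val (h g i) = to (enum_val i) g.
  rewrite /h => Kg; rewrite Kg; case: pickP => [j /eqP //|/=].
  have Sx : to (enum_val i) g \in S by rewrite (acts_act actKS) // enum_valP.
  by move/(_ (enum_rank_in Sx (to (enum_val i) g))); rewrite enum_rankK_in // eqxx.
have hI g : injective (h g).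
  case: (boolP (g \in K)) => Kg i j; last by rewrite /h (negbTE Kg).
  by move/(congr1 enum_val); rewrite !hE // => /act_inj/enum_val_inj.
pose f g : {perm 'I_#|S|} := perm (hI g).
have fM : {in K &, {morph f : x y / x * y}}.
  move=> x y Kx Ky; apply/permP => i; rewrite permM !permE; apply: enum_val_inj.
  by rewrite !hE ?groupM // actM.
pose fm := Morphism fM; have inj_f : 'injm fm.
  apply/subsetP => g; rewrite !inE => /andP[Kg /eqP f1]; rewrite (ffulK g) //.
  move=> x Sx; have := congr1 (fun s : {perm _} => s (enum_rank_in Sx x)) f1.
  by rewrite permE perm1 => /(congr1 enum_val); rewrite hE // enum_rankK_in.
by exists (fm @* K)%G; rewrite sub_isog.
Qed.

Lemma faithful_act_Sym (aT : finGroupType) (X : finType)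
    (to : {action aT &-> X}) (K : {group aT}) (S : {set X}) :
  [acts K, on S | to] ->
  (forall g, g \in K -> (forall x, x \in S -> to x g = x) -> g = 1) ->
  #|K| = #|S|`! -> K \isog 'Sym_('I_#|S|).
Proof.
move=> actKS ffulK oK; have [H isoH] := faithful_act_isog actKS ffulK.
suff <- : H :=: 'Sym_('I_#|S|) by [].
by apply/eqP; rewrite eqEcard subsetT card_Sym card_ord -(card_isog isoH) oK leqnn.
Qed.

Lemma faithful_act_Alt (aT : finGroupType) (X : finType)
    (to : {action aT &-> X}) (K : {group aT}) (S : {set X}) :
  [acts K, on S | to] ->
  (forall g, g \in K -> (forall x, x \in S -> to x g = x) -> g = 1) ->
  (#|K| * 2)%N = #|S|`! -> K \isog 'Alt_('I_#|S|).
Proof.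
move=> actKS ffulK oK; have [H isoH] := faithful_act_isog actKS ffulK.
suff <- : H :=: 'Alt_('I_#|S|) by [].
by apply: index2_Alt; rewrite card_ord -oK (card_isog isoH).
Qed.

(** For y outside C = <c>, the elements y and y c are distinct involutions that generate K. *)
Lemma dihedral_of_involutions (gT : finGroupType) (K C : {group gT}) :
  cyclic C -> C \subset K -> #|K : C| = 2 -> 1 < #|C| ->
  (forall g, g \in K -> g \notin C -> g ^+ 2 = 1) ->
  K \isog [set: extremal.dihedral_gtype #|C|.*2].
Proof.
case/cyclicP => c defC sCK iC C1 invol.
have oK : #|K| = #|C|.*2 by rewrite -(Lagrange sCK) iC muln2.
have [y Ky nCy] : exists2 y, y \in K & y \notin C.
  by apply/subsetPn; apply/negP => sKC; move: iC; rewrite (_ : #|K : C| = 1%N) //;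
     apply/eqP; rewrite indexg_eq1.
have Cc : c \in C by rewrite defC cycle_id.
have Kc : c \in K by rewrite (subsetP sCK).
have nCyc : y * c \notin C by rewrite groupMr.
have Kyc : y * c \in K by rewrite groupM.
have ord2 g : g \in K -> g \notin C -> #[g] = 2.
  move=> Kg nCg; apply: nt_prime_order => //; first exact: invol.
  by apply: contraNneq nCg => ->; exact: group1.
have nycy : y != y * c.
  rewrite -{1}(mulg1 y) (inj_eq (mulgI y)) eq_sym; apply: contraTneq C1 => c1.
  by rewrite defC c1 cycle1 cards1.
have sCG : C \subset <<[set y; y * c]>>.
  by rewrite defC cycle_subG -[X in X \in _](mulKg y c) groupM ?groupV // mem_gen // !inE eqxx
    ?orbT.
have := extremal.involutions_gen_dihedral (ord2 _ Ky nCy) (ord2 _ Kyc nCyc) nycy.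
set G := <<_>>; suff -> : G = K by rewrite oK.
have sGK : G \subset K by rewrite gen_subG subUset !sub1set Ky.
have Gy : y \in G by rewrite mem_gen // !inE eqxx.
apply/eqP; rewrite eqEcard sGK oK /=.
have := Lagrange sCG; set i := #|_ : _| => oG.
have i1 : i != 1%N.
  by apply: contra nCy; rewrite indexg_eq1 => sGC; exact: (subsetP sGC).
have : 0 < i by rewrite indexg_gt0.
rewrite -oG; move: i1; case: i {oG} => [|[|i]] // _ _.
by rewrite -muln2 leq_mul2l orbT.
Qed.

Lemma dihedral_gens (gT : finGroupType) (K : {group gT}) n : 1 < n ->
  K \isog [set: extremal.dihedral_gtype n.*2] -> exists x y,
  [/\ <[x]> \subset K, #|K : <[x]>| = 2, y \in K :\: <[x]>, y ^+ 2 = 1 & x ^ y = x^-1].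
Proof.
move=> n1 /(isoGrpP _ (extremal.Grp_dihedral n1)); rewrite extremal.card_dihedral //.
case=> oK /existsP[[x y]] /= /eqP[defK xn y2 xy].
have {}defK : <[x]> * <[y]> = K by rewrite -norm_joinEr // norms_cycle xy groupV cycle_id.
have lex : #[x] <= n by apply: dvdn_leq; [exact: ltnW|rewrite order_dvdn xn].
have nXy : y \notin <[x]>.
  apply/negP => Xy; have := oK; rewrite -defK mulGSid ?cycle_subG // -[#|_|]/(#[x]).
  by move: lex n1; lia.
have oy : #[y] = 2 by apply: nt_prime_order (group1_contra nXy).
have ox : (#[x] * 2)%N = #|K|.
  by rewrite -oy -defK TI_cardMg // setIC prime_TIg ?cycle_subG // -orderE oy.
have sXK : <[x]> \subset K by rewrite -defK mulG_subl.
exists x, y; split => //; last first.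
  by rewrite inE nXy -cycle_subG -defK mulG_subr.
by apply/eqP; rewrite -(eqn_pmul2l (order_gt0 x)) ox -(Lagrange sXK).
Qed.

(** Write z^2 = c^k with z outside K = <c>. Dividing z by c^(k/2), rounded down, leaves a square
    equal to 1 or c. The first is excluded, so the corrected element is a square root of c and
    generates G. *)
Lemma index2_noinv_cyclic (gT : finGroupType) (G K : {group gT}) :
  K \subset G -> #|G : K| = 2 -> abelian G -> cyclic K ->
  (forall g, g \in G -> g \notin K -> g ^+ 2 != 1) -> cyclic G.
Proof.
move=> sKG iGK /centsP cGG /cyclicP[c defK] noinv.
have [z Gz nKz] : exists2 z, z \in G & z \notin K.
  by apply/subsetPn; apply/negP => sGK; move: iGK; rewrite (_ : #|G : K| = 1%N) //;
     apply/eqP; rewrite indexg_eq1.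
have Kc i : c ^+ i \in K by rewrite defK mem_cycle.
have [k zk] : exists k, z ^+ 2 = c ^+ k.
  have : z ^+ 2 \in K by rewrite expgS expg1 (index2_mul sKG).
  by rewrite defK => /cycleP.
pose w := z * c ^- k./2.
have Gw : w \in G by rewrite groupM // groupV (subsetP sKG).
have nKw : w \notin K by rewrite groupMr ?groupV.
have w2 : w ^+ 2 = c ^+ odd k.
  have cc : commute z (c ^- k./2) by apply: cGG => //; rewrite groupV (subsetP sKG) ?Kc.
  rewrite (expgMn _ cc) zk -{1}(odd_double_half k) -muln2 expgD mulnC expgM.
  by rewrite expVgn -!expgM mulnC mulgK.
have ok : odd k by apply: contraTT (noinv w Gw nKw) => /negbTE ek; rewrite w2 ek negbK.
apply/cyclicP; exists w; apply/eqP; rewrite eq_sym eqEcard cycle_subG Gw /=.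
have sKw : K \subset <[w]> by rewrite defK cycle_subG -[c]expg1 -[1%N]/(nat_of_bool true) -ok -w2
  mem_cycle.
rewrite -(Lagrange sKG) iGK -(Lagrange sKw) leq_mul2l; apply/orP; right.
have : #|<[w]> : K| != 1%N by rewrite indexg_eq1 cycle_subG.
by have := indexg_gt0 <[w]> K; case: #|_ : _| => [|[|]].
Qed.

Lemma cyclic_involution_uniq (gT : finGroupType) (K : {group gT}) x y : cyclic K ->
  x \in K -> y \in K -> x ^+ 2 = 1 -> y ^+ 2 = 1 -> x != 1 -> y != 1 -> x = y.
Proof.
move=> cK Kx Ky x2 y2 x1 y1.
have o (z : gT) : z ^+ 2 = 1 -> z != 1 -> #[z] = 2 by move=> z2 z1; exact: nt_prime_order.
have : <[x]> == <[y]> :> {set gT}.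
  by rewrite (eq_subG_cyclic cK) ?cycle_subG //= -!orderE (o x) // (o y).
move=> /eqP E; have : x \in <[y]> by rewrite -E cycle_id.
by rewrite (cycle2g (o y y2 y1)) !inE (negbTE x1) => /eqP.
Qed.

End GroupFacts.

(** Divided by n, the sum of the orbit sizes is the classical equation 1/n1 + 1/n2 + 1/n3 = 1 + 2/n;
    the ordering of the orbits makes n1 the smallest stabilizer order. *)
Lemma three_orbits_arith n o1 o2 o3 n1 n2 n3 :
  o1 * n1 = n -> o2 * n2 = n -> o3 * n3 = n -> o1 + o2 + o3 = n + 2 ->
  1 < n1 -> 1 < n2 -> 1 < n3 -> o2 <= o1 -> o3 <= o2 ->
  n1 = 2 /\ ((n2 = 2 /\ n = n3.*2) \/
    n2 = 3 /\ (n3 = 3 /\ n = 12 \/ n3 = 4 /\ n = 24 \/ n3 = 5 /\ n = 60)).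
Proof.
move=> e1 e2 e3 s n11 n21 n31 l21 l32.
have n12 : n1 = 2.
  by have [|?] := leqP n1 2; [lia | exfalso; have : 3 * o1 <= o1 * n1 by nia]; lia.
split => //; subst n1.
have [n2_2|n2_3] := leqP n2 2; first left.
  have ? : n2 = 2 by lia.
  have o32 : o3 = 2 by subst n2; lia.
  by subst o3; rewrite -muln2; split=> //; lia.
right; have n23 : n2 = 3.
  have [|?] := leqP n2 3; first lia.
  have n2o2 : 4 * o2 <= o2 * n2 by nia.
  by exfalso; lia.
split => //; subst n2; have : n3 < 6.
  have [//|?] := ltnP n3 6.
  have n3o3 : 6 * o3 <= o3 * n3 by nia.
  by exfalso; lia.
by move: n31 e3; case: n3 => [|[|[|[|[|[|]]]]]] //; lia.
Qed.

(** * Counting the poles of a finite rotation group *)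

Section Poles.
Local Open Scope group_scope.
Import GroupScope.
Variables (aT : finGroupType) (X : finType) (D : {group aT}) (to : action D X).
Variable (alpha : X -> X).

(* The combinatorial properties of the action of a finite rotation group on its
   poles, the points of the sphere lying on the axis of a nontrivial element. *)
Record pole_action (K : {group aT}) : Prop := PoleAction {
  pole_dom : K \subset D;
  pole_fix : forall g, g \in K -> g != 1 -> exists x, forall y,
    (to y g == y) = (y == x) || (y == alpha x);
  pole_stab : forall x, exists g, [/\ g \in K, g != 1 & to x g = x];
  pole_cyclic : forall x, cyclic 'C_K[x | to];
  pole_alphaN : forall x, alpha x != x;
  pole_alphaK : forall x, alpha (alpha x) = x;
  pole_alphaJ : forall x g, g \in K -> to (alpha x) g = alpha (to x g);
  pole_flip : forall x g, g \in K -> to x g = alpha x -> g ^+ 2 = 1 }.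

Variable K : {group aT}.
Hypothesis poleK : pole_action K.
Implicit Types (x y : X) (g h : aT).

Let sKD : K \subset D := pole_dom poleK.

Lemma mem_stab x g : (g \in 'C_K[x | to]) = (g \in K) && (to x g == x).
Proof.
rewrite !inE sub1set inE; case: (boolP (g \in K)) => //= Kg.
by rewrite (subsetP sKD).
Qed.

Lemma fix_pole x y g : g \in K -> g != 1 -> to x g = x ->
  (to y g == y) = (y == x) || (y == alpha x).
Proof.
move=> Kg g1 xg; have [z zP] := pole_fix poleK Kg g1.
rewrite zP; have := zP x; rewrite xg eqxx => /esym/orP[] /eqP -> //.
by rewrite (pole_alphaK poleK) orbC.
Qed.

Lemma stab_alpha x : 'C_K[alpha x | to] = 'C_K[x | to].
Proof.
apply/setP => g; rewrite !mem_stab; case: (boolP (g \in K)) => //= Kg.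
rewrite (pole_alphaJ poleK) // (can_eq (pole_alphaK poleK)) //.
Qed.

Lemma stab_gt1 x : 1 < #|'C_K[x | to]|.
Proof.
have [g [Kg g1 xg]] := pole_stab poleK x.
rewrite cardG_gt1; apply/trivgPn; exists g => //.
by rewrite mem_stab Kg xg eqxx.
Qed.

Lemma orbit_stab x : (#|orbit to K x| * #|'C_K[x | to]|)%N = #|K|.
Proof. exact: card_orbit_in_stab. Qed.

Lemma acts_poles : [acts K, on [set: X] | to].
Proof.
by apply/subsetP => g Kg; rewrite !inE (subsetP sKD) //=; apply/subsetP => x; rewrite !inE.
Qed.

(** The identity fixes all poles and every other element exactly two. *)
Lemma Burnside_poles : (#|X| + 2 * #|K|.-1)%N = (#|orbit to K @: [set: X]| * #|K|)%N.
Proof.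
rewrite -(Frobenius_Cauchy acts_poles) (big_setD1 1) //=; congr (_ + _)%N.
  by rewrite -cardsT; apply: eq_card => x; rewrite !inE sub1set inE act1 eqxx.
rewrite (eq_bigr (fun=> 2)); last first.
  move=> g /setD1P[g1 Kg]; have [x xP] := pole_fix poleK Kg g1.
  rewrite (_ : 'Fix_([set: X] | to)[g] = [set x; alpha x]).
    by rewrite cards2 eq_sym (pole_alphaN poleK).
  by apply/setP => y; rewrite !inE sub1set inE xP.
by rewrite sum_nat_const mulnC (cardsD1 1 K) group1.
Qed.

Lemma sum_orbits_poles : #|X| = \sum_(O in orbit to K @: [set: X]) #|O|.
Proof. by rewrite -cardsT; exact: card_partition (orbit_partition acts_poles). Qed.

(** Stabilizers are nontrivial, so r orbits have at most r |K| / 2 points in all. Against the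
    Burnside count this leaves only r = 2, with two fixed poles, and r = 3. *)
Lemma orbits_pole_action : K :!=: 1 ->
  (#|X| = 2 /\ cyclic K) \/
  (#|X| = (#|K| + 2)%N /\ #|orbit to K @: [set: X]| = 3).
Proof.
rewrite -cardG_gt1 => K1; have B := Burnside_poles.
have S2 : (2 * #|X| <= #|orbit to K @: [set: X]| * #|K|)%N.
  rewrite sum_orbits_poles big_distrr /= -sum_nat_const; apply: leq_sum.
  move=> _ /imsetP[x _ ->]; rewrite -(orbit_stab x) mulnC leq_mul2l stab_gt1 orbT //.
have X0 : 0 < #|X|.
  have /trivgPn[g Kg g1] : K :!=: 1 by rewrite -cardG_gt1.
  by have [x _] := pole_fix poleK Kg g1; apply/card_gt0P; exists x.
move: B S2; case E : #|orbit to K @: [set: X]| => [|[|[|[|r]]]] B S2.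
- by exfalso; lia.
- by exfalso; lia.
- left; have X2 : #|X| = 2 by lia.
  split => //; have [x _] : exists x : X, true by case/card_gt0P: X0 => x; exists x.
  suff -> : K :=: 'C_K[x | to] by exact: pole_cyclic.
  apply/eqP; rewrite eq_sym eqEcard subsetIl /= -(orbit_stab x).
  suff -> : #|orbit to K x| = 1%N by rewrite mul1n.
  have := sum_orbits_poles; rewrite X2.
  rewrite (big_setD1 (orbit to K x)) ?imset_f //=.
  have : #|(orbit to K @: [set: X]) :\ orbit to K x| = 1%N.
    by have := cardsD1 (orbit to K x) (orbit to K @: [set: X]); rewrite E imset_f //= => -[].
  case/eqP/cards1P => O EO; rewrite EO big_set1.
  have : O \in orbit to K @: [set: X].
    have : O \in (orbit to K @: [set: X]) :\ orbit to K x by rewrite EO set11.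
    by case/setD1P.
  case/imsetP => y _ ->; have o1 : 0 < #|orbit to K x|.
    by apply/card_gt0P; exists x; exact: orbit_refl.
  have o2 : 0 < #|orbit to K y| by apply/card_gt0P; exists y; exact: orbit_refl.
  lia.
- by right; split => //; lia.
- by exfalso; move: B S2; move: #|X| #|K| X0 K1 => u v; nia.
Qed.

Lemma three_orbits : #|orbit to K @: [set: X]| = 3 -> exists x1 x2 x3,
  [/\ forall x, [|| x \in orbit to K x1, x \in orbit to K x2 | x \in orbit to K x3],
      #|X| = (#|orbit to K x1| + #|orbit to K x2| + #|orbit to K x3|)%N,
      #|orbit to K x2| <= #|orbit to K x1| & #|orbit to K x3| <= #|orbit to K x2|].
Proof.
set S := orbit to K @: [set: X] => S3.
pose ge (A B : {set X}) := #|B| <= #|A|.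
pose s := sort ge (enum S).
have ge_tot : total ge by move=> A B; exact: leq_total.
have sP : sorted ge s by exact: sort_sorted.
have ms O : (O \in s) = (O \in S) by rewrite mem_sort mem_enum.
have us : \sum_(O <- s) #|O| = #|X|.
  rewrite sum_orbits_poles -/S -big_enum /=.
  by apply: perm_big; rewrite perm_sort.
have : size s = 3 by rewrite size_sort -cardE.
case: s sP ms us => [|O1 [|O2 [|O3 [|]]]] //= /and3P[ge12 ge23 _] ms.
rewrite !big_cons big_nil addn0 addnA => sX _.
have im O : O \in S -> exists x, O = orbit to K x by case/imsetP => x; exists x.
have [|x1 E1] := im O1; first by rewrite -ms !inE eqxx.
have [|x2 E2] := im O2; first by rewrite -ms !inE eqxx orbT.
have [|x3 E3] := im O3; first by rewrite -ms !inE eqxx !orbT.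
exists x1, x2, x3; rewrite -E1 -E2 -E3; split => // x.
have : orbit to K x \in S by rewrite imset_f.
by rewrite -ms !inE => /or3P[] /eqP <-; rewrite orbit_refl ?orbT.
Qed.


Lemma stab_orbit x y : y \in orbit to K x -> exists2 g, g \in K &
  'C_K[y | to] = 'C_K[x | to] :^ g.
Proof.
case/orbitP => g Kg <-; exists g => //.
by rewrite astab1_act_in ?(subsetP sKD) // -{1}(conjGid Kg) -conjIg.
Qed.

Lemma card_stab_orbit x y : y \in orbit to K x -> #|'C_K[y | to]| = #|'C_K[x | to]|.
Proof. by case/stab_orbit => g _ ->; rewrite cardJg. Qed.

Lemma mem_some_stab g : g \in K -> g != 1 -> exists x, g \in 'C_K[x | to].
Proof.
move=> Kg g1; have [x xP] := pole_fix poleK Kg g1.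
by exists x; rewrite mem_stab Kg xP eqxx.
Qed.

Lemma pole_flip_mul x g h : g \in K -> h \in 'C_K[x | to] -> to x g = alpha x ->
  (g * h) ^+ 2 = 1.
Proof.
rewrite mem_stab => Kg /andP[Kh /eqP xh] xg; apply: (pole_flip poleK (x := x)).
  by rewrite groupM.
by rewrite actMin ?(subsetP sKD) // xg (pole_alphaJ poleK) // xh.
Qed.

(** The stabilizer C of x3 has index 2, and every g outside it is an involution: this is clear if g
    sends x3 to its antipode. Otherwise the antipode lies in one of the other two orbits, so C has
    order 2 like all the other stabilizers, and g lies in one of them. *)
Lemma dihedral_poles x1 x2 x3 :
  (forall x, [|| x \in orbit to K x1, x \in orbit to K x2 | x \in orbit to K x3]) ->
  #|'C_K[x1 | to]| = 2 -> #|'C_K[x2 | to]| = 2 -> #|K| = #|'C_K[x3 | to]|.*2 ->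
  exists2 n, 1 < n & K \isog [set: extremal.dihedral_gtype n.*2].
Proof.
move=> cov n1 n2 oK; have c1 := stab_gt1 x3.
have sC : 'C_K[x3 | to] \subset K by exact: subsetIl.
have iC : #|K : 'C_K[x3 | to]| = 2.
  apply/eqP; rewrite -(eqn_pmul2l (ltnW c1)).
  by rewrite (Lagrange sC) oK muln2.
exists #|'C_K[x3 | to]| => //.
apply: (dihedral_of_involutions (pole_cyclic poleK x3)) => // g Kg.
rewrite mem_stab Kg /= => nxg.
have [fl|nfl] := eqVneq (to x3 g) (alpha x3); first exact: (pole_flip poleK Kg fl).
have orb : orbit to K x3 = [set x3; to x3 g].
  apply/eqP; rewrite eq_sym eqEcard subUset !sub1set orbit_refl mem_orbit //=.
  by rewrite cards2 eq_sym nxg card_orbit_in // iC.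
have nal : alpha x3 \notin orbit to K x3.
  by rewrite orb !inE (negbTE (pole_alphaN poleK x3)) eq_sym.
have m2 : #|'C_K[x3 | to]| = 2.
  rewrite -stab_alpha; have := cov (alpha x3); rewrite (negbTE nal) orbF.
  by case/orP => /card_stab_orbit ->.
have g1 : g != 1 by apply: contraNneq nxg => ->; rewrite act1.
have [x Cg] := mem_some_stab Kg g1.
have : #|'C_K[x | to]| = 2.
  by case/or3P: (cov x) => /card_stab_orbit ->.
by move=> o2; apply/eqP; rewrite -order_dvdn -o2 order_dvdG.
Qed.

Lemma normal_stab (N : {group aT}) x y : N <| K -> 'C_K[x | to] \subset N ->
  y \in orbit to K x -> 'C_K[y | to] \subset N.
Proof.
case/andP=> _ nN sCN /stab_orbit[g Kg ->].
by rewrite -(normP (subsetP nN g Kg)) conjSg.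
Qed.

(* Counting the pairs (g, y) with g in N nontrivial and y in the orbit of x
   fixed by g: each g fixes at most two points, each y is fixed by C_K[y]. *)
Lemma card_normal_stab (N : {group aT}) x : N <| K -> 'C_K[x | to] \subset N ->
  (#|orbit to K x| * #|'C_K[x | to]|.-1 <= 2 * #|N|.-1)%N.
Proof.
move=> nN sCN; have [sNK nNK] := andP nN.
have E : \sum_(y in orbit to K x) \sum_(g in N^# | g \in 'C_K[y | to]) 1 =
    (#|orbit to K x| * #|'C_K[x | to]|.-1)%N.
  rewrite -sum_nat_const; apply: eq_bigr => y Oy.
  rewrite -(card_stab_orbit Oy) sum1dep_card (cardsD1 1 'C_K[y | to]) group1 /=.
  apply: eq_card => g; rewrite !inE; have sy := subsetP (normal_stab nN sCN Oy) g.
  by case: (boolP (g == 1)) => //= _; apply/andP/idP => [[]//|Cg]; split => //;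
    apply: sy; rewrite !inE.
rewrite -E (exchange_big_dep (fun g => g \in N^#)) /=; last by move=> ? ? _ /andP[].
have -> : (2 * #|N|.-1 = \sum_(g in N^#) 2)%N.
  by rewrite sum_nat_const mulnC (cardsD1 1 N) group1.
apply: leq_sum => g /setD1P[g1 Ng]; have Kg := subsetP sNK g Ng.
have [z zP] := pole_fix poleK Kg g1.
rewrite sum1dep_card; apply: leq_trans (_ : #|[set z; alpha z]| <= 2).
  apply: subset_leq_card; apply/subsetP => y; rewrite !inE => /andP[_ /andP[_]].
  by rewrite -zP => /andP[_ /andP[_]]; rewrite sub1set inE.
by rewrite cards2; case: (_ != _).
Qed.


(** N is the kernel of conjugation on the Sylow subgroups; the inclusion in a normalizer bounds its
    order when faithfulness is tested. *)
Lemma Syl_conj_kernel p (P : {group aT}) g : p.-Sylow(K) P -> g \in K ->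
  (forall Q, Q \in 'Syl_p(K) -> 'JG%act Q g = Q) ->
  exists N : {group aT}, [/\ N <| K, g \in N & N \subset 'N_K(P)].
Proof.
move=> sylP Kg fg; exists ('C_K('Syl_p(K) | 'JG))%G.
have act : [acts K, on 'Syl_p(K) | 'JG] by exact: (atrans_acts (Syl_trans p K)).
split.
- rewrite /normal subsetIl normsI ?normG //.
  by apply: subset_trans act _; exact: astab_norm.
- by rewrite inE Kg; apply/astabP => Q /fg.
- apply/subsetP => k /setIP[Kk /astabP /(_ P)]; rewrite inE sylP => /(_ isT) /(congr1 val) /= E.
  by rewrite in_setI Kk; apply/normP.
Qed.

(** The Sylow congruence leaves 1 or 4 subgroups. A single one would be normal of order 3, which
    [card_normal_stab] forbids because the orbit of x has 4 or 8 points. *)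
Lemma poles_Syl3 x : #|'C_K[x | to]| = 3 -> #|K| = 12 \/ #|K| = 24 ->
  #|'Syl_3(K)| = 4 /\ forall g, g \in K ->
    (forall P, P \in 'Syl_3(K) -> ('JG%act P g = P)) -> g = 1.
Proof.
move=> o3 oK; pose P := 'C_K[x | to]%G.
have sylP : 3.-Sylow(K) P.
  by rewrite pHallE subsetIl /= o3; case: oK => ->; rewrite p_part.
have oO : (#|orbit to K x| * 3)%N = #|K| by rewrite -o3 orbit_stab.
have n3 : #|'Syl_3(K)| = 4.
  have := @card_Syl_mod 3 _ K isT; have := @card_Syl_dvd 3 _ K.
  case n31 : (#|'Syl_3(K)| == 1%N).
    move=> _ _; have nP : P <| K.
      have := card_Syl sylP; rewrite (eqP n31) => /esym/eqP.
      rewrite indexg_eq1 subsetI subxx /= => nKP.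
      by rewrite /normal subsetIl.
    have := card_normal_stab nP (subxx _).
    have oP : #|P| = 3 by exact: o3.
    rewrite oP ?o3 => le; exfalso; move: oO le.
    by case: oK => ->; move: #|orbit to K x| => o /=; lia.
  move: n31; move: #|'Syl_3(K)| => n n1 dn mn.
  have n24 : n %| 24 by case: oK dn => -> // /dvdn_trans; exact.
  have : n \in divisors 24 by rewrite -dvdn_divisors.
  rewrite (_ : divisors 24 = [:: 1; 2; 3; 4; 6; 8; 12; 24]%N) //.
  by rewrite !inE => /or4P[/eqP e|/eqP e|/eqP e|/or4P[/eqP //|/eqP e|/eqP e|/orP[]/eqP e]];
    move: mn n1; rewrite e.
split => // g Kg fg; apply/eqP/negPn/negP => g1.
have [N [nN Ng sNP]] := Syl_conj_kernel sylP Kg fg.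
(* N has order at most |K| / 4, too small to contain the stabilizer by [card_normal_stab]. *)
have nPN : ~~ ('C_K[x | to] \subset N).
  apply/negP => /(card_normal_stab nN); have := subset_leq_card sNP.
  have := card_Syl sylP; rewrite n3 => iN.
  have := Lagrange (subsetIl K 'N(P)); rewrite -iN o3 /=.
  by case: oK oO => ->; move: #|'N_K(_)| #|N| #|orbit to K x|; clear; lia.
have prP : prime #|'C_K[x | to]| by rewrite o3.
have NP1 h : h \in N -> h \in 'C_K[x | to] -> h = 1.
  move=> Nh Ph; apply/eqP/negPn/negP => h1; case/negP: nPN.
  case: (prime_subgroupVti N prP) => // /setP/(_ h).
  by rewrite inE Nh Ph inE (negbTE h1).
have /trivgPn[h Ph h1] : 'C_K[x | to] :!=: 1 by rewrite -cardG_gt1 o3.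
(* As g normalizes P, it permutes the two poles of h. Either it fixes x, and then lies in N and in
   P, or it exchanges x with its antipode. *)
have := Ph; rewrite mem_stab => /andP[Kh /eqP xh].
have nPg : P :^ g = P by have := fg P; rewrite inE => /(_ sylP) /(congr1 val).
have : h \in 'C_K[to x g | to].
  have -> : 'C_K[to x g | to] = 'C_K[x | to] :^ g.
    by rewrite astab1_act_in ?(subsetP sKD) // -{1}(conjGid Kg) -conjIg.
  by rewrite nPg.
rewrite mem_stab => /andP[_]; rewrite (fix_pole _ Kh h1 xh) => /orP[] /eqP xg.
  by move: g1; rewrite (NP1 g) ?eqxx // mem_stab Kg xg eqxx.
have g2 := pole_flip poleK Kg xg; have gh2 := pole_flip_mul Kg Ph xg.
have h3 : h ^+ 3 = 1 by rewrite -o3; apply/eqP; rewrite -order_dvdn order_dvdG.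
move: h1; rewrite (NP1 h) ?eqxx //.
(* Both g and g h are involutions, so g inverts h. Since h has order 3, it is the product of g and a
   conjugate of g, hence an element of N. *)
have -> : h = g * (g ^ h^-1).
  apply/esym; rewrite conjgE invgK !mulgA.
  move: gh2; rewrite expgS expg1 !mulgA => /(canRL (mulgK _)); rewrite mul1g => ->.
  by apply: (mulIg (h * h)); rewrite mulgA mulgKV mulVg -h3 !expgS expg0 mulg1.
by rewrite groupM // memJ_norm ?groupV // (subsetP (normal_norm nN)).
Qed.

(** All stabilizers have prime order, and all involutions fix poles of the single orbit of x1. The
    involutions are counted once as a conjugacy class and once as a disjoint union over the Sylow
    2-subgroups, three in each. *)
Lemma poles_Syl2 x1 x2 x3 :
  (forall x, [|| x \in orbit to K x1, x \in orbit to K x2 | x \in orbit to K x3]) ->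
  #|'C_K[x1 | to]| = 2 -> #|'C_K[x2 | to]| = 3 -> #|'C_K[x3 | to]| = 5 -> #|K| = 60 ->
  #|'Syl_2(K)| = 5 /\ forall g, g \in K ->
    (forall P, P \in 'Syl_2(K) -> ('JG%act P g = P)) -> g = 1.
Proof.
move=> cov n1 n2 n3 oK.
have covn y : #|'C_K[y | to]| = 2 /\ y \in orbit to K x1 \/
    #|'C_K[y | to]| = 3 \/ #|'C_K[y | to]| = 5.
  by case/or3P: (cov y) => Oy; rewrite (card_stab_orbit Oy); [left|right; left|right; right].
have cyc g y : g \in 'C_K[y | to] -> g != 1 -> 'C_K[y | to] = <[g]>.
  move=> Cg g1; have pr : prime #|'C_K[y | to]|.
    by case: (covn y) => [[-> _]|[|] ->].
  apply/eqP; rewrite eq_sym eqEcard cycle_subG Cg /=.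
  have /primeP[_ /(_ _ (order_dvdG Cg))] := pr.
  by rewrite order_eq1 (negbTE g1) /= => /eqP <-.
have invE g : g \in K -> #[g] = 2 -> exists y, [/\ g \in 'C_K[y | to],
    'C_K[y | to] = <[g]> & y \in orbit to K x1].
  move=> Kg g2; have g1 : g != 1 by rewrite -order_gt1 g2.
  have [y Cg] := mem_some_stab Kg g1; exists y; rewrite Cg (cyc _ _ Cg g1).
  split => //; case: (covn y) => [[]//|]; rewrite (cyc _ _ Cg g1) -[#|_|]/(#[g]) g2.
  by case.
(* The centralizer permutes the two poles of g, and the stabilizer of a pole is <g>, of order 2. *)
have centle g : g \in K -> #[g] = 2 -> #|'C_K[g]| <= 4.
  move=> Kg g2; have [y [Cg defC _]] := invE g Kg g2.
  have g1 : g != 1 by rewrite -order_gt1 g2.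
  have := Cg; rewrite mem_stab => /andP[_ /eqP yg].
  have sCD : 'C_K[g] \subset D by rewrite (subset_trans _ sKD) // subsetIl.
  rewrite -(card_orbit_in_stab to y sCD); apply: (@leq_mul _ _ 2 2).
    apply: leq_trans (_ : #|[set y; alpha y]| <= 2); last first.
      by rewrite cards2; case: (_ != _).
    apply: subset_leq_card; apply/subsetP => _ /orbitP[c /setIP[Kc /cent1P cgc] <-].
    rewrite !inE -(fix_pole _ Kg g1 yg); apply/eqP.
    by rewrite -actMin ?(subsetP sKD) // cgc actMin ?(subsetP sKD) // yg.
  rewrite -g2 -[#[g]]/#|<[g]>| -defC subset_leq_card //.
  by apply: setSI; exact: subsetIl.
(* V has order 4, so it is abelian and fills the centralizer of each of its involutions; distinct
   Sylow 2-subgroups therefore share no involution. *)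
have sylE (V : {group aT}) g : 2.-Sylow(K) V -> g \in V -> #[g] = 2 -> 'C_K[g] = V.
  move=> sylV Vg g2; have sVK := pHall_sub sylV.
  have oV : #|V| = 4 by rewrite (card_Hall sylV) oK p_part.
  apply/eqP; rewrite eq_sym eqEcard oV centle ?(subsetP sVK) // andbT.
  rewrite subsetI sVK sub_cent1 (subsetP _ _ Vg) //.
  by rewrite -/(abelian V); exact: (@card_p2group_abelian _ 2).
pose I := [set g in K | #[g] == 2].
have fI g : g \in I -> ('C_K[g])%G \in 'Syl_2(K).
  rewrite !inE => /andP[Kg /eqP g2].
  have p2 : 2.-group <[g]> by rewrite /pgroup -[#|_|]/(#[g]) g2.
  have sgK : <[g]> \subset K by rewrite cycle_subG.
  have [V sylV sgV] := Sylow_superset sgK p2.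
  suff -> : ('C_K[g])%G = V by [].
  by apply/val_inj => /=; apply: sylE => //; rewrite -cycle_subG.
have cardI : #|I| = (#|'Syl_2(K)| * 3)%N.
  rewrite -sum1_card (partition_big (fun g => 'C_K[g]%G) (mem 'Syl_2(K))) //=.
  rewrite -sum_nat_const; apply: eq_bigr => V; rewrite inE => sylV.
  have oV : #|V| = 4 by rewrite (card_Hall sylV) oK p_part.
  rewrite sum1dep_card (_ : 3 = #|V^#|); last first.
    by have := cardsD1 1 V; rewrite group1 oV => -[].
  apply: eq_card => g; rewrite !inE; apply/andP/andP => [[/andP[Kg g2] /eqP CV]|[g1 Vg]].
    rewrite -order_gt1 (eqP g2); split => //.
    by rewrite -CV inE Kg cent1id.
  have Kg := subsetP (pHall_sub sylV) g Vg.
  have g2 : #[g] = 2.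
    have [y Cg] := mem_some_stab Kg g1; have := order_dvdG Vg; rewrite oV.
    case: (covn y); rewrite (cyc _ _ Cg g1) -[#|_|]/(#[g]); first by case.
    by case=> ->.
  by rewrite Kg g2; split => //; apply/eqP/val_inj => /=; exact: sylE.
have [g0 [Kg0 g02]] : exists g, g \in K /\ #[g] = 2.
  have [g [Kg g1 xg]] := pole_stab poleK x1; exists g; split => //.
  have Cg : g \in 'C_K[x1 | to] by rewrite mem_stab Kg xg eqxx.
  by rewrite -n1 (cyc _ _ Cg g1).
have g0I : g0 \in I by rewrite inE Kg0 g02.
have o4 : #|'C_K[g0]| = 4.
  by have := fI _ g0I; rewrite inE => /card_Hall /= ->; rewrite oK p_part.
(* The involutions form one class: their poles lie in one orbit, and an involution is the only
   nontrivial element of its pole stabilizer. *)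
have I15 : #|I| = 15.
  have -> : I = g0 ^: K.
    apply/setP => g; apply/idP/imsetP => [|[k Kk ->]]; last first.
      by rewrite inE orderJ g02 groupJ.
    rewrite inE => /andP[Kg /eqP g2].
    have [y [_ defC Oy]] := invE g Kg g2; have [y0 [_ defC0 Oy0]] := invE g0 Kg0 g02.
    have [k Kk] : exists2 k, k \in K & 'C_K[y | to] = 'C_K[y0 | to] :^ k.
      apply: stab_orbit; rewrite orbit_in_sym //.
      by apply: (orbit_in_trans sKD Oy0); rewrite orbit_in_sym.
    rewrite defC defC0 -cycleJ => E; exists k => //.
    have : g \in <[g0 ^ k]> by rewrite -E cycle_id.
    by rewrite cycle2g ?orderJ // !inE -order_eq1 g2 /= => /eqP.
  apply/eqP; rewrite -index_cent1 -(eqn_pmul2l (isT : 0 < 4)) -{1}o4.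
  by rewrite (Lagrange (subsetIl _ _)) oK.
have n5 : #|'Syl_2(K)| = 5 by move: cardI; rewrite I15; lia.
split => // g Kg fg; apply/eqP/negPn/negP => g1.
have [V sylV] := Sylow_exists 2 K.
have [N [nN Ng sNV]] := Syl_conj_kernel sylV Kg fg.
(* The normalizer has index 5. A stabilizer of order p inside N would need (60 / p) (p - 1) <= 22,
   which fails for p = 2, 3, 5. *)
have N12 : #|N| <= 12.
  apply: leq_trans (subset_leq_card sNV) _.
  have := card_Syl sylV; rewrite n5 => i5.
  by have := Lagrange (subsetIl K 'N(V)); rewrite -i5 oK; move: #|'N_K(V)|; clear; lia.
have [y Cg] := mem_some_stab Kg g1.
have sCN : 'C_K[y | to] \subset N by rewrite (cyc _ _ Cg g1) cycle_subG.
have := card_normal_stab nN sCN; have := orbit_stab y; rewrite oK.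
by move: N12; case: (covn y) => [[-> _]|[|] ->]; move: #|orbit to K y| #|N|; clear; lia.
Qed.

Theorem polyhedral_poles : cyclic K
  \/ (exists2 n, 1 < n & K \isog [set: extremal.dihedral_gtype n.*2])
  \/ K \isog 'Alt_('I_4) \/ K \isog 'Sym_('I_4) \/ K \isog 'Alt_('I_5).
Proof.
have [K1|ntK] := eqVneq K 1%G; first by rewrite K1 cyclic1; left.
have [[_ cK]|[oX o3]] := orbits_pole_action ntK; first by left.
have [x1 [x2 [x3 [cov sX l12 l23]]]] := three_orbits o3.
have := three_orbits_arith (orbit_stab x1) (orbit_stab x2) (orbit_stab x3).
rewrite -sX oX => /(_ erefl (stab_gt1 _) (stab_gt1 _) (stab_gt1 _) l12 l23).
case=> n1 [[n2 oK]|[n2 H]].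
  by right; left; exact: dihedral_poles cov n1 n2 oK.
have act p : [acts K, on 'Syl_p(K) | 'JG] by exact: (atrans_acts (Syl_trans p K)).
have s3 : #|K| = 12 \/ #|K| = 24 -> #|'Syl_3(K)| = 4 /\ forall g, g \in K ->
    (forall P, P \in 'Syl_3(K) -> ('JG%act P g = P)) -> g = 1.
  exact: poles_Syl3 n2.
case: H => [[n3 oK]|[[n3 oK]|[n3 oK]]].
- have [|s4 ffl] := s3; first by left.
  do 2 right; left; have := faithful_act_Alt (act 3) ffl.
  by rewrite s4; apply; rewrite oK.
- have [|s4 ffl] := s3; first by right.
  do 3 right; left; have := faithful_act_Sym (act 3) ffl.
  by rewrite s4; apply; rewrite oK.
- have [s5 ffl] := poles_Syl2 cov n1 n2 n3 oK.
  do 4 right; have := faithful_act_Alt (act 2) ffl.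
  by rewrite s5; apply; rewrite oK.
Qed.

(** With three orbits some pole stabilizer has order 2. Its involution z is central, so K permutes
    the two poles of z; an element exchanging them would be an involution, hence z itself, which
    fixes them. So K is a stabilizer. *)
Lemma poles_uniq_involution :
  (forall g h, g \in K -> h \in K -> #[g] = 2 -> #[h] = 2 -> g = h) -> cyclic K.
Proof.
move=> uinv; have [K1|ntK] := eqVneq K 1%G; first by rewrite K1 cyclic1.
have [[_]//|[oX o3]] := orbits_pole_action ntK.
have [x1 [x2 [x3 [_ sX l12 l23]]]] := three_orbits o3.
have := three_orbits_arith (orbit_stab x1) (orbit_stab x2) (orbit_stab x3).
rewrite -sX oX => /(_ erefl (stab_gt1 _) (stab_gt1 _) (stab_gt1 _) l12 l23) [n1 _].
have /trivgPn[z Cz z1] : 'C_K[x1 | to] :!=: 1 by rewrite -cardG_gt1 n1.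
have oz : #[z] = 2.
  apply: nt_prime_order => //.
  by apply/eqP; rewrite -order_dvdn -n1 order_dvdG.
have := Cz; rewrite mem_stab => /andP[Kz /eqP xz].
suff -> : K :=: 'C_K[x1 | to] by exact: pole_cyclic.
apply/setP => g; rewrite mem_stab; case: (boolP (g \in K)) => //= Kg.
have zg : z ^ g = z by apply: uinv => //; rewrite ?groupJ ?orderJ.
have : to (to x1 g) z = to x1 g.
  by rewrite -actMin ?(subsetP sKD) // -{1}zg conjgE !mulgA mulgV mul1g
    actMin ?(subsetP sKD) // xz.
move/eqP; rewrite (fix_pole _ Kz z1 xz) => /orP[->//|/eqP xg].
have g1 : g != 1.
  by apply: contraNneq (pole_alphaN poleK x1) => g1; rewrite -xg g1 act1.
have : g = z by apply: uinv => //; apply: nt_prime_order => //; exact: (pole_flip poleK Kg xg).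
by move=> gz; move: (pole_alphaN poleK x1); rewrite -xg gz xz eqxx.
Qed.

End Poles.

Section PoleSubgroup.
Local Open Scope group_scope.
Import GroupScope.
Variables (aT : finGroupType) (X : finType) (D : {group aT}) (to : action D X).
Variables (alpha : X -> X) (K : {group aT}).
Hypothesis poleK : pole_action to alpha K.
Let sKD : K \subset D := pole_dom poleK.

Lemma pole_actionS (H : {group aT}) : H \subset K ->
  (forall x, exists g, [/\ g \in H, g != 1 & to x g = x]) -> pole_action to alpha H.
Proof.
move=> sHK stabH; have sub := subsetP sHK; case: (poleK) => *; split => //.
- exact: subset_trans sHK _.
- by move=> g /sub; eauto.
- by move=> x; apply: cyclicS (pole_cyclic poleK x); exact: setSI.
- by move=> x g /sub; eauto.
- by move=> x g /sub; eauto.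
Qed.

(** Squares of elements outside H are nontrivial elements of H, so H has the same poles as K. But a
    noncyclic K has |K| + 2 poles, more than H can have. *)
Lemma poles_index2 (H : {group aT}) : H \subset K -> #|K : H| = 2 ->
  (forall g, g \in K -> g \notin H -> g ^+ 2 != 1) -> cyclic K.
Proof.
move=> sHK iHK noinv; have sq g : g \in K -> g \notin H -> g ^+ 2 \in H.
  by move=> Kg nHg; rewrite expgS expg1; exact: (index2_mul sHK).
have oK : #|K| = (#|H| * 2)%N by rewrite -iHK Lagrange.
have poleH : pole_action to alpha H.
  apply: pole_actionS => // x; have [g [Kg g1 xg]] := pole_stab poleK x.
  case: (boolP (g \in H)) => [Hg|nHg]; first by exists g.
  exists (g ^+ 2); split; [exact: sq|exact: noinv|].
  by rewrite expgS expg1 actMin ?(subsetP sKD) // xg.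
have ntH : H :!=: 1.
  apply/eqP => H1; have [g Kg nHg] : exists2 g, g \in K & g \notin H.
    by apply/subsetPn; apply/negP => sKH; move: iHK; rewrite (_ : #|K : H| = 1%N) //;
      apply/eqP; rewrite indexg_eq1.
  by have := sq g Kg nHg; rewrite H1 inE (negbTE (noinv g Kg nHg)).
have ntK : K :!=: 1 by apply: contra ntH => /eqP K1; rewrite -subG1 -K1.
have [[_]//|[oX _]] := orbits_pole_action poleK ntK.
have H0 := cardG_gt0 H.
by case: (orbits_pole_action poleH ntH) => [[oX2 _]|[oX2 _]]; exfalso; lia.
Qed.

End PoleSubgroup.

(** * Faithful orthogonal representations in dimension three *)

Section OrthRep.
Local Open Scope ring_scope.
Variables (R : rcfType) (gT : finGroupType).
Implicit Types (K H : {group gT}) (rho : gT -> 'M[R]_3).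

Record orth_rep K rho : Prop := OrthRep {
  repM : {in K &, forall g h, rho (g * h)%g = rho g *m rho h};
  rep_orth : forall g, g \in K -> orth (rho g);
  rep_inj : forall g, g \in K -> rho g = 1%:M -> g = 1%g }.

Definition rot_rep K rho := orth_rep K rho /\ forall g, g \in K -> \det (rho g) = 1.

Lemma rep1 K rho : orth_rep K rho -> rho 1%g = 1%:M.
Proof.
move=> rK; have := repM rK (group1 K) (group1 K); rewrite mulg1.
move/(congr1 (mulmx (rho 1%g)^T)); rewrite mulmxA (rep_orth rK) ?group1 // mul1mx.
by move=> <-.
Qed.

Lemma repV K rho g : orth_rep K rho -> g \in K -> rho g^-1%g *m rho g = 1%:M.
Proof. by move=> rK Kg; rewrite -(repM rK) ?groupV // mulVg (rep1 rK). Qed.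

Lemma rep_eq K rho g h : orth_rep K rho -> g \in K -> h \in K -> rho g = rho h -> g = h.
Proof.
move=> rK Kg Kh E; apply/eqP; rewrite eq_mulVg1; apply/eqP.
apply: (rep_inj rK); rewrite ?groupM ?groupV // (repM rK) ?groupV // -E.
exact: repV rK _.
Qed.

Lemma orth_repS K H rho : H \subset K -> orth_rep K rho -> orth_rep H rho.
Proof.
move=> /subsetP sHK rK; split => [g h Hg Hh|g Hg|g Hg].
- by rewrite (repM rK) ?sHK.
- by apply: (rep_orth rK); exact: sHK.
- by apply: (rep_inj rK); rewrite sHK.
Qed.

Lemma rot_repS K H rho : H \subset K -> rot_rep K rho -> rot_rep H rho.
Proof.
move=> sHK [rK dK]; split; first exact: orth_repS rK.
by move=> g Hg; rewrite dK // (subsetP sHK).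
Qed.

(* The sign twist makes any orthogonal representation a representation by
   rotations, as det (- A) = - det A in odd dimension. *)
Definition twist rho g : 'M[R]_3 := \det (rho g) *: rho g.

Lemma rot_rep_twist K rho : orth_rep K rho ->
  (forall g, g \in K -> rho g <> - 1%:M) -> rot_rep K (twist rho).
Proof.
move=> rK nN1; rewrite /twist; split; first split.
- move=> g h Kg Kh; rewrite (repM rK) // det_mulmx -scalemxAl -scalemxAr scalerA.
  by [].
- move=> g Kg; have og := rep_orth rK Kg.
  by case: (orth_det og) => ->; rewrite ?scale1r // scaleN1r; exact: orthN.
- move=> g Kg; case: (orth_det (rep_orth rK Kg)) => ->; rewrite ?scale1r ?scaleN1r.
    exact: rep_inj rK _ Kg.
  by move=> E; case: (nN1 g Kg); rewrite -E opprK.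
- move=> g Kg; case: (orth_det (rep_orth rK Kg)) => E; rewrite E ?scale1r ?scaleN1r //.
  by rewrite detN3 E opprK.
Qed.

Section RotationCharacter.
Import complex.
Local Open Scope complex_scope.

(** On the plane orthogonal to u each rotation is multiplication by the complex number c + i s,
    which embeds K into the multiplicative group of a field. *)
Lemma cyclic_fix_axis K rho (u : 'cV[R]_3) : rot_rep K rho -> dot u u = 1 ->
  (forall g, g \in K -> rho g *m u = u) -> cyclic K.
Proof.
move=> [rK dK] u1 fu; have [p [p1 pu q1 [qp qu]]] := orth_frame u1.
set q := cross u p in q1 qp qu.
pose c g := dot (rho g *m p) p; pose s g := dot (rho g *m p) q.
have Ep g : g \in K -> rho g *m p = c g *: p + s g *: q.
  move=> Kg; rewrite {1}(frame_decomp (rho g *m p) u1 p1 pu) -/(c g) -/q -/(s g).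
  suff -> : dot (rho g *m p) u = 0 by rewrite scale0r add0r.
  by have := orth_dot p u (rep_orth rK Kg); rewrite fu // pu.
have uq : cross u q = - p.
  have : cross u q = dot u p *: u - dot u u *: p.
    by rewrite /q; apply: cV3P; rewrite !crossE !mxE !dotE; ring.
  by rewrite (dotC u p) pu u1 scale0r scale1r sub0r.
have Eq g : g \in K -> rho g *m q = c g *: q - s g *: p.
  move=> Kg; have og := rep_orth rK Kg.
  rewrite /q (orth_cross _ _ og) (dK g Kg) scale1r fu // Ep //.
  by rewrite cross_linr uq scalerN.
apply: (@field_mul_group_cyclic _ _ _ (fun g => c g +i* s g)) => [g h Kg Kh|g Kg] /=.
  apply/eqP; rewrite eq_complex /= /c /s (repM rK) // -mulmxA (Ep h) // mulmxDr.
  rewrite -!scalemxAr (Ep g) // (Eq g) // !dotE_lin p1 q1 qp (dotC p q) qp.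
  by apply/andP; split; apply/eqP; ring.
split => [|->]; last by rewrite /c /s (rep1 rK) mul1mx p1 (dotC p q) qp.
move/eqP; rewrite eq_complex /= => /andP[/eqP c1 /eqP s0].
apply: (rep_inj rK) => //.
apply: (@cols3_inj _ _ u p q) => //; first by rewrite q1 oner_neq0.
- exact: fu.
- by rewrite Ep // c1 s0 scale1r scale0r addr0.
- by rewrite Eq // c1 s0 scale1r scale0r subr0.
Qed.

End RotationCharacter.

Lemma rot_rep_poles K rho : rot_rep K rho ->
  exists (X : finType) (to : action K X) (alpha : X -> X), pole_action to alpha K.
Proof.
move=> rotK; have [rK dK] := rotK.
have [ax axP] : exists ax : gT -> 'cV[R]_3, forall g, g \in K -> g != 1%g ->
    dot (ax g) (ax g) = 1 /\ rho g *m ax g = ax g.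
  apply: (@fin_all_exists _ _ (fun g u => g \in K -> g != 1%g ->
    dot u u = 1 /\ rho g *m u = u)) => g.
  case: (boolP (g \in K)) => [Kg|_]; last by exists 0.
  by have [u Hu] := rot_axis (rep_orth rK Kg) (dK g Kg); exists u.
pose P : seq 'cV[R]_3 := [seq ax g | g in K^#%g] ++ [seq - ax g | g in K^#%g].
have mP x : x \in P -> dot x x = 1 /\ exists g, [/\ g \in K, g != 1%g & rho g *m x = x].
  rewrite mem_cat => /orP[] /imageP[g /setD1P[g1 Kg] ->]; have [a1 ga] := axP g Kg g1.
    by split => //; exists g.
  by rewrite dotNl dotNr opprK; split => //; exists g; rewrite mulmxN ga.
have Pm x g : dot x x = 1 -> g \in K -> g != 1%g -> rho g *m x = x -> x \in P.
  move=> x1 Kg g1 gx; have [a1 ga] := axP g Kg g1.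
  have mg : g \in K^#%g by rewrite !inE g1.
  rewrite mem_cat.
  case: (rot_fix2 (rep_orth rK Kg) (dK g Kg) a1 x1 ga gx) => [/(rep_inj rK Kg) g1'|].
    by rewrite g1' eqxx in g1.
  by case=> ->; apply/orP; [left|right]; apply/imageP; exists g.
pose X := seq_sub P.
have PN x : x \in P -> - x \in P.
  by case/mP => x1 [g [Kg g1 gx]]; apply: (Pm _ g) => //; rewrite ?dotNl ?dotNr ?opprK ?mulmxN ?gx.
have PJ x g : x \in P -> g \in K -> rho g^-1%g *m x \in P.
  move=> /mP[x1 [h [Kh h1 hx]]] Kg; have Kg' : g^-1%g \in K by rewrite groupV.
  apply: (Pm _ (h ^ g)%g).
  - by rewrite orth_dot //; exact: (rep_orth rK).
  - by rewrite groupJ.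
  - by rewrite -(conj1g g) (inj_eq (@conjg_inj _ g)).
  rewrite conjgE !(repM rK) ?groupM // -!mulmxA (mulmxA (rho g)) -(repM rK) //.
  by rewrite mulgV (rep1 rK) mul1mx hx.
(* Actions are on the right, hence the inverse. *)
pose t (x : X) g : X := if g \in K then insubd x (rho g^-1%g *m val x) else x.
have tE x g : g \in K -> val (t x g) = rho g^-1%g *m val x.
  by move=> Kg; rewrite /t Kg val_insubd PJ // (valP x).
have t_act : is_action K t.
  split=> [g x y|g h Kg Kh x].
    case: (boolP (g \in K)) => Kg; last by rewrite /t (negbTE Kg).
    move/(congr1 val); rewrite !tE // => /(orth_inj (rep_orth rK _)) E.
    by apply: val_inj; apply: E; rewrite groupV.
  apply: val_inj; rewrite !tE ?groupM // invMg (repM rK) ?groupV //.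
  by rewrite mulmxA.
pose al (x : X) : X := insubd x (- val x).
have alE x : val (al x) = - val x by rewrite val_insubd PN // (valP x).
exists X, (Action t_act), al.
have fixE (x : X) g : g \in K -> (t x g == x) = (rho g *m val x == val x).
  move=> Kg; rewrite -val_eqE tE //; apply/eqP/eqP => [{1}<-|{1}<-].
    by rewrite mulmxA -(repM rK) ?groupV // mulgV (rep1 rK) mul1mx.
  by rewrite mulmxA (repV rK) // mul1mx.
split => /=.
- exact: subxx.
- move=> g Kg g1; have [a1 ga] := axP g Kg g1.
  have Pa : ax g \in P by apply: Pm ga.
  have vP : val (SeqSub Pa) = ax g by [].
  exists (SeqSub Pa) => y.
  rewrite fixE // -[y == SeqSub _]val_eqE -[y == al _]val_eqE alE vP.
  apply/eqP/orP => [gy|]; last by case=> /eqP ->; rewrite ?mulmxN ga.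
  have [y1 _] := mP _ (valP y).
  case: (rot_fix2 (rep_orth rK Kg) (dK g Kg) a1 y1 ga gy) => [/(rep_inj rK Kg) g1'|].
    by rewrite g1' eqxx in g1.
  by case=> ->; rewrite eqxx; [left|right].
- move=> x; have [x1 [g [Kg g1 gx]]] := mP _ (valP x).
  by exists g; split => //; apply/eqP; rewrite fixE // gx.
- move=> x; have [x1 _] := mP _ (valP x).
  apply: (@cyclic_fix_axis _ rho (val x)) => //.
    by apply: rot_repS rotK; exact: subsetIl.
  by move=> g; rewrite !inE sub1set inE => /and3P[_ Kg]; rewrite /= fixE // => /eqP.
- move=> x; rewrite -val_eqE alE eq_sym; have [x1 _] := mP _ (valP x).
  exact: unit_neqN.
- by move=> x; apply: val_inj; rewrite !alE opprK.
- by move=> x g Kg; apply: val_inj; rewrite alE !tE // alE mulmxN.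
- move=> x g Kg /(congr1 val); rewrite tE // alE => gx.
  have [x1 _] := mP _ (valP x); have Kg' : g^-1%g \in K by rewrite groupV.
  have := rot_flip (rep_orth rK Kg') (dK _ Kg') x1 gx.
  rewrite -(repM rK) // => /(rep_inj rK (groupM Kg' Kg')).
  by rewrite -invMg => /(canRL invgK); rewrite invg1 expgS expg1.
Qed.

Theorem rot_rep_polyhedral K rho : rot_rep K rho ->
  cyclic K
  \/ (exists2 n, (1 < n)%N & K \isog [set: extremal.dihedral_gtype n.*2]%g)
  \/ (K \isog 'Alt_('I_4))%g \/ (K \isog 'Sym_('I_4))%g \/ (K \isog 'Alt_('I_5))%g.
Proof. by case/rot_rep_poles => X [to [al /polyhedral_poles]]. Qed.

(** If there is an involution z outside K, it is the only one there and thus central. An involution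
    g of K would make z g a second one, so z is the only involution of G. *)
Lemma index2_rot_cyclic (K G : {group gT}) rho : K \subset G -> #|G : K|%g = 2%N ->
  rot_rep G rho ->
  (forall g h, g \in G -> h \in G -> g \notin K -> h \notin K ->
    (g ^+ 2 = 1 -> h ^+ 2 = 1 -> g = h)%g) -> cyclic G.
Proof.
move=> sKG iGK rG uinv; have [X [to [al poleG]]] := rot_rep_poles rG.
case: (boolP [exists z in G, (z \notin K) && (z ^+ 2 == 1)%g]); last first.
  move=> noz; apply: (poles_index2 poleG sKG iGK) => g Gg nKg.
  apply: contra noz => g2; apply/existsP; exists g; by rewrite Gg nKg.
case/exists_inP => z Gz /andP[nKz /eqP z2].
have zJ g : g \in G -> (z ^ g)%g = z.
  move=> Gg; have nK := index2_normal sKG iGK; apply: uinv => //.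
  - exact: groupJ.
  - by rewrite memJ_norm // (subsetP (normal_norm nK)).
  - by rewrite -conjXg z2 conj1g.
apply: (poles_uniq_involution poleG).
suff key g : g \in G -> #[g]%g = 2%N -> g = z.
  by move=> g h Gg Gh g2 h2; rewrite (key g) // (key h).
move=> Gg og; have g2 : (g ^+ 2 = 1)%g by rewrite -og expg_order.
case: (boolP (g \in K)) => [Kg|nKg]; last exact: uinv.
have zg : (z * g = g * z)%g by rewrite conjgC zJ.
have : (z * g = z)%g.
  apply: uinv => //; [exact: groupM|by rewrite groupMr|].
  by rewrite expgMn // z2 g2 mulg1.
move/(canRL (mulKg z)); rewrite mulVg => g1; by rewrite g1 order1 in og.
Qed.

Lemma orth_reps_cyclic (K G : {group gT}) i1 i2 : K \subset G -> #|G : K|%g = 2%N ->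
  orth_rep G i1 -> orth_rep G i2 ->
  (forall g, g \in K -> \det (i1 g) = 1) -> (forall g, g \in K -> \det (i2 g) = 1) ->
  (forall g, g \in G -> g \notin K -> (g ^+ 2 = 1)%g -> i1 g = - 1%:M \/ i2 g = - 1%:M) ->
  abelian G /\ cyclic K.
Proof.
move=> sKG iGK r1 r2 d1 d2 inv.
(* As rho never takes the value -1, its twist is a rotation representation. An involution outside K
   must be -1 under rho', so faithfulness leaves at most one. *)
have caseA rho rho' : orth_rep G rho -> orth_rep G rho' ->
    (forall g, g \in G -> rho g <> - 1%:M) ->
    (forall g, g \in G -> g \notin K -> (g ^+ 2 = 1)%g -> rho g = - 1%:M \/ rho' g = - 1%:M) ->
    abelian G /\ cyclic K.
  move=> r r' nN i; have cG : cyclic G.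
    apply: (index2_rot_cyclic sKG iGK (rot_rep_twist r nN)) => g h Gg Gh nKg nKh g2 h2.
    apply: (rep_eq r') => //.
    by case: (i g Gg nKg g2) => [/(nN g Gg)//|->]; case: (i h Gh nKh h2) => [/(nN h Gh)//|->].
  by split; [exact: cyclic_abelian | exact: cyclicS sKG cG].
case: (boolP [exists z in G, i1 z == - 1%:M]) => [|n1]; last first.
  apply: (caseA i1 i2) => // g Gg E; case/negP: n1.
  by apply/existsP; exists g; rewrite Gg E eqxx.
case/exists_inP => z Gz /eqP iz.
case: (boolP [exists z in G, i2 z == - 1%:M]) => [|n2]; last first.
  apply: (caseA i2 i1) => // [g Gg E|g Gg nKg g2]; last by case: (inv g Gg nKg g2); tauto.
  by case/negP: n2; apply/existsP; exists g; rewrite Gg E eqxx.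
case/exists_inP => w Gw /eqP iw.
have nKz : z \notin K.
  by apply/negP => /d1; rewrite iz detN3 det1 => /eqP; rewrite eqNr oner_eq0.
have zC g : g \in G -> (z * g = g * z)%g.
  move=> Gg; apply: (rep_eq r1); rewrite ?groupM //.
  by rewrite !(repM r1) // iz mulNmx mulmxN mul1mx mulmx1.
have z2 : (z ^+ 2 = 1)%g.
  apply: (rep_inj r1); first exact: groupX.
  by rewrite expgS expg1 (repM r1) // iz mulNmx mulmxN opprK mul1mx.
have rotK : rot_rep K i1 by split=> //; exact: orth_repS r1.
have [X [to [al poleK]]] := rot_rep_poles rotK.
(* For an involution g of K, z g is an involution outside K. It is not -1 under i1, where z already
   is, so it is -1 under i2 and equals w. *)
have cK : cyclic K.
  apply: (poles_uniq_involution poleK).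
  suff key g : g \in K -> #[g]%g = 2%N -> g = (z^-1 * w)%g.
    by move=> g h Kg Kh g2 h2; rewrite (key g) // (key h).
  move=> Kg og; have g2 : (g ^+ 2 = 1)%g by rewrite -og expg_order.
  have Gg := subsetP sKG g Kg.
  apply: (mulgI z); rewrite mulKVg.
  have : i1 (z * g)%g = - 1%:M \/ i2 (z * g)%g = - 1%:M.
    apply: inv; [exact: groupM|by rewrite groupMr|].
    by rewrite expgMn ?z2 ?g2 ?mulg1 //; exact: zC.
  case=> [|E]; last by apply: (rep_eq r2); rewrite ?groupM // E iw.
  rewrite (repM r1) // iz mulNmx mul1mx => /oppr_inj /(rep_inj r1 Gg) g1.
  by rewrite g1 order1 in og.
split=> //; have /centsP cKK := cyclic_abelian cK.
have dec g : g \in G -> g \notin K -> exists2 k, k \in K & g = (z * k)%g.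
  move=> Gg nKg; exists (z^-1 * g)%g; last by rewrite mulKVg.
  by apply: (index2_mul sKG); rewrite ?groupV.
apply/centsP => g Gg h Gh; rewrite /commute.
case: (boolP (g \in K)) => [Kg|/(dec g Gg)[k Kk ->]];
  case: (boolP (h \in K)) => [Kh|/(dec h Gh)[l Kl ->]].
- exact: cKK.
- by rewrite mulgA -(zC g Gg) -!mulgA (cKK g Kg l Kl).
- by rewrite -mulgA (cKK k Kk h Kh) mulgA (zC h Gh) mulgA.
- have Gk := subsetP sKG k Kk; have Gl := subsetP sKG l Kl.
  by rewrite !mulgA -(mulgA z k z) -(zC k Gk) -(mulgA z l z) -(zC l Gl) -!mulgA (cKK k Kk l Kl).
Qed.

End OrthRep.

From mathcomp Require Import boolp classical_sets functions.
From mathcomp Require Import cardinality reals topology normedtype sequences trigo.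
From mathcomp.multinomials Require Import freeg.

Import numFieldNormedType.Exports.

(** * Rotation representations of the polyhedral groups *)

Section FrameRep.
Local Open Scope ring_scope.
Variables (R : rcfType) (T U : finType) (act : {perm T} -> U -> U).
Variables (F : U -> 'cV[R]_3) (k : R).
Hypothesis act1 : forall u, act 1%g u = u.
Hypothesis actM : forall s t u, act (s * t)%g u = act t (act s u).
Hypothesis k0 : k != 0.
Hypothesis frameF : \sum_u F u *m (F u)^T = k%:M.

(** A vector x equals k^-1 times the sum of [dot (F u) x *: F u], so this is the only linear
    candidate for sending each [F u] to [F (act s^-1 u)]. The inverse appears because permutations
    compose on the right. *)
Definition frame_rep (s : {perm T}) : 'M[R]_3 :=
  k^-1 *: \sum_u F (act s^-1%g u) *m (F u)^T.

Let actK s : cancel (act s) (act s^-1%g).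
Proof. by move=> u; rewrite -actM mulgV act1. Qed.

Let actVK s : cancel (act s^-1%g) (act s).
Proof. by move=> u; rewrite -actM mulVg act1. Qed.

Lemma frame_ext (A B : 'M[R]_3) : (forall u, A *m F u = B *m F u) -> A = B.
Proof.
move=> AB; apply: (scalerI k0); rewrite -!mul_mx_scalar -frameF !mulmx_sumr.
by apply: eq_bigr => u _; rewrite !mulmxA AB.
Qed.

Lemma mulmx_dotl (x y z : 'cV[R]_3) : x *m y^T *m z = dot y z *: x.
Proof.
rewrite -mulmxA (_ : y^T *m z = (dot y z)%:M) ?mul_mx_scalar //.
by apply/matrixP => i j; rewrite !ord1 dot_mx [RHS]mxE mulr1n.
Qed.

Variable G : {group {perm T}}.
Hypothesis gramF : forall s u v, s \in G ->
  dot (F (act s u)) (F (act s v)) = dot (F u) (F v).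

Lemma frame_repE s u : s \in G -> frame_rep s *m F u = F (act s^-1%g u).
Proof.
move=> Gs; have Gs' : s^-1%g \in G by rewrite groupV.
rewrite /frame_rep -scalemxAl mulmx_suml.
have -> : \sum_v F (act s^-1%g v) *m (F v)^T *m F u =
    (\sum_v F v *m (F v)^T) *m F (act s^-1%g u).
  rewrite mulmx_suml [RHS](reindex (act s^-1%g)) /=; last first.
    by exists (act s) => v _; rewrite ?actVK ?actK.
  by apply: eq_bigr => v _; rewrite !mulmx_dotl gramF.
by rewrite frameF mul_scalar_mx scalerA mulVf // scale1r.
Qed.

Lemma frame_rep_orth s : s \in G -> orth (frame_rep s).
Proof.
move=> Gs; apply: frame_ext => u; apply: dot_inj => w; rewrite mul1mx.
have E : forall v, dot ((frame_rep s)^T *m frame_rep s *m F u) (F v) = dot (F u) (F v).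
  move=> v; rewrite -mulmxA dot_mulmxl trmxK !frame_repE // gramF ?groupV //.
have -> : w = k^-1 *: \sum_v F v *m (F v)^T *m w.
  by rewrite -mulmx_suml frameF mul_scalar_mx scalerA mulVf // scale1r.
have dsum (x : 'cV[R]_3) : dot x (\sum_v F v *m (F v)^T *m w) =
    \sum_v dot (F v) w * dot x (F v).
  rewrite (big_morph (dot x) (fun y z => dotDr y z x) (_ : dot x 0 = 0)); last first.
    by rewrite dotE !mxE; ring.
  by apply: eq_bigr => v _; rewrite mulmx_dotl dotZr.
by rewrite !dotZr !dsum; congr (_ * _); apply: eq_bigr => v _; rewrite E.
Qed.

Hypothesis sepF : forall s, s \in G ->
  (forall u, F (act s u) = F u) \/ (forall u, F (act s u) = - F u) -> s = 1%g.

(** [sepF] rules out the values 1 and -1 alike, so passing to the twist keeps the representation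
    faithful. *)
Lemma rot_rep_frame : rot_rep G (twist frame_rep).
Proof.
have sep s e : s \in G -> e = 1 \/ e = - 1 -> frame_rep s = e%:M -> s = 1%g.
  move=> Gs he E; apply/eqP; rewrite -invg_eq1; apply/eqP.
  apply: sepF; first by rewrite groupV.
  by case: he => he; [left|right] => u; rewrite -frame_repE // E he mul_scalar_mx
    ?scale1r ?scaleN1r.
have fM : {in G &, forall g h, frame_rep (g * h)%g = frame_rep g *m frame_rep h}.
  move=> s t Gs Gt; apply: frame_ext => u.
  by rewrite -mulmxA !frame_repE ?groupM // invMg actM.
have f1 : frame_rep 1%g = 1%:M.
  by apply: frame_ext => u; rewrite frame_repE // invg1 act1 mul1mx.
apply: rot_rep_twist.
  split => [||s Gs]; [exact: fM|exact: frame_rep_orth|].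
  by apply: (sep s 1) => //; left.
move=> s Gs E; have s1 : s = 1%g by apply: (sep s (-1)) => //; [right|rewrite E raddfN].
have /matrixP/(_ 0 0) : 1%:M = - 1%:M :> 'M[R]_3 by rewrite -E s1 f1.
by rewrite !mxE /= mulr1n => /eqP; rewrite eq_sym eqNr oner_eq0.
Qed.

End FrameRep.

(** * The tetrahedron and the rotations of S_4 and A_4 *)

Section Tetrahedron.
Local Open Scope ring_scope.
Variable R : rcfType.

Definition tetra (i : 'I_4) : 'cV[R]_3 :=
  \col_j (nth [::] [:: [:: 1; 1; 1]; [:: 1; -1; -1]; [:: -1; 1; -1]; [:: -1; -1; 1]] i)`_j.

Lemma dot_tetra i j : dot (tetra i) (tetra j) = if i == j then 3 else - 1.
Proof.
rewrite dotE !mxE -val_eqE.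
by case: i => [[|[|[|[|//]]]] ?]; case: j => [[|[|[|[|//]]]] ?]; rewrite /=; ring.
Qed.

Lemma tetra_frame : \sum_i tetra i *m (tetra i)^T = 4%:M.
Proof.
apply/matrixP => i j; rewrite summxE !big_ord_recl big_ord0 !mxE !big_ord_recl !big_ord0 !mxE /=.
by elim/ord3P: i; elim/ord3P: j; rewrite /=; ring.
Qed.

(** S_4 is the full symmetry group of the tetrahedron; the twist turns its improper elements into
    rotations of the cube. *)
Lemma Sym4_rot_rep : exists rho, rot_rep ('Sym_('I_4))%G (rho : _ -> 'M[R]_3).
Proof.
exists (twist (frame_rep (fun (s : {perm 'I_4}) i => s i) tetra 4)).
have dN (i j : 'I_4) : tetra i <> - tetra j.
  move=> E; have : dot (tetra i) (tetra j) = - 3 by rewrite E dotNl dot_tetra eqxx.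
  by rewrite dot_tetra; case: eqP => _; lra.
apply: rot_rep_frame => //.
- by move=> u; rewrite perm1.
- by move=> s t u; rewrite permM.
- by rewrite pnatr_eq0.
- exact: tetra_frame.
- by move=> s u v _; rewrite !dot_tetra (inj_eq perm_inj).
- move=> s _ [H|/(_ 0)/dN //]; apply/permP => i; rewrite perm1.
  have : dot (tetra (s i)) (tetra i) = 3 by rewrite H dot_tetra eqxx.
  by rewrite dot_tetra; case: eqP => // _ H3; exfalso; lra.
Qed.

End Tetrahedron.

(** * The dodecahedron and the rotations of A_5 *)

Section Dodecahedron.
Local Open Scope ring_scope.
Variable R : rcfType.

(* The pair (a, b) stands for a + b phi, with phi the golden ratio. *)
Local Notation zphi := (int * int)%type.
Definition zphi_add (x y : zphi) : zphi := (x.1 + y.1, x.2 + y.2).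
Definition zphi_mul (x y : zphi) : zphi :=
  (x.1 * y.1 + x.2 * y.2, x.1 * y.2 + x.2 * y.1 + x.2 * y.2).
Definition zphi_conj (x : zphi) : zphi := (x.1 + x.2, - x.2).

(* The vertices of a regular dodecahedron. Its rotations permute the five
   tetrahedra of one of its two compounds; the entry (i, j) is the vertex lying
   in the i-th tetrahedron whose antipode lies in the j-th one. *)
Definition dodeca_table : seq (seq (seq zphi)) :=
  [:: [:: [:: (0, 0); (0, 0); (0, 0)];
      [:: (-1, 0); (-1, 0); (1, 0)];
      [:: (-1, 0); (1, 0); (-1, 0)];
      [:: (1, 0); (-1, 0); (-1, 0)];
      [:: (1, 0); (1, 0); (1, 0)]];
  [:: [:: (1, 0); (1, 0); (-1, 0)];
      [:: (0, 0); (0, 0); (0, 0)];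
      [:: (0, 0); (-1, 1); (0, 1)];
      [:: (0, -1); (0, 0); (1, -1)];
      [:: (-1, 1); (0, -1); (0, 0)]];
  [:: [:: (1, 0); (-1, 0); (1, 0)];
      [:: (0, 0); (1, -1); (0, -1)];
      [:: (0, 0); (0, 0); (0, 0)];
      [:: (-1, 1); (0, 1); (0, 0)];
      [:: (0, -1); (0, 0); (-1, 1)]];
  [:: [:: (-1, 0); (1, 0); (1, 0)];
      [:: (0, 1); (0, 0); (-1, 1)];
      [:: (1, -1); (0, -1); (0, 0)];
      [:: (0, 0); (0, 0); (0, 0)];
      [:: (0, 0); (-1, 1); (0, -1)]];
  [:: [:: (-1, 0); (-1, 0); (-1, 0)];
      [:: (1, -1); (0, 1); (0, 0)];
      [:: (0, 1); (0, 0); (1, -1)];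
      [:: (0, 0); (1, -1); (0, 1)];
      [:: (0, 0); (0, 0); (0, 0)]]].

Definition dodeca_coord (i j k : nat) : zphi :=
  nth (0, 0) (nth [::] (nth [::] dodeca_table i) j) k.

Definition dodeca_gram (i j k l : nat) : zphi :=
  foldr zphi_add (0, 0)
    [seq zphi_mul (dodeca_coord i j m) (dodeca_coord k l m) | m <- iota 0 3].

Definition phi : R := (1 + Num.sqrt 5) / 2.

Lemma phi_sqr : phi * phi = phi + 1.
Proof.
rewrite /phi; have : Num.sqrt 5 * Num.sqrt 5 = 5 :> R by rewrite -expr2 sqr_sqrtr ?ler0n.
by move=> h; field: h.
Qed.

Definition zphi_val (x : zphi) : R := x.1%:~R + x.2%:~R * phi.

Lemma zphi_val0 : zphi_val (0, 0) = 0.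
Proof. by rewrite /zphi_val /=; ring. Qed.

Lemma zphi_valD x y : zphi_val (zphi_add x y) = zphi_val x + zphi_val y.
Proof. by rewrite /zphi_val /= !intrD; ring. Qed.

Lemma zphi_valM x y : zphi_val (zphi_mul x y) = zphi_val x * zphi_val y.
Proof.
rewrite /zphi_val /= !intrD !intrM.
transitivity (x.1%:~R * y.1%:~R + (x.1%:~R * y.2%:~R + x.2%:~R * y.1%:~R) * phi
  + x.2%:~R * y.2%:~R * (phi * phi)); last by ring.
by rewrite phi_sqr; ring.
Qed.

Definition dodeca (u : 'I_5 * 'I_5) : 'cV[R]_3 :=
  \col_k zphi_val (dodeca_coord u.1 u.2 k).

Lemma dot_dodeca u v : dot (dodeca u) (dodeca v) = zphi_val (dodeca_gram u.1 u.2 v.1 v.2).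
Proof.
by rewrite dotE !mxE /dodeca_gram /= !zphi_valD !zphi_valM zphi_val0 addr0 addrA.
Qed.

Definition swapn (x y i : nat) : nat := if i == x then y else if i == y then x else i.

Lemma tperm_swapn n (x y i : 'I_n) : tperm x y i = swapn x y i :> nat.
Proof. by rewrite permE /= /swapn !val_eqE; case: ifP => // _; case: ifP. Qed.

Definition dodeca_gram_tperm : bool :=
  all (fun x => all (fun y => (x == y) || all (fun i => all (fun j => all (fun k => all (fun l =>
    dodeca_gram (swapn x y i) (swapn x y j) (swapn x y k) (swapn x y l) ==
    zphi_conj (dodeca_gram i j k l))
  (iota 0 5)) (iota 0 5)) (iota 0 5)) (iota 0 5)) (iota 0 5)) (iota 0 5).

Lemma dodeca_gram_tpermP : dodeca_gram_tperm.
Proof. by vm_cast_no_check (erefl true). Qed.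

Lemma zphi_conjK : involutive zphi_conj.
Proof. by case=> a b; rewrite /zphi_conj /=; congr pair; lia. Qed.

(** A transposition of the five tetrahedra changes every Gram entry by the Galois conjugation phi ->
    1 - phi, a finite computation. Even permutations therefore preserve the Gram matrix, and only
    they are realized by isometries. *)
Lemma dodeca_gram_perm (s : {perm 'I_5}) (i j k l : 'I_5) :
  dodeca_gram (s i) (s j) (s k) (s l) =
  if odd_perm s then zphi_conj (dodeca_gram i j k l) else dodeca_gram i j k l.
Proof.
have [ts -> Hts] := prod_tpermP s; rewrite odd_perm_prod //.
elim: ts Hts i j k l => [|[x y] ts IH] /=; first by move=> _ i j k l; rewrite big_nil !perm1.
case/andP=> nxy /IH {}IH i j k l; rewrite big_cons !permM IH !tperm_swapn.
have mI (m : 'I_5) : (m : nat) \in iota 0 5 by rewrite mem_iota /=.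
have := dodeca_gram_tpermP; rewrite /dodeca_gram_tperm.
move=> /allP/(_ x (mI x))/allP/(_ y (mI y)); rewrite val_eqE (negbTE nxy) orFb.
move=> /allP/(_ i (mI i))/allP/(_ j (mI j))/allP/(_ k (mI k))/allP/(_ l (mI l))/eqP ->.
by case: (odd _) => /=; rewrite ?zphi_conjK.
Qed.

(** The constant follows from the trace: twenty vertices of squared norm 3 in dimension 3, the
    diagonal entries of the table being zero. *)
Lemma dodeca_frame : \sum_u dodeca u *m (dodeca u)^T = 20%:M.
Proof.
have S (F : 'I_5 * 'I_5 -> R) : \sum_u F u = \sum_(i < 5) \sum_(j < 5) F (i, j).
  by rewrite pair_big /=; apply: eq_bigr => -[].
pose c k l := foldr zphi_add (0, 0)
  [seq zphi_mul (dodeca_coord p.1 p.2 k) (dodeca_coord p.1 p.2 l)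
     | p <- [seq (i, j) | i <- iota 0 5, j <- iota 0 5]].
have cE : all (fun k => all (fun l => c k l == (if k == l then 20 else 0, 0)) (iota 0 3))
    (iota 0 3).
  by vm_cast_no_check (erefl true).
apply/matrixP => k l; rewrite summxE S [RHS]mxE.
have -> : \sum_(i < 5) \sum_(j < 5) (dodeca (i, j) *m (dodeca (i, j))^T) k l = zphi_val (c k l).
  have fE (s : seq zphi) : zphi_val (foldr zphi_add (0, 0) s) = \sum_(x <- s) zphi_val x.
    elim: s => [|x s IH] /=; first by rewrite big_nil zphi_val0.
    by rewrite big_cons zphi_valD IH.
  rewrite fE big_map big_allpairs -[iota 0 5]/(index_iota 0 5) big_mkord.
  apply: eq_bigr => i _; rewrite big_mkord; apply: eq_bigr => j _.
  by rewrite zphi_valM mxE big_ord_recl big_ord0 addr0 !mxE.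
have mI (m : 'I_3) : (m : nat) \in iota 0 3 by rewrite mem_iota /=.
move: cE => /allP/(_ k (mI k))/allP/(_ l (mI l))/eqP ->; rewrite val_eqE.
by rewrite /zphi_val /= mul0r addr0; case: (k == l); rewrite ?mulr1n ?mulr0n.
Qed.

(** A vertex has squared norm 3, and the inner product takes this value on no other vertex. The
    remaining Gram entries are listed; each could equal 3 only if phi were 2 or -1, or by a
    numerical contradiction. *)
Lemma dodeca_dot3 u v : u.1 != u.2 -> dot (dodeca u) (dodeca v) = 3 -> u = v.
Proof.
have chk : all (fun i => all (fun j => (i == j) || all (fun k => all (fun l =>
     (dodeca_gram i j k l != (3, 0)) || (i == k) && (j == l))
     (iota 0 5)) (iota 0 5)) (iota 0 5)) (iota 0 5).
  by vm_cast_no_check (erefl true).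
have chk2 : all (fun i => all (fun j => all (fun k => all (fun l =>
     dodeca_gram i j k l \in [:: (3, 0); (0, 0); (1, 0); (-1, 0); (-3, 0); (-1, 2); (1, -2)])
     (iota 0 5)) (iota 0 5)) (iota 0 5)) (iota 0 5).
  by vm_cast_no_check (erefl true).
have mI (m : 'I_5) : (m : nat) \in iota 0 5 by rewrite mem_iota /=.
case: u v => i j [k l] /= nij; rewrite dot_dodeca /=.
move: chk => /allP/(_ i (mI i))/allP/(_ j (mI j)); rewrite val_eqE (negbTE nij) orFb.
move=> /allP/(_ k (mI k))/allP/(_ l (mI l)).
move: chk2 => /allP/(_ i (mI i))/allP/(_ j (mI j))/allP/(_ k (mI k))/allP/(_ l (mI l)).
move: (dodeca_gram i j k l) => g gI /orP[g3|/andP[]]; last first.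
  by rewrite !val_eqE => /eqP -> /eqP ->.
have phi_sq := phi_sqr; move: gI; rewrite !inE (negbTE g3) orFb /zphi_val => gI.
have nphi2 : phi <> 2 by move=> E; move: phi_sq; rewrite E; lra.
have nphi1 : phi <> - 1 by move=> E; move: phi_sq; rewrite E; lra.
case/or3P: gI => [/eqP->|/eqP->|/or4P[]/eqP->] /= E; exfalso; (lra || (apply: nphi2; lra) ||
  (apply: nphi1; lra)).
Qed.

Lemma dodeca_norm u : u.1 != u.2 -> dot (dodeca u) (dodeca u) = 3.
Proof.
have chk : all (fun i => all (fun j => (i == j) || (dodeca_gram i j i j == (3, 0)))
     (iota 0 5)) (iota 0 5).
  by vm_cast_no_check (erefl true).
have mI (m : 'I_5) : (m : nat) \in iota 0 5 by rewrite mem_iota /=.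
case: u => i j /= nij; rewrite dot_dodeca /=.
move: chk => /allP/(_ i (mI i))/allP/(_ j (mI j)); rewrite val_eqE (negbTE nij) orFb.
by move=> /eqP ->; rewrite /zphi_val /=; ring.
Qed.

Lemma dodeca_antipode i j : dodeca (i, j) = - dodeca (j, i).
Proof.
have chk : all (fun i => all (fun j => all (fun k =>
    zphi_add (dodeca_coord i j k) (dodeca_coord j i k) == (0, 0))
     (iota 0 3)) (iota 0 5)) (iota 0 5).
  by vm_cast_no_check (erefl true).
have mI (m : 'I_5) : (m : nat) \in iota 0 5 by rewrite mem_iota /=.
apply/matrixP => k l; rewrite !mxE.
have mk : (k : nat) \in iota 0 3 by rewrite mem_iota /=.
move: chk => /allP/(_ i (mI i))/allP/(_ j (mI j))/allP/(_ k mk)/eqP/(congr1 zphi_val).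
by rewrite zphi_valD zphi_val0 /= => /eqP; rewrite addr_eq0 => /eqP.
Qed.

Lemma Alt5_rot_rep : exists rho, rot_rep ('Alt_('I_5))%G (rho : _ -> 'M[R]_3).
Proof.
pose act (s : {perm 'I_5}) (u : 'I_5 * 'I_5) := (s u.1, s u.2).
exists (twist (frame_rep act dodeca 20)).
apply: rot_rep_frame => //.
- by case=> i j; rewrite /act !perm1.
- by move=> s t [i j]; rewrite /act !permM.
- by rewrite pnatr_eq0.
- exact: dodeca_frame.
- move=> s u v; rewrite Alt_even => /negbTE es.
  by rewrite !dot_dodeca /= dodeca_gram_perm es.
move=> s As H; apply/permP => i; rewrite perm1.
have [j nij] : exists j : 'I_5, i != j.
  by case: (eqVneq i 0) => [->|n]; [exists 1 | exists 0].
case: H => H.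
  have : act s (i, j) = (i, j).
    apply: dodeca_dot3 => /=; first by rewrite (inj_eq perm_inj).
    by rewrite H dodeca_norm.
  by case.
have key j' : i != j' -> s i = j'.
  move=> nij'; have : act s (i, j') = (j', i).
    apply: dodeca_dot3 => /=; first by rewrite (inj_eq perm_inj).
    by rewrite H -dodeca_antipode dodeca_norm //= eq_sym.
  by case.
have [k nik njk] : exists2 k : 'I_5, i != k & j != k.
  have : [set i; j] != [set: 'I_5].
    by apply/negP => /eqP/(congr1 (fun A : {set _} => #|A|)); rewrite cardsT card_ord cards2;
      case: (_ != _).
  rewrite finset.eqEsubset finset.subsetT /= => /fintype.subsetPn[k _]; rewrite !inE negb_or.
  by case/andP => ? ?; exists k; rewrite eq_sym.
by move: njk; rewrite -(key j nij) (key k nik) eqxx.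
Qed.

End Dodecahedron.

(** * Cyclic and dihedral rotation groups *)

Section Rotations.
Local Open Scope ring_scope.
Variable R : realType.

Definition rotz (c s : R) : 'M[R]_3 :=
  \matrix_(i, j) (nth [::] [:: [:: c; - s; 0]; [:: s; c; 0]; [:: 0; 0; 1]] i)`_j.

Definition flipx : 'M[R]_3 :=
  \matrix_(i, j) (nth [::] [:: [:: 1; 0; 0]; [:: 0; -1; 0]; [:: 0; 0; -1]] i)`_j.

Lemma rotzM c s c' s' : rotz c s *m rotz c' s' = rotz (c * c' - s * s') (s * c' + c * s').
Proof.
by apply/matrixP => i j; rewrite mxE sum3 !mxE; elim/ord3P: i; elim/ord3P: j => /=; ring.
Qed.

Lemma rotz1 : rotz 1 0 = 1%:M.
Proof. by apply/matrixP => i j; rewrite !mxE; elim/ord3P: i; elim/ord3P: j => /=; ring. Qed.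

Lemma rotz_tr c s : (rotz c s)^T = rotz c (- s).
Proof. by apply/matrixP => i j; rewrite !mxE; elim/ord3P: i; elim/ord3P: j => /=; ring. Qed.

Lemma rotz_orth c s : c ^+ 2 + s ^+ 2 = 1 -> orth (rotz c s).
Proof.
move=> cs; rewrite /orth rotz_tr.
by rewrite rotzM -rotz1 -cs; congr rotz; ring.
Qed.

Lemma rotz_det c s : c ^+ 2 + s ^+ 2 = 1 -> \det (rotz c s) = 1.
Proof. by move=> <-; rewrite det3 !mxE /=; ring. Qed.

Lemma flipx_sqr : flipx *m flipx = 1%:M.
Proof. by apply/matrixP => i j; rewrite mxE sum3 !mxE; elim/ord3P: i; elim/ord3P: j => /=;
  ring. Qed.

Lemma flipx_orth : orth flipx.
Proof.
rewrite /orth (_ : flipx^T = flipx) ?flipx_sqr //.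
by apply/matrixP => i j; rewrite !mxE; elim/ord3P: i; elim/ord3P: j => /=; ring.
Qed.

Lemma flipx_det : \det flipx = 1.
Proof. by rewrite det3 !mxE /=; ring. Qed.

Lemma flipx_rotz c s : flipx *m rotz c s *m flipx = rotz c (- s).
Proof.
by apply/matrixP => i j; rewrite mxE sum3 !mxE !sum3 !mxE; elim/ord3P: i; elim/ord3P: j => /=; ring.
Qed.

Definition rot_by (t : R) := rotz (cos t) (sin t).

Lemma rot_byM s t : rot_by s *m rot_by t = rot_by (s + t).
Proof. by rewrite /rot_by rotzM cosD sinD. Qed.

Lemma rot_byX t n : rot_by t ^+ n = rot_by (n%:R * t).
Proof.
elim: n => [|n IH]; first by rewrite expr0 mul0r /rot_by cos0 sin0 rotz1.
rewrite exprS IH; transitivity (rot_by t *m rot_by (n%:R * t)) => //.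
by rewrite rot_byM; congr rot_by; rewrite mulrSr; ring.
Qed.

Lemma rot_by_eq1 t : 0 <= t < pi *+ 2 -> rot_by t = 1%:M -> t = 0.
Proof.
case/andP=> t0 t2 /matrixP/(_ 0 0); rewrite !mxE /= mulr1n => ct.
apply/eqP; rewrite eq_le t0 andbT leNgt; apply/negP => tp.
(* The half angle lies strictly between 0 and pi, where sin is positive, while cos t = 1 forces sin
   (t / 2) = 0. *)
have s0 : 0 < sin (t / 2) by apply: sin_gt0_pi; move: t2; rewrite mulr2n => ?; lra.
have t2E : (t / 2) *+ 2 = t by rewrite mulr2n; lra.
have := cos_mulr2n (t / 2); rewrite t2E ct cos2sin2 mulr2n => h; have : sin (t / 2) ^+ 2 = 0 by lra.
by move/eqP; rewrite sqrf_eq0 gt_eqF.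
Qed.

(** The second clause records the common axis: the last diagonal entry of every rotation is 1.
    Extensions by half-turns or signs are proved faithful by looking at this entry. *)
Lemma cyclic_rot_rep (gT : finGroupType) (C : {group gT}) : cyclic C ->
  exists rho : gT -> 'M[R]_3, rot_rep C rho /\
    forall g, exists c s, rho g = rotz c s.
Proof.
case/cyclicP => x defC; set n := #[x]%g; have n0 : (0 < n)%N by exact: order_gt0.
have [ix ixP] : exists ix : gT -> nat, forall g, g \in C -> (ix g < n)%N /\ g = (x ^+ ix g)%g.
  apply: (@fin_all_exists _ _ (fun g i => g \in C -> (i < n)%N /\ g = (x ^+ i)%g)) => g.
  case: (boolP (g \in C)) => [|_]; last by exists 0%N.
  by rewrite defC => /cyclePmin[i li ->]; exists i.
pose t : R := pi *+ 2 / n%:R.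
have nR : n%:R != 0 :> R by rewrite pnatr_eq0 -lt0n.
have tn : rot_by t ^+ n = 1%:M.
  by rewrite rot_byX /t mulrC divfK // /rot_by cos2pi sin2pi rotz1.
exists (fun g => rot_by t ^+ ix g); split; last by move=> g; rewrite rot_byX; eexists; eexists.
split; first split.
- move=> g h Cg Ch; have [_ eg] := ixP g Cg; have [_ eh] := ixP h Ch.
  have [_ egh] := ixP (g * h)%g (groupM Cg Ch).
  rewrite -[RHS]exprD -(expr_mod _ tn) -[RHS](expr_mod _ tn); congr (_ ^+ _).
  by apply/eqP; rewrite -eq_expg_mod_order -egh expgD -eg -eh.
- by move=> g _; rewrite rot_byX; apply: rotz_orth; exact: cos2Dsin2.
- move=> g Cg; have [li eg] := ixP g Cg; rewrite rot_byX => /rot_by_eq1 H.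
  rewrite eg; suff -> : ix g = 0%N by rewrite expg0.
  have p0 : 0 < pi *+ 2 :> R by rewrite pmulrn_lgt0 // pi_gt0.
  have : (ix g)%:R * t = 0.
    apply: H; rewrite /t mulr_ge0 ?ler0n ?divr_ge0 ?ler0n ?ltW //=.
    by rewrite mulrCA -[X in _ < X]mulr1 ltr_pM2l // ltr_pdivrMr ?ltr0n // mul1r ltr_nat.
  move/eqP; rewrite mulf_eq0 pnatr_eq0 => /orP[/eqP //|].
  by rewrite /t mulf_eq0 invr_eq0 (negbTE nR) gt_eqF.
- by move=> g _; rewrite rot_byX; apply: rotz_det; exact: cos2Dsin2.
Qed.

(** The involution y goes to the half-turn [flipx], which inverts rotations about the z-axis.
    Outside the cyclic subgroup the last diagonal entry is -1. *)
Lemma dihedral_rot_rep (gT : finGroupType) (K : {group gT}) n : (1 < n)%N ->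
  (K \isog [set: extremal.dihedral_gtype n.*2])%g ->
  exists rho : gT -> 'M[R]_3, rot_rep K rho.
Proof.
move=> n1 /(dihedral_gens n1)[x [y [sCK iC /setDP[Ky nCy] y2 xy]]].
have [r [rotC rE]] := cyclic_rot_rep (cycle_cyclic x); have [rC dC] := rotC.
pose C := <[x]>%G; pose F := flipx.
have yV : (y^-1 = y)%g by apply/eqP; rewrite eq_invg_mul -(expgS y 1) y2.
have yy z : (z * y * y = z)%g by rewrite -mulgA -(expgS y 1) y2 mulg1.
have cJ c : c \in C -> (c ^ y)%g \in C /\ r (c ^ y)%g = F *m r c *m F.
  move=> Cc; have -> : (c ^ y = c^-1)%g.
    by case/cycleP: Cc => i ->; rewrite conjXg xy expgVn.
  split; first by rewrite groupV.
  have : r c^-1%g = (r c)^T.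
    rewrite -[LHS]mulmx1 -(orth_trmx (rep_orth rC Cc)) mulmxA (repV rC) ?mul1mx //.
  by have [a [b ->]] := rE c; rewrite rotz_tr flipx_rotz.
have nCM g h : g \in K -> h \in K -> ((g * h)%g \in C) = ((g \in C) == (h \in C)).
  move=> Kg Kh; case: (boolP (g \in C)) => Cg; first by rewrite groupMl.
  case: (boolP (h \in C)) => Ch; first by rewrite groupMr // (negbTE Cg).
  by rewrite (index2_mul sCK iC).
pose rho g := if g \in C then r g else r (g * y)%g *m F.
have FF : F *m F = 1%:M by exact: flipx_sqr.
have Cgy g : g \in K -> g \notin C -> (g * y)%g \in C.
  by move=> Kg Cg; rewrite nCM // (negbTE Cg) (negbTE nCy).
exists rho; split; first split.
- move=> g h Kg Kh; rewrite /rho nCM //.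
  case: (boolP (g \in C)) => Cg; case: (boolP (h \in C)) => Ch /=.
  + by rewrite (repM rC).
  + by rewrite -mulgA (repM rC) ?Cgy // mulmxA.
  + have [Chy rhy] := cJ h Ch.
    have -> : (g * h * y = (g * y) * (h ^ y))%g by rewrite conjgE !mulgA yV yy.
    rewrite (repM rC) ?Cgy // rhy -!mulmxA FF mulmx1 //.
  + have Ch' := Cgy h Kh Ch; have [Chy rhy] := cJ _ Ch'.
    have -> : (g * h = (g * y) * ((h * y) ^ y))%g by rewrite conjgE !mulgA yV !yy.
    by rewrite (repM rC) ?Cgy // rhy !mulmxA.
- move=> g Kg; rewrite /rho; case: ifP => Cg; first exact: (rep_orth rC).
  by apply: orthM; [apply: (rep_orth rC); rewrite Cgy ?Cg|exact: flipx_orth].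
- move=> g Kg; rewrite /rho; case: ifP => Cg; first exact: (rep_inj rC).
  have [c [s ->]] := rE (g * y)%g; move/matrixP/(_ 2 2).
  rewrite mxE sum3 !mxE /= !(mulr0, add0r, mulr1n, mul0r) mul1r => /eqP.
  by rewrite eqNr oner_eq0.
- move=> g Kg; rewrite /rho; case: ifP => Cg; first exact: dC.
  by rewrite det_mulmx dC ?Cgy ?Cg // flipx_det mulr1.
Qed.

Lemma polyhedral_rot_rep (gT : finGroupType) (K : {group gT}) :
  cyclic K
  \/ (exists2 n, (1 < n)%N & K \isog [set: extremal.dihedral_gtype n.*2]%g)
  \/ (K \isog 'Alt_('I_4))%g \/ (K \isog 'Sym_('I_4))%g \/ (K \isog 'Alt_('I_5))%g ->
  exists rho : gT -> 'M[R]_3, rot_rep K rho.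
Proof.
have iso_rep (hT : finGroupType) (H : {group hT}) : (exists rho, rot_rep H (rho : _ -> 'M[R]_3)) ->
    (K \isog H)%g -> exists rho : gT -> 'M[R]_3, rot_rep K rho.
  move=> [rho [rH dH]] /isogP[f /injmP injf defH].
  have Hf g : g \in K -> f g \in H by move=> Kg; rewrite -defH mem_morphim.
  exists (rho \o f); split => [|g Kg /=]; last by rewrite dH ?Hf.
  split => [g h Kg Kh|g Kg|g Kg] /=.
  - by rewrite morphM // (repM rH) ?Hf.
  - by apply: (rep_orth rH); exact: Hf.
  - move/(rep_inj rH (Hf g Kg)) => fg1; apply: injf => //.
    by rewrite fg1 morph1.
case=> [|[[n n1]|[|[|]]]].
- by case/cyclic_rot_rep => rho [? _]; exists rho.
- exact: dihedral_rot_rep.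
- apply: iso_rep; have [rho rS] := Sym4_rot_rep R; exists rho.
  by apply: rot_repS rS; exact: finset.subsetT.
- by apply: iso_rep; exact: Sym4_rot_rep.
- by apply: iso_rep; exact: Alt5_rot_rep.
Qed.

End Rotations.

(** * Representations whose determinant is the sign of the quotient *)

Section AbelianReps.
Local Open Scope ring_scope.
Variables (R : realType) (gT : finGroupType) (G K : {group gT}).
Hypotheses (sKG : K \subset G) (iGK : #|G : K|%g = 2%N).
Hypotheses (abG : abelian G) (cK : cyclic K).

Definition sign_rep (rho : gT -> 'M[R]_3) :=
  orth_rep G rho /\ forall g, g \in G -> \det (rho g) = (-1) ^+ (g \notin K).

Let inKM g h : g \in G -> h \in G -> ((g * h)%g \in K) = ((g \in K) == (h \in K)).
Proof.
move=> Gg Gh; case: (boolP (g \in K)) => Kg; first by rewrite groupMl.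
case: (boolP (h \in K)) => Kh; first by rewrite groupMr // (negbTE Kg).
by rewrite (index2_mul sKG iGK).
Qed.

(** G is the direct product of K and <z>; K acts by rotations about one axis and z by -1. *)
Lemma sign_rep_involution z : z \in G -> z \notin K -> (z ^+ 2 = 1)%g ->
  exists2 rho, sign_rep rho & rho z = - 1%:M.
Proof.
move=> Gz nKz z2; have [r [[rK dK] rE]] := cyclic_rot_rep R cK.
have zz g : (z * (z * g) = g)%g by rewrite mulgA -(expgS z 1) z2 mul1g.
have Kz g : g \in G -> g \notin K -> (z * g)%g \in K.
  by move=> Gg nKg; rewrite inKM // (negbTE nKz) (negbTE nKg).
have cGG := centsP abG.
pose rho g := if g \in K then r g else - r (z * g)%g.
exists rho; last first.
  by rewrite /rho (negbTE nKz) -(expgS z 1) z2 (rep1 rK).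
split; first split.
- move=> g h Gg Gh; rewrite /rho inKM //.
  case: (boolP (g \in K)) => Kg; case: (boolP (h \in K)) => Kh /=.
  + by rewrite (repM rK).
  + rewrite mulmxN -(repM rK) ?Kz //; congr (- r _).
    by rewrite mulgA (cGG z Gz g Gg) mulgA.
  + by rewrite mulNmx -(repM rK) ?Kz // mulgA.
  + rewrite mulNmx mulmxN opprK -(repM rK) ?Kz //; congr (r _).
    by rewrite -(mulgA z) (mulgA g) (cGG g Gg z Gz) -(mulgA z) zz.
- move=> g Gg; rewrite /rho; case: ifP => Kg; first exact: (rep_orth rK).
  by apply: orthN; apply: (rep_orth rK); rewrite Kz ?Kg.
- move=> g Gg; rewrite /rho; case: ifP => Kg; first exact: (rep_inj rK).
  have [c [s ->]] := rE (z * g)%g; move/matrixP/(_ 2 2).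
  by rewrite !mxE /= mulr1n => /eqP; rewrite eqNr oner_eq0.
- move=> g Gg; rewrite /rho; case: (boolP (g \in K)) => Kg /=; first exact: dK.
  by rewrite detN3 dK ?Kz.
Qed.

(** Here G itself is cyclic, and its rotations about one axis are multiplied by the sign. The last
    diagonal entry of a signed rotation is -1, so none of them is the identity. *)
Lemma sign_rep_free : (forall g, g \in G -> g \notin K -> (g ^+ 2 != 1)%g) ->
  exists rho, sign_rep rho.
Proof.
move=> noinv; have cG := index2_noinv_cyclic sKG iGK abG cK noinv.
have [r [[rG dG] rE]] := cyclic_rot_rep R cG.
exists (fun g => (-1) ^+ (g \notin K) *: r g); split; first split.
- move=> g h Gg Gh; rewrite inKM // (repM rG) // -scalemxAl -scalemxAr scalerA -signr_addb.
  by congr (_ ^+ _ *: _); case: (g \in K); case: (h \in K).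
- move=> g Gg; case: (g \notin K); rewrite ?expr0 ?expr1 ?scale1r ?scaleN1r.
    by apply: orthN; exact: (rep_orth rG).
  exact: (rep_orth rG).
- move=> g Gg; case: (g \notin K); rewrite ?expr0 ?expr1 ?scale1r ?scaleN1r.
    have [c [s ->]] := rE g; move/matrixP/(_ 2 2).
    by rewrite !mxE /= mulr1n => /eqP; rewrite eqNr oner_eq0.
  exact: (rep_inj rG).
- move=> g Gg; rewrite detZ dG // mulr1; case: (g \notin K); last by rewrite expr0 expr1n.
  by rewrite expr1 -signr_odd.
Qed.

End AbelianReps.

(** * The degree of a singular 2-cube of the sphere *)

Section LocalDegree.
Local Open Scope ring_scope.
Variable R : realType.
Implicit Types (p q v : 'cV[R]_3).

(* A 1-cochain on pairs of nearby points of the sphere counting the crossings of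
   the half-plane y = 0 < x; away from the poles it is closed. The 2-cochain deg_sq
   is its coboundary over the northern hemisphere and 0 over the southern one, so
   it is closed everywhere and represents a generator of H^2(S^2). *)
Definition upper p : int := (0 <= p 1 0)%R%:R.

Definition crossing p q : int := if 0 < p 0 0 then upper q - upper p else 0.

Definition deg_sq (p00 p10 p01 p11 : 'cV[R]_3) : int :=
  if 0 <= p00 2 0 then
    crossing p00 p10 + crossing p10 p11 - crossing p01 p11 - crossing p00 p01
  else 0.

Definition near8 p q := forall i, `|p i 0 - q i 0| < 8^-1.

(** Within 1/8 of v either x keeps its sign, so that the cochain is a coboundary or zero, or |v_x|
    <= 1/8 and then |v_y| > 1/8, so that y keeps its sign. *)
Lemma crossing_flat v p00 p10 p01 p11 : 15 / 16 <= v 0 0 ^+ 2 + v 1 0 ^+ 2 ->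
  near8 p00 v -> near8 p10 v -> near8 p01 v -> near8 p11 v ->
  crossing p00 p10 + crossing p10 p11 - crossing p01 p11 - crossing p00 p01 = 0.
Proof.
move=> vn n00 n10 n01 n11.
have bnd p i : near8 p v -> v i 0 - 8^-1 < p i 0 < v i 0 + 8^-1.
  by move=> /(_ i); rewrite ltr_distl.
have [vx|vx] := ltrP 8^-1 (v 0 0).
  have pos p : near8 p v -> 0 < p 0 0 by move/(bnd p 0)/andP => [? _]; lra.
  by rewrite /crossing !pos //; ring.
have [vx'|vx'] := ltrP (v 0 0) (- 8^-1).
  have neg p : near8 p v -> (0 < p 0 0) = false.
    by move/(bnd p 0)/andP => [_ ?]; apply/negbTE; rewrite -leNgt; lra.
  by rewrite /crossing !neg //; ring.
have vy : 64^-1 < v 1 0 ^+ 2.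
  have : v 0 0 ^+ 2 <= 64^-1.
    have -> : 64^-1 = 8^-1 ^+ 2 :> R by rewrite exprVn -natrX.
    by rewrite -(real_normK (num_real (v 0 0))) lerXn2r ?nnegrE ?ler_norml ?vx ?vx' //; lra.
  by move=> ?; lra.
have hE p : near8 p v -> upper p = (0 <= v 1 0)%R%:R.
  move/(bnd p 1)/andP => [b1 b2]; rewrite /upper; congr (_%:R); congr nat_of_bool.
  have [v0|v0] := lerP 0 (v 1 0).
    have : 8^-1 < v 1 0 by rewrite ltNge; apply/negP => ?; nra.
    by move=> ?; apply/idP; lra.
  have : v 1 0 < - 8^-1 by rewrite ltNge; apply/negP => ?; nra.
  by move=> ?; apply/negbTE; rewrite -ltNge; lra.
by rewrite /crossing !hE // subrr !if_same; ring.
Qed.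

(** The corners all lie in the north, where the coboundary of a coboundary cancels, or all in the
    south, where every term is zero, or |z| <= 1/8 at the base corner. In the last case x^2 + y^2 >=
    63/64 and every face vanishes by [crossing_flat]. *)
Lemma deg_sq_closed (v : bool -> bool -> bool -> 'cV[R]_3) :
  v false false false 0 0 ^+ 2 + v false false false 1 0 ^+ 2 +
    v false false false 2 0 ^+ 2 = 1 ->
  (forall a b c, near8 (v a b c) (v false false false)) ->
  let D0 a := deg_sq (v a false false) (v a true false) (v a false true) (v a true true) in
  let D1 a := deg_sq (v false a false) (v true a false) (v false a true) (v true a true) in
  let D2 a := deg_sq (v false false a) (v true false a) (v false true a) (v true true a) in
  D0 true - D0 false - (D1 true - D1 false) + (D2 true - D2 false) = 0.
Proof.
move=> vn vv /=; set o := v false false false in vn vv.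
have bnd a b c i : o i 0 - 8^-1 < v a b c i 0 < o i 0 + 8^-1.
  by have := vv a b c i; rewrite ltr_distl.
have [oz|oz] := ltrP 8^-1 (o 2 0).
  have pos a b c : 0 <= v a b c 2 0 by have /andP[? _] := bnd a b c 2; lra.
  by rewrite /deg_sq !pos /o; ring.
have [oz'|oz'] := ltrP (o 2 0) (- 8^-1).
  have neg a b c : (0 <= v a b c 2 0) = false.
    by apply/negbTE; rewrite -ltNge; have /andP[_ ?] := bnd a b c 2; lra.
  by rewrite /deg_sq !neg.
have flat a b c d e f g h i j k l : deg_sq (v a b c) (v d e f) (v g h i) (v j k l) = 0.
  rewrite /deg_sq; case: ifP => // _; apply: (crossing_flat (v := o)) => //.
  have : o 2 0 ^+ 2 <= 64^-1.
    have -> : 64^-1 = 8^-1 ^+ 2 :> R by rewrite exprVn -natrX.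
    by rewrite -(real_normK (num_real (o 2 0))) lerXn2r ?nnegrE ?ler_norml ?oz ?oz' //; lra.
  by move=> ?; lra.
by rewrite !flat; ring.
Qed.

Definition deg_grid N (f : nat -> nat -> 'cV[R]_3) : int :=
  \sum_(i < N) \sum_(j < N) deg_sq (f i j) (f i.+1 j) (f i j.+1) (f i.+1 j.+1).

(** The differences of opposite outer faces telescope into a sum over the small cubes, where the
    cochain is closed. *)
Lemma deg_grid_boundary N (f : nat -> nat -> nat -> 'cV[R]_3) :
  (forall i j k, (i < N)%N -> (j < N)%N -> (k < N)%N ->
    f i j k 0 0 ^+ 2 + f i j k 1 0 ^+ 2 + f i j k 2 0 ^+ 2 = 1 /\
    forall a b c : bool, near8 (f (a + i)%N (b + j)%N (c + k)%N) (f i j k)) ->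
  deg_grid N (f N) - deg_grid N (f 0%N)
  - (deg_grid N (fun i k => f i N k) - deg_grid N (fun i k => f i 0%N k))
  + (deg_grid N (fun i j => f i j N) - deg_grid N (fun i j => f i j 0%N)) = 0.
Proof.
move=> small.
pose D0 i j k := deg_sq (f i j k) (f i j.+1 k) (f i j k.+1) (f i j.+1 k.+1).
pose D1 i j k := deg_sq (f i j k) (f i.+1 j k) (f i j k.+1) (f i.+1 j k.+1).
pose D2 i j k := deg_sq (f i j k) (f i.+1 j k) (f i j.+1 k) (f i.+1 j.+1 k).
have tel (F : nat -> int) : F N - F 0%N = \sum_(i < N) (F i.+1 - F i).
  by rewrite -(big_mkord xpredT (fun i => F i.+1 - F i)) telescope_sumr.
have -> : deg_grid N (f N) - deg_grid N (f 0%N) =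
    \sum_(i < N) \sum_(j < N) \sum_(k < N) (D0 i.+1 j k - D0 i j k).
  rewrite (tel (fun i => deg_grid N (f i))); apply: eq_bigr => i _.
  by rewrite /deg_grid -sumrB; apply: eq_bigr => j _; rewrite -sumrB.
have -> : deg_grid N (fun i k => f i N k) - deg_grid N (fun i k => f i 0%N k) =
    \sum_(i < N) \sum_(j < N) \sum_(k < N) (D1 i j.+1 k - D1 i j k).
  rewrite (tel (fun j => deg_grid N (fun i k => f i j k))) exchange_big /=.
  apply: eq_bigr => i _.
  by rewrite /deg_grid -sumrB; apply: eq_bigr => j _; rewrite -sumrB.
have -> : deg_grid N (fun i j => f i j N) - deg_grid N (fun i j => f i j 0%N) =
    \sum_(i < N) \sum_(j < N) \sum_(k < N) (D2 i j k.+1 - D2 i j k).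
  rewrite (tel (fun k => deg_grid N (fun i j => f i j k))).
  transitivity (\sum_(k < N) \sum_(i < N) \sum_(j < N) (D2 i j k.+1 - D2 i j k)).
    apply: eq_bigr => i _.
    by rewrite /deg_grid -sumrB; apply: eq_bigr => j _; rewrite -sumrB.
  by rewrite exchange_big /=; apply: eq_bigr => i _; rewrite exchange_big.
rewrite -sumrB -big_split /= big1 // => i _; rewrite -sumrB -big_split /= big1 // => j _.
rewrite -sumrB -big_split /= big1 // => k _.
have [n1 nr] := small i j k (ltn_ord i) (ltn_ord j) (ltn_ord k).
exact: (deg_sq_closed (v := fun a b c => f (a + i)%N (b + j)%N (c + k)%N)).
Qed.

Lemma crossing_id p : crossing p p = 0.
Proof. by rewrite /crossing subrr if_same. Qed.

Lemma deg_sq_deg0 p q : deg_sq p p q q = 0.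
Proof. by rewrite /deg_sq !crossing_id; case: ifP => // _; ring. Qed.

Lemma deg_sq_deg1 p q : deg_sq p q p q = 0.
Proof. by rewrite /deg_sq !crossing_id; case: ifP => // _; ring. Qed.

End LocalDegree.

(** * Uniform grids on the cube *)

Section Grid.
Local Open Scope classical_set_scope.
Local Open Scope ring_scope.
Variable R : realType.
Local Notation I := (set_type (@unit_interval R)).

(* The closed form of max 0 (min 1 x). *)
Definition clampr (x : R) : R := (`|x| - `|x - 1| + 1) / 2.

Lemma clampr_id x : 0 <= x <= 1 -> clampr x = x.
Proof.
by case/andP=> x0 x1; rewrite /clampr ger0_norm // ler0_norm ?subr_le0 //; field.
Qed.

Lemma clampr_subproof x : clampr x \in @unit_interval R.
Proof.
rewrite inE /unit_interval /= /clampr.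
have [x0|x0] := leP 0 x; have [x1|x1] := leP 0 (x - 1).
- by rewrite (ger0_norm x0) (ger0_norm x1); lra.
- by rewrite (ger0_norm x0) (ltr0_norm x1); lra.
- by lra.
- by rewrite (ltr0_norm x0) (ltr0_norm x1); lra.
Qed.

Definition clamp (x : R) : I := SigSub (clampr_subproof x).

Lemma clamp_continuous : continuous clamp.
Proof.
apply: (@continuous_comp_initial _ _ _ (@set_val _ (@unit_interval R)) clamp) => x.
have -> : @set_val _ (@unit_interval R) \o clamp = clampr by apply/funext.
rewrite /clampr; apply: cvgMr_tmp; apply: cvgD; last exact: cvg_cst.
apply: cvgB; first exact: norm_continuous.
by apply: (continuous_comp (f := fun y : R => y - 1)); [apply: cvgB => //;
  exact: cvg_cst|exact: norm_continuous].
Qed.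

Lemma clampK (x : I) : clamp (val x) = x.
Proof.
apply: val_inj => /=; apply: clampr_id.
by have := valP x; rewrite inE.
Qed.

Lemma val_clamp x : 0 <= x <= 1 -> val (clamp x) = x.
Proof. exact: clampr_id. Qed.

(** The cube is the image under [clamp] of a product of closed intervals in the space of functions,
    compact by Tychonoff. *)
Lemma cube_compact n : compact [set: cube R n].
Proof.
pose f (u : {ptws 'I_n -> R}) : cube R n := fun j => clamp (u j).
have cf : continuous f.
  move=> u; have ? := @fmap_filter _ _ f (nbhs u) _.
  apply/cvg_sup => j.
  have ct : continuous (fun u : {ptws 'I_n -> R} => f u j).
    move=> v; apply: (@continuous_comp _ _ _ (fun u : {ptws 'I_n -> R} => u j) clamp).
      exact: (@proj_continuous 'I_n (fun=> R) j).
    exact: clamp_continuous.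
  exact: (@continuous_comp_initial _ _ _ (fun u : cube R n => u j) f ct).
have -> : [set: cube R n] = f @` [set u | forall j, `[0, 1]%classic (u j)].
  apply/seteqP; split => // t _; exists (fun j => val (t j)).
    by move=> j; have := valP (t j); rewrite inE /= in_itv.
  by apply/funext => j; exact: clampK.
apply: (@continuous_compact {ptws 'I_n -> R} (cube R n) f).
  by apply: continuous_subspaceT => x; exact: cf.
have T := @tychonoff 'I_n (fun=> R) (fun=> `[0, 1]%classic) (fun=> @segment_compact R 0 1).
exact: T.
Qed.

Lemma cvg_cube n (T : Type) (F : set_system T) (u : T -> cube R n) (x : cube R n) :
  Filter F -> (forall j, (fun t => u t j) @ F --> x j) -> u @ F --> x.
Proof.
move=> FF H; have ? := @fmap_filter _ _ u F FF.
apply/cvg_sup => j U; have /= -> := @nbhsE (initial_topology (fun y : cube R n => y j)) x.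
case=> B [[C oC <-] Cx] /filterS; apply; apply: (H j).
by rewrite /= nbhsE; exists C.
Qed.

Definition shift n (b : 'I_n -> R) (m : nat) (x : cube R n) : cube R n :=
  fun j => clamp (val (x j) + b j * harmonic m).

(** This is uniform continuity: the estimate holds near each point for large m, and compactness
    gives one m for all points. The step [harmonic m] is 1 / (m + 1), the mesh of [grid]. *)
Lemma shift_near n (f : cube R n -> R) (b : 'I_n -> R) (e : R) : continuous f -> 0 < e ->
  \forall m \near \oo, forall x, `|f (shift b m x) - f x| < e.
Proof.
move=> cf e0; have /compact_near_coveringP H := @cube_compact n.
have K : \forall m \near \oo, [set: cube R n] `<=` (fun x => `|f (shift b m x) - f x| < e).
  apply: (H nat \oo (fun m x => `|f (shift b m x) - f x| < e)) => x0 _.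
  have FF : Filter (filter_prod (nbhs x0) (\oo : set_system nat)) by exact: filter_prod_filter.
  have csh : (fun z : cube R n * nat => shift b z.2 z.1) @
      filter_prod (nbhs x0) \oo --> x0.
    apply: cvg_cube => j.
    have -> : x0 j = clamp (val (x0 j) + b j * 0) by rewrite mulr0 addr0 clampK.
    apply: (@cvg_comp _ _ _ (fun z : cube R n * nat => val (z.1 j) + b j * harmonic z.2) clamp).
      apply: cvgD.
        apply: (@cvg_comp _ _ _ fst (fun x : cube R n => val (x j)) _ (nbhs x0)).
          exact: cvg_fst.
        apply: (@continuous_comp _ _ _ (fun t : cube R n => t j) val).
          exact: (@proj_continuous 'I_n (fun=> I) j).
        exact: initial_continuous.
      apply: cvgMl_tmp; apply: (@cvg_comp _ _ _ snd harmonic _ \oo).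
        exact: cvg_snd.
      exact: cvg_harmonic.
    exact: clamp_continuous.
  have c1 : (fun z : cube R n * nat => f (shift b z.2 z.1)) @
      filter_prod (nbhs x0) \oo --> f x0.
    exact: (@cvg_comp _ _ _ (fun z : cube R n * nat => shift b z.2 z.1) f _ _ _ csh (cf x0)).
  have c2 : (fun z : cube R n * nat => f z.1) @ filter_prod (nbhs x0) \oo --> f x0.
    apply: (@cvg_comp _ _ _ fst f _ (nbhs x0) _ _ (cf x0)); exact: cvg_fst.
  have D := cvgB c1 c2; rewrite subrr in D.
  have H1 := @cvgr0_norm_lt _ _ _ _ FF _ (D FF) e e0.
  exact: H1.
by apply: filterS K => m Km x; exact: Km.
Qed.

Definition grid n m (i : 'I_n -> nat) : cube R n := fun j => clamp ((i j)%:R / m.+1%:R).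

Lemma grid_near n (f : cube R n -> R) (b : 'I_n -> bool) (e : R) : continuous f -> 0 < e ->
  \forall m \near \oo, forall i, (forall j, (i j <= m)%N) ->
    `|f (grid m (fun j => b j + i j)%N) - f (grid m i)| < e.
Proof.
move=> cf e0; have := shift_near (fun j => (b j)%:R) cf e0.
apply: filterS => m Hm i im; have := Hm (grid m i).
suff -> : shift (fun j => (b j)%:R) m (grid m i) = grid m (fun j => b j + i j)%N by [].
apply/funext => j; rewrite /shift /grid val_clamp; last first.
  by rewrite divr_ge0 //= ler_pdivrMr // mul1r ler_nat ltnW // ltnS.
by congr clamp; rewrite /harmonic natrD mulrDl addrC.
Qed.

Lemma face_map3 (e : bool) (t : cube R 2) :
  (face_map 0 e t 0 = endpoint R e) * (face_map 0 e t 1 = t 0) * (face_map 0 e t 2 = t 1) *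
  (face_map 1 e t 0 = t 0) * (face_map 1 e t 1 = endpoint R e) * (face_map 1 e t 2 = t 1) *
  (face_map 2 e t 0 = t 0) * (face_map 2 e t 1 = t 1) * (face_map 2 e t 2 = endpoint R e).
Proof.
have U (a b : 'I_3) : a = b -> unlift a b = None by move=> ->; exact: unlift_none.
have L (a b : 'I_3) (k : 'I_2) : b = fintype.lift a k -> unlift a b = Some k by move=> ->;
  exact: liftK.
do ?split; rewrite /face_map.
- by rewrite (U 0 0).
- by rewrite (L 0 1 0) //; exact: val_inj.
- by rewrite (L 0 2 1) //; exact: val_inj.
- by rewrite (L 1 0 0) //; exact: val_inj.
- by rewrite (U 1 1).
- by rewrite (L 1 2 1) //; exact: val_inj.
- by rewrite (L 2 0 0) //; exact: val_inj.
- by rewrite (L 2 1 1) //; exact: val_inj.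
- by rewrite (U 2 2).
Qed.

End Grid.

(** * Invariance of the degree under homology *)

Section ChainDegree.
Local Open Scope classical_set_scope.
Local Open Scope ring_scope.
Variables (R : realType) (X : topologicalType) (g : X -> 'cV[R]_3).
Hypothesis cg : continuous g.
Hypothesis sg : forall x, g x \in @sphere R.

Definition idx2 (i j : nat) (k : 'I_2) : nat := if k == 0 then i else j.
Definition idx3 (i j l : nat) (k : 'I_3) : nat :=
  if k == 0 then i else if k == 1 then j else l.

(** The value for a single m need not be a homology invariant; only statements for all large m are
    made about it. *)
Definition deg_cube m (s : @singular_cube R 2 X) : int :=
  deg_grid m.+1 (fun i j => g (s (grid R m (idx2 i j)))).

Lemma grid_face m i j (e : bool) :
  (face_map 0 e (grid R m (idx2 i j)) = grid R m (idx3 (e * m.+1) i j)) *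
  (face_map 1 e (grid R m (idx2 i j)) = grid R m (idx3 i (e * m.+1) j)) *
  (face_map 2 e (grid R m (idx2 i j)) = grid R m (idx3 i j (e * m.+1))).
Proof.
have E : endpoint R e = clamp ((e * m.+1)%:R / m.+1%:R).
  by apply: val_inj; rewrite natrM mulfK ?pnatr_eq0 // val_clamp //; case: e; rewrite ?lexx ?ler01.
by do ?split; apply/funext => k; elim/ord3P: k; rewrite face_map3 ?E.
Qed.

Lemma deg_cube_boundary (c : @singular_cube R 3 X) : \forall m \near \oo,
  \sum_(i < 3) (-1) ^+ i * (deg_cube m (face i true c) - deg_cube m (face i false c)) = 0.
Proof.
have cc (k : 'I_3) : continuous (fun t => g (c t) k 0).
  move=> t; apply: (@continuous_comp _ _ _ (fun t => g (c t)) (fun v : 'cV[R]_3 => v k 0)).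
    by apply: (@continuous_comp _ _ _ c g); [exact: cts_fun|exact: cg].
  exact: coord_continuous.
have small : \forall m \near \oo, forall (b : bool * bool * bool) (k : 'I_3),
    forall i, (forall j, (i j <= m)%N) ->
    `|g (c (grid R m (fun j => idx3 b.1.1 b.1.2 b.2 j + i j)%N)) k 0 - g (c (grid R m i)) k 0|
      < 8^-1.
  apply: filter_forall => b; apply: filter_forall => k.
  have := @grid_near R 3 (fun t => g (c t) k 0) (fun j =>
    if j == 0 then b.1.1 else if j == 1 then b.1.2 else b.2) 8^-1 (cc k).
  rewrite invr_gt0 ltr0n => /(_ isT); apply: filterS => m H i im.
  have := H i im; congr (`|g (c (grid R m _)) k 0 - _| < _).
  by apply/funext => j; rewrite /idx3; case: (j == 0) => //; case: (j == 1).
apply: filterS small => m small.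
rewrite sum3 expr0 mul1r /= expr1 mulN1r -signr_odd /= mul1r.
have fE i (e : bool) : deg_cube m (face i e c) =
    deg_grid m.+1 (fun a b => g (c (face_map i e (grid R m (idx2 a b))))) by [].
rewrite !fE.
pose f i j k := g (c (grid R m (idx3 i j k))).
have F0 (e : bool) : deg_grid m.+1 (fun a b => g (c (face_map 0 e (grid R m (idx2 a b))))) =
    deg_grid m.+1 (f (e * m.+1)%N).
  by congr deg_grid; apply/funext => a; apply/funext => b; rewrite grid_face.
have F1 (e : bool) : deg_grid m.+1 (fun a b => g (c (face_map 1 e (grid R m (idx2 a b))))) =
    deg_grid m.+1 (fun a b => f a (e * m.+1)%N b).
  by congr deg_grid; apply/funext => a; apply/funext => b; rewrite grid_face.
have F2 (e : bool) : deg_grid m.+1 (fun a b => g (c (face_map 2 e (grid R m (idx2 a b))))) =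
    deg_grid m.+1 (fun a b => f a b (e * m.+1)%N).
  by congr deg_grid; apply/funext => a; apply/funext => b; rewrite grid_face.
rewrite !F0 !F1 !F2 mul1n mul0n.
apply: deg_grid_boundary => i j k im jm km; split.
  by have := sg (c (grid R m (idx3 i j k))); rewrite inE /sphere /= sum3.
move=> a b d; rewrite /near8 => l.
have := small (a, b, d) l (idx3 i j k); rewrite /f /=.
have -> : (fun j0 : 'I_3 => idx3 a b d j0 + idx3 i j k j0)%N = idx3 (a + i) (b + j) (d + k).
  by apply/funext => z; rewrite /idx3; case: (z == 0) => //; case: (z == 1).
by apply=> z; rewrite /idx3; case: (z == 0) => //; case: (z == 1).
Qed.

Lemma deg_cube_degenerate m (s : @singular_cube R 2 X) : degenerate s -> deg_cube m s = 0.
Proof.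
case=> i si; rewrite /deg_cube /deg_grid big1 // => a _; rewrite big1 // => b _.
have [i0|i1] : i = 0 \/ i = 1.
  by case: i {si} => [[|[|//]]] Hi; [left|right]; exact: val_inj.
- have E u v v' : s (grid R m (idx2 v u)) = s (grid R m (idx2 v' u)).
    by apply: si => j; rewrite i0 /grid /idx2 => /negbTE ->.
  by rewrite (E b a.+1 a) (E b.+1 a.+1 a) deg_sq_deg0.
- have E u v v' : s (grid R m (idx2 u v)) = s (grid R m (idx2 u v')).
    apply: si => j; rewrite i1 /grid /idx2; case: (j =P 0) => // j0.
    by case: j j0 => [[|[|//]]] Hj j0 j1; [case: j0|case/eqP: j1]; exact: val_inj.
  by rewrite (E a b.+1 b) (E a.+1 b.+1 b) deg_sq_deg1.
Qed.

Definition deg_chain m (z : @chain R 2 X) : int :=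
  fglift (deg_cube m : _ -> int^o) z.

Lemma fgliftD (K : choiceType) (M : lmodType int) (f : K -> M) :
  {morph fglift f : x y / x + y}.
Proof.
move=> x y; have fB := @lift_is_additive int K M f.
have f0 : fglift f 0 = 0 by rewrite -(subrr 0) fB subrr.
by rewrite -[y in LHS]opprK fB -(sub0r y) fB f0 sub0r opprK.
Qed.

Lemma fglift0 (K : choiceType) (M : lmodType int) (f : K -> M) : fglift f 0 = 0.
Proof. by rewrite -(subrr 0) (@lift_is_additive int K M f) subrr. Qed.

Lemma fgliftZ (K : choiceType) (M : lmodType int) (f : K -> M) (a : int) z :
  fglift f (a *: z) = a *: fglift f z.
Proof.
have fMn n : fglift f (z *+ n) = fglift f z *+ n.
  by elim: n => [|n IH]; rewrite ?mulr0n ?fglift0 // !mulrS fgliftD IH.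
have fN y : fglift f (- y) = - fglift f y.
  by apply/eqP; rewrite -addr_eq0 -fgliftD addNr fglift0.
case: a => n; rewrite ?NegzE ?scaleNr ?fN -natz !scaler_nat fMn //.
Qed.

Lemma fglift_sum (K : choiceType) (M : lmodType int) (f : K -> M) (z : {freeg K / int}) :
  fglift f z = \sum_(x <- dom z) coeff x z *: f x.
Proof.
rewrite -{1}(freeg_sumE z) (big_morph _ (fgliftD f) (fglift0 f)).
by apply: eq_bigr => x _; rewrite liftU.
Qed.

(** The bounding chain has finitely many cubes, so a single threshold makes all their boundary
    degrees vanish; degenerate cubes contribute 0 at every mesh. *)
Lemma homologous_deg z w : homologous z w ->
  \forall m \near \oo, deg_chain m z = deg_chain m w.
Proof.
case=> c [d [dd E]].
have bd : \forall m \near \oo, forall s, s \in dom c ->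
    \sum_(i < 3) (-1) ^+ i * (deg_cube m (face i true s) - deg_cube m (face i false s)) = 0.
  elim: (dom c) => [|s l IH]; first exact: filterS filterT.
  have B := deg_cube_boundary s.
  apply: filterS2 IH B => m IHm Bm s'.
  by rewrite inE => /orP[/eqP ->|/IHm].
apply: filterS bd => m bd.
have -> : z = w + (boundary c + d) by rewrite -E addrC subrK.
rewrite /deg_chain !fgliftD (fglift_sum _ d) [X in _ + (_ + X)]big1_seq ?addr0; last first.
  by move=> s /andP[_ /dd/(deg_cube_degenerate m) ->]; rewrite scaler0.
rewrite /boundary (fglift_sum _ c) (big_morph _ (fgliftD _) (fglift0 _)) big1_seq ?addr0 // =>
  s /andP[_ sc].
rewrite fgliftZ (big_morph _ (fgliftD _) (fglift0 _)).
set y := (X in _ *: X).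
suff -> : y = 0 by rewrite scaler0.
transitivity (\sum_(i < 3) (-1) ^+ i *
  (deg_cube m (face i true s) - deg_cube m (face i false s))); last exact: bd s sc.
apply: eq_bigr => i _; rewrite fgliftZ (@lift_is_additive int _ _ _) !liftU !scale1r.
by [].
Qed.

End ChainDegree.

(** * Degrees of the factor classes *)

Section FactorDegree.
Local Open Scope classical_set_scope.
Local Open Scope ring_scope.
Variable R : realType.
Local Notation S2 := (set_type (@sphere R)).

(** The first index runs along meridians and the second along parallels. Along a closed parallel the
    meridian edges telescope away, which leaves the difference of the crossings of two neighbouring
    parallels. *)
Lemma deg_grid_telescope N (f : nat -> nat -> 'cV[R]_3) :
  (forall i j k, f i j 2 0 = f i k 2 0) -> (forall i, f i N = f i 0%N) ->
  deg_grid N f = \sum_(i < N | 0 <= f i 0%N 2 0)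
    (\sum_(j < N) crossing (f i.+1 j) (f i.+1 j.+1) - \sum_(j < N) crossing (f i j) (f i j.+1)).
Proof.
move=> fz fN; rewrite /deg_grid [RHS]big_mkcond; apply: eq_bigr => i _.
rewrite /deg_sq; under eq_bigr do rewrite (fz i _ 0%N).
case: ifP => _; last by rewrite big1.
have -> : \sum_(j < N) (crossing (f i j) (f i.+1 j) + crossing (f i.+1 j) (f i.+1 j.+1)
    - crossing (f i j.+1) (f i.+1 j.+1) - crossing (f i j) (f i j.+1)) =
  \sum_(j < N) (crossing (f i.+1 j) (f i.+1 j.+1) - crossing (f i j) (f i j.+1))
  - \sum_(j < N) (crossing (f i j.+1) (f i.+1 j.+1) - crossing (f i j) (f i.+1 j)).
  by rewrite -sumrB; apply: eq_bigr => j _; ring.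
rewrite -(big_mkord xpredT (fun j => crossing (f i j.+1) (f i.+1 j.+1)
  - crossing (f i j) (f i.+1 j))).
rewrite (telescope_sumr (fun j => crossing (f i j) (f i.+1 j))) //.
by rewrite !fN subrr subr0 sumrB.
Qed.

Definition sph_pt (N i j : nat) : 'cV[R]_3 :=
  let theta := pi * (i%:R / N%:R) in let psi := pi *+ 2 * (j%:R / N%:R) in
  \col_l [:: sin theta * cos psi; sin theta * sin psi; cos theta]`_l.

(** With N = 4k the equator is row 2k and the longitude pi is column 2k, so the signs of z and y are
    comparisons with 2k. The bound k > 1 makes 2 pi / N smaller than pi / 2, so that the last edge
    of a parallel starts at x > 0. *)
Lemma deg_sph_pt k : (1 < k)%N -> deg_grid (4 * k) (sph_pt (4 * k)) = 1.
Proof.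
move=> k1; set N := (4 * k)%N; have N0 : (0 < N)%N by rewrite /N; lia.
have NR : N%:R != 0 :> R by rewrite pnatr_eq0 -lt0n.
rewrite deg_grid_telescope; first last.
- move=> i; apply: cV3P; rewrite !mxE //= mul0r mulr0 divff // mulr1.
    by rewrite cos0 cos2pi.
  by rewrite sin0 sin2pi.
- by move=> i j l; rewrite !mxE.
pose B i := \sum_(j < N) crossing (sph_pt N i j) (sph_pt N i j.+1).
have pigt : 0 < pi :> R by exact: pi_gt0.
have ang0 i : 0 <= pi * (i%:R / N%:R) :> R by rewrite mulr_ge0 ?divr_ge0 // ltW.
have le_half i : (i <= 2 * k)%N -> pi * (i%:R / N%:R) <= pi / 2 :> R.
  move=> ik; rewrite ler_pM2l // ler_pdivrMr ?ltr0n // mulrC ler_pdivlMr ?ltr0n //.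
  by rewrite -natrM ler_nat /N; lia.
have cos_north i : (i <= 2 * k)%N -> 0 <= cos (pi * (i%:R / N%:R)) :> R.
  move=> ik; apply: cos_ge0_pihalf; rewrite le_half // andbT.
  by apply: le_trans (ang0 i); rewrite oppr_le0 divr_ge0 // ltW.
have cos_south i : (2 * k < i <= N)%N -> cos (pi * (i%:R / N%:R)) < 0 :> R.
  move=> /andP[ki iN]; rewrite -(cos_pihalf R).
  rewrite ltr_cos ?in_itv /=.
  - rewrite ltr_pM2l // ltr_pdivlMr ?ltr0n // mulrC ltr_pdivrMr ?ltr0n //.
    by rewrite -natrM ltr_nat /N; lia.
  - by apply/andP; split; [rewrite divr_ge0 // ltW | rewrite ler_pdivrMr // ler_peMr ?ler1n // ltW].
  - by rewrite ang0 /= ger_pMr // ler_pdivrMr ?ltr0n // mul1r ler_nat.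
rewrite (eq_bigl (fun i : 'I_N => (i < (2 * k).+1)%N)); last first.
  move=> i; rewrite !mxE /= ltnS; case: leqP => ik; first by rewrite cos_north.
  by apply/negbTE; rewrite -ltNge cos_south // ik ltnW.
rewrite -(big_ord_widen N (fun i => B i.+1 - B i)); last by rewrite /N; lia.
rewrite -(big_mkord xpredT (fun i => B i.+1 - B i)) telescope_sumr //.
(* Row 0 is the north pole, where x = 0. What remains is the winding of row 2k + 1, the first one
   south of the equator. *)
have -> : B 0%N = 0.
  apply: big1 => j _; rewrite /crossing !mxE /= mul0r mulr0 sin0 mul0r ltxx.
  by [].
rewrite subr0 {}/B; set i := (2 * k).+1.
have sth : 0 < sin (pi * (i%:R / N%:R)) :> R.
  apply: sin_gt0_pi; apply/andP; split; first by rewrite mulr_gt0 ?divr_gt0 ?ltr0n.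
  by rewrite gtr_pMr // ltr_pdivrMr ?ltr0n // mul1r ltr_nat /i /N; lia.
have psiE j : pi *+ 2 * (j%:R / N%:R) = pi * ((2 * j)%:R / N%:R) :> R.
  by rewrite natrM; ring.
have upE j : (j < N)%N -> upper (sph_pt N i j) = (j <= 2 * k)%N%:R.
  move=> jN; rewrite /upper !mxE /= pmulr_rge0 // psiE; congr (_%:R); congr nat_of_bool.
  case: (leqP j (2 * k)) => jk.
    apply: sin_ge0_pi; rewrite ang0 /= ger_pMr // ler_pdivrMr ?ltr0n // mul1r ler_nat /N; lia.
  have -> : (2 * j)%:R / N%:R = 1 + (2 * j - N)%:R / N%:R :> R.
    rewrite -[X in X + _](divff NR) -mulrDl -natrD; congr (_%:R / _).
    by rewrite subnKC // /N; lia.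
  apply/negbTE; rewrite -ltNge mulrDr mulr1 addrC sinDpi oppr_lt0; apply: sin_gt0_pi.
  have jk' : (0 < 2 * j - N)%N by rewrite /N; lia.
  rewrite mulr_gt0 ?divr_gt0 ?ltr0n //=.
  by rewrite gtr_pMr // ltr_pdivrMr ?ltr0n // mul1r ltr_nat /N; lia.
have upN : upper (sph_pt N i N) = 1.
  by rewrite /upper !mxE /= divff // mulr1 sin2pi mulr0 lexx.
have NE : N = N.-1.+1 by rewrite prednK.
have nN : (N.-1 < N)%N by rewrite prednK.
transitivity (\sum_(j < N.-1.+1) crossing (sph_pt N i j) (sph_pt N i j.+1)).
  by rewrite -NE.
(* Only the last edge counts: there y becomes nonnegative at x > 0. The other change of [upper] is
   after column 2k, where x < 0. *)
rewrite big_ord_recr /= big1 ?add0r => [|j _].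
  rewrite -[N.-1.+1]NE /crossing upN upE //.
  have -> : (N.-1 <= 2 * k)%N = false by rewrite /N; lia.
  rewrite !mxE /= pmulr_rgt0 // psiE.
  have -> : (2 * N.-1)%:R / N%:R = 2 - (2%:R / N%:R) :> R.
    apply: (mulIf NR); rewrite mulrBl !divfK // -natrM -natrB; last by rewrite /N; lia.
    by congr (_%:R); lia.
  rewrite mulrBr -(mulrC 2) mulr_natl addrC cosD2pi cosN.
  rewrite cos_gt0_pihalf ?subr0 //.
  apply/andP; split; last first.
    rewrite ltr_pM2l // ltr_pdivrMr ?ltr0n // mulrC ltr_pdivlMr ?ltr0n //.
    by rewrite -natrM ltr_nat /N; lia.
  by apply: lt_le_trans (ang0 2%N); rewrite oppr_lt0 divr_gt0.
have jN : (j.+1 < N)%N by have := ltn_ord j; lia.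
rewrite /crossing !upE ?(ltnW jN) //.
case: (ltngtP j (2 * k)%N) => jk; rewrite ?subrr ?if_same //.
rewrite !mxE /= pmulr_rgt0 // psiE jk.
have -> : (2 * (2 * k))%:R / N%:R = 1 :> R by rewrite mulnA divff.
by rewrite mulr1 cospi ltr0N1.
Qed.

Lemma deg_grid_ext N (f h : nat -> nat -> 'cV[R]_3) :
  (forall i j, (i <= N)%N -> (j <= N)%N -> f i j = h i j) -> deg_grid N f = deg_grid N h.
Proof.
move=> fh; apply: eq_bigr => i _; apply: eq_bigr => j _.
by rewrite !fh // ltnW.
Qed.

Definition factor_pt (j : 'I_2) (p : S2xS2 R) : 'cV[R]_3 :=
  if j == 0 then val p.1 else val p.2.

Lemma deg_factor_class k (i j : 'I_2) : (1 < k)%N ->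
  deg_chain (factor_pt j) (4 * k).-1 (factor_class R i) = (i == j)%:R.
Proof.
move=> k1; rewrite /factor_class /sphere_class /pushforward liftU scale1r.
rewrite /deg_chain liftU scale1r /deg_cube.
have -> : (4 * k).-1.+1 = (4 * k)%N by lia.
have cl l : (l <= 4 * k)%N -> val (clamp (l%:R / (4 * k).-1.+1%:R : R)) = l%:R / (4 * k)%:R.
  move=> lk; have -> : (4 * k).-1.+1 = (4 * k)%N by lia.
  by rewrite val_clamp // divr_ge0 //= ler_pdivrMr ?ltr0n ?mul1r ?ler_nat //; lia.
have sphE a b : (a <= 4 * k)%N -> (b <= 4 * k)%N ->
    val (spherical (grid R (4 * k).-1 (idx2 a b))) = sph_pt (4 * k) a b.
  move=> ak bk; rewrite /spherical /spherical_vec SubK /sph_pt.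
  have -> : val (grid R (4 * k).-1 (idx2 a b) 0) = a%:R / (4 * k)%:R by exact: cl.
  by have -> : val (grid R (4 * k).-1 (idx2 a b) 1) = b%:R / (4 * k)%:R by exact: cl.
have bk : deg_grid (4 * k) (fun _ _ => val (basepoint R)) = 0.
  by rewrite /deg_grid big1 // => a _; rewrite big1 // => b _; rewrite deg_sq_deg0.
have [ij|ij] := eqVneq i j.
  rewrite ij -[RHS](deg_sph_pt k1); apply: deg_grid_ext => a b ak bk'.
  by rewrite /factor_pt /= /factor_incl; case: (j == 0); exact: sphE.
rewrite -[RHS]bk; apply: deg_grid_ext => a b _ _.
rewrite /factor_pt /= /factor_incl.
case: i j ij => [[|[|//]]] Hi [[|[|//]]] Hj //.
Qed.

Lemma factor_class_indep (a b : 'I_2 -> int) :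
  homologous (\sum_i a i *: factor_class R i) (\sum_i b i *: factor_class R i) -> a =1 b.
Proof.
move=> ab j.
have cg : continuous (factor_pt j).
  rewrite /factor_pt => p; case: (j == 0).
    apply: (@continuous_comp _ _ _ fst (@set_val _ (@sphere R))); first exact: cvg_fst.
    exact: initial_continuous.
  apply: (@continuous_comp _ _ _ snd (@set_val _ (@sphere R))); first exact: cvg_snd.
  exact: initial_continuous.
have sg x : factor_pt j x \in @sphere R.
  by rewrite /factor_pt; case: ifP => _; exact: valP.
have [m _ Hm] := homologous_deg cg sg ab.
(* This index is beyond m, and its grid has 4 (m + 2) steps, as required by [deg_factor_class]. *)
have := Hm (4 * (m + 2)).-1; rewrite /=.
have dE (c : 'I_2 -> int) :
    deg_chain (factor_pt j) (4 * (m + 2)).-1 (\sum_i c i *: factor_class R i) = c j.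
  rewrite {1}/deg_chain (big_morph _ (fgliftD _) (fglift0 _)).
  transitivity (\sum_i c i * (i == j)%:R).
    apply: eq_bigr => i _; rewrite fgliftZ -(@deg_factor_class (m + 2) i j) //; lia.
  rewrite (bigD1 j) //= eqxx mulr1 big1 ?addr0 // => i /negbTE ->; exact: mulr0.
by rewrite !dE; apply; lia.
Qed.

End FactorDegree.

(** * The action of orthogonal maps on homology *)

Section Homologous.
Local Open Scope ring_scope.
Variables (R : realType) (X : topologicalType).
Implicit Types z w d : @chain R 2 X.

Lemma degenerate_chainB d d' :
  degenerate_chain d -> degenerate_chain d' -> degenerate_chain (d - d').
Proof. by move=> D D' s /domB; rewrite mem_cat => /orP[/D|/D']. Qed.

Lemma degenerate_chain0 : degenerate_chain (0 : @chain R 2 X).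
Proof. by move=> s; rewrite dom0. Qed.

Lemma degenerate_chainN d : degenerate_chain d -> degenerate_chain (- d).
Proof. by move=> D; rewrite -sub0r; exact: degenerate_chainB degenerate_chain0 D. Qed.

Lemma degenerate_chainD d d' :
  degenerate_chain d -> degenerate_chain d' -> degenerate_chain (d + d').
Proof. by move=> D D'; rewrite -(opprK d'); exact: degenerate_chainB D (degenerate_chainN D'). Qed.

Lemma degenerate_chainU (s : @singular_cube R 2 X) : degenerate s -> degenerate_chain << s >>.
Proof. by move=> D u; rewrite domU1 inE => /eqP ->. Qed.

Lemma boundaryN (c : @chain R 3 X) : boundary (- c) = - boundary c.
Proof. by rewrite /boundary -scaleN1r fgliftZ scaleN1r. Qed.

Lemma homologous_refl z : homologous z z.
Proof.
exists 0, 0; split; first exact: degenerate_chain0.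
by rewrite subrr /boundary fglift0 addr0.
Qed.

Lemma homologous_trans w z y : homologous z w -> homologous w y -> homologous z y.
Proof.
move=> [c [d [D E]]] [c' [d' [D' E']]]; exists (c + c'), (d + d').
split; first exact: degenerate_chainD.
by rewrite -(subrK w z) -addrA E E' /boundary fgliftD addrACA.
Qed.

Lemma homologous_sym z w : homologous z w -> homologous w z.
Proof.
move=> [c [d [D E]]]; exists (- c), (- d); split; first exact: degenerate_chainN.
by rewrite -opprB E boundaryN opprD.
Qed.

Lemma boundaryU (c : @singular_cube R 3 X) : boundary << c >> =
  (<< face 0 true c >> - << face 0 false c >>) - (<< face 1 true c >> - << face 1 false c >>)
  + (<< face 2 true c >> - << face 2 false c >>).
Proof. by rewrite /boundary liftU scale1r sum3 expr0 scale1r /= expr1 scaleN1r -signr_odd /=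
  scale1r. Qed.

End Homologous.

(** * Homotopies and reversal of the spherical cube *)

Section SphereHomotopy.
Local Open Scope classical_set_scope.
Local Open Scope ring_scope.
Variable R : realType.
Local Notation I := (set_type (@unit_interval R)).
Local Notation S2 := (set_type (@sphere R)).

Lemma spherical_eq (t u : cube R 2) : t 0 = u 0 -> t 1 = u 1 -> spherical t = spherical u.
Proof. by move=> h0 h1; apply: val_inj; rewrite /= /spherical_vec h0 h1. Qed.

Lemma spherical_pole (e : bool) (t u : cube R 2) :
  t 0 = endpoint R e -> u 0 = endpoint R e -> spherical t = spherical u.
Proof.
move=> h0 h1; apply: val_inj; rewrite /= /spherical_vec h0 h1.
apply: cV3P; rewrite !mxE /= //.
  by case: e {h0 h1}; rewrite /= ?mulr1 ?mulr0 ?sinpi ?sin0 !mul0r.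
by case: e {h0 h1}; rewrite /= ?mulr1 ?mulr0 ?sinpi ?sin0 !mul0r.
Qed.

Lemma spherical_seam (e e' : bool) (t u : cube R 2) :
  t 0 = u 0 -> t 1 = endpoint R e -> u 1 = endpoint R e' -> spherical t = spherical u.
Proof.
move=> h h0 h1; apply: val_inj; rewrite /= /spherical_vec h h0 h1.
apply: cV3P; rewrite !mxE /= //.
  by case: e {h0}; case: e' {h1}; rewrite /= ?mulr1 ?mulr0 ?cos2pi ?cos0.
by case: e {h0}; case: e' {h1}; rewrite /= ?mulr1 ?mulr0 ?sin2pi ?sin0.
Qed.

Lemma coord_cube_continuous n (j : 'I_n) : continuous (fun t : cube R n => t j).
Proof. exact: (@proj_continuous 'I_n (fun=> I) j). Qed.

Lemma val_coord_continuous n (j : 'I_n) : continuous (fun t : cube R n => val (t j) : R).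
Proof.
move=> t; apply: (@continuous_comp _ _ _ (fun t : cube R n => t j) val).
  exact: coord_cube_continuous.
exact: initial_continuous.
Qed.

Lemma cube_continuous (T : topologicalType) n (u : T -> cube R n) :
  (forall j, continuous (fun t => u t j)) -> continuous u.
Proof. by move=> H t; apply: cvg_cube => j; exact: (H j t). Qed.

Section Target.
Variable Y : topologicalType.

(** The 3-cube has the homotopy parameter as its first coordinate. Its polar faces are degenerate,
    as the longitude is lost at a pole, and its two longitude faces agree along the seam and
    cancel. *)
Lemma homotopy_homologous (F : I * S2 -> Y) (s0 s1 : @singular_cube R 2 Y) : continuous F ->
  (forall t, s0 t = F (endpoint R false, spherical t)) ->
  (forall t, s1 t = F (endpoint R true, spherical t)) ->
  homologous (<< s0 >> : chain 2 Y) << s1 >>.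
Proof.
move=> cF E0 E1.
pose p (t : cube R 3) : cube R 2 := fun j => if j == 0 then t 1 else t 2.
have cp : continuous p.
  by apply: cube_continuous => j; rewrite /p; case: (j == 0); exact: coord_cube_continuous.
pose c (t : cube R 3) := F (t 0, spherical (p t)).
have cc : continuous c.
  move=> t; apply: (@continuous_comp (cube R 3) (I * S2)%type Y
    (fun t => (t 0, spherical (p t))) F); last exact: cF.
  apply: (@cvg_pair _ _ _ _ (nbhs (t 0)) (nbhs (spherical (p t)))).
  - exact: nbhs_filter.
  - exact: coord_cube_continuous.
  by apply: (@continuous_comp _ _ _ p (@spherical R)); [exact: cp | exact: spherical_continuous].
pose C : @singular_cube R 3 Y := mkcts cc.
exists (- << C >>), (<< face 1 false C >> - << face 1 true C >>); split.
  have D e : degenerate (face 1 e C).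
    exists 1 => t u tu; change (c (face_map 1 e t) = c (face_map 1 e u)).
    rewrite /c !face_map3 (tu 0) //; congr (F (_, _)).
    by apply: (@spherical_pole e); rewrite /p /= !face_map3.
  by apply: degenerate_chainB; exact: degenerate_chainU.
rewrite boundaryN boundaryU.
have -> : face 0 false C = s0.
  apply/continuousEP => t; rewrite E0;
  change (c (face_map 0 false t) = F (endpoint R false, spherical t)).
  rewrite /c !face_map3; congr (F (_, _)).
  by apply: spherical_eq; rewrite /p /= face_map3.
have -> : face 0 true C = s1.
  apply/continuousEP => t; rewrite E1;
  change (c (face_map 0 true t) = F (endpoint R true, spherical t)).
  rewrite /c !face_map3; congr (F (_, _)).
  by apply: spherical_eq; rewrite /p /= face_map3.
have -> : face 2 true C = face 2 false C.
  apply/continuousEP => t; change (c (face_map 2 true t) = c (face_map 2 false t)).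
  rewrite /c !face_map3; congr (F (_, _)).
  by apply: (@spherical_seam true false); rewrite /p /= !face_map3.
have E2 (V : zmodType) (x y a b u : V) : x - y = - (y - x - (a - b) + (u - u)) + (b - a).
  by rewrite subrr addr0 (opprB (y - x)) (opprB y) addrAC -(opprB a b) subrr add0r.
exact: E2.
Qed.

Definition reverse (t : cube R 2) : cube R 2 :=
  fun j => if j == 0 then t 0 else clamp (1 - val (t 1)).

(** The 3-cube has longitude t1 (1 - t2): its face t2 = 0 is s and its face t1 = 1 is s', occurring
    with equal signs. The faces t1 = 0 and t2 = 1 have constant longitude 0, and the polar faces are
    degenerate. *)
Lemma reverse_homologous (f : S2 -> Y) (s s' : @singular_cube R 2 Y) : continuous f ->
  (forall t, s t = f (spherical t)) -> (forall t, s' t = f (spherical (reverse t))) ->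
  homologous (<< s' >> : chain 2 Y) (- << s >>).
Proof.
move=> cf E E'.
pose p (t : cube R 3) : cube R 2 :=
  fun j => if j == 0 then t 0 else clamp (val (t 1) * (1 - val (t 2))).
have cp : continuous p.
  apply: cube_continuous => j; rewrite /p; case: (j == 0); first exact: coord_cube_continuous.
  move=> t; apply: (@continuous_comp _ _ _ (fun t : cube R 3 =>
    val (t 1) * (1 - val (t 2))) (@clamp R)).
    apply: continuousM; first exact: val_coord_continuous.
    by apply: continuousB; [exact: cst_continuous | exact: val_coord_continuous].
  exact: clamp_continuous.
have cc : continuous (fun t => f (spherical (p t))).
  move=> t; apply: (@continuous_comp _ _ _ (fun t => spherical (p t)) f); last exact: cf.
  by apply: (@continuous_comp _ _ _ p (@spherical R)); [exact: cp | exact: spherical_continuous].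
pose C : @singular_cube R 3 Y := mkcts cc.
exists (- << C >>), ((<< face 0 true C >> - << face 0 false C >>)
  + (<< face 1 false C >> + << face 2 true C >>)); split.
  have D0 e : degenerate (face 0 e C).
    exists 0 => t u _; congr f; apply: (@spherical_pole e); rewrite /p /= !face_map3 //.
  have cl0 x : x = 0 -> clamp x = endpoint R false.
    by move=> ->; apply: val_inj; rewrite val_clamp // lexx ler01.
  have D1 : degenerate (face 1 false C).
    exists 1 => t u tu; congr f; apply: (@spherical_seam false false);
      rewrite /p /= !face_map3 ?(tu 0) //; apply: cl0; exact: mul0r.
  have D2 : degenerate (face 2 true C).
    exists 1 => t u tu; congr f; apply: (@spherical_seam false false);
      rewrite /p /= !face_map3 ?(tu 0) //; apply: cl0; by rewrite subrr mulr0.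
  by apply: degenerate_chainD; [apply: degenerate_chainB | apply: degenerate_chainD];
    exact: degenerate_chainU.
rewrite boundaryN boundaryU.
have -> : face 2 false C = s.
  apply/continuousEP => t; rewrite E; congr f; apply: spherical_eq; rewrite /p /= !face_map3 //.
  by rewrite subr0 mulr1 clampK.
have -> : face 1 true C = s'.
  apply/continuousEP => t; rewrite E'; congr f; apply: spherical_eq; rewrite /p /= !face_map3 //.
  by rewrite mul1r.
have E0 (V : zmodType) (x y a b u : V) :
    x - - y = - (u - (x - a) + (b - y)) + (u + (a + b)).
  have -> : - (u - (x - a) + (b - y)) = (x + y) - (u + (a + b)).
    by rewrite (opprB x) -(addrA u) (addrACA a) -opprD addrA opprB.
  by rewrite subrK opprK.
exact: E0.
Qed.

End Target.
End SphereHomotopy.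

(** * Path components of O(3) *)

Section OrthogonalPaths.
Local Open Scope classical_set_scope.
Local Open Scope ring_scope.
Variable R : realType.
Local Notation I := (set_type (@unit_interval R)).
Implicit Types (A B : 'M[R]_3) (x y n : 'cV[R]_3).

Lemma ctsD (T : topologicalType) (f g : T -> R) :
  continuous f -> continuous g -> continuous (fun t => f t + g t).
Proof. by move=> cf cg t; exact: (cvgD (cf t) (cg t)). Qed.

Lemma ctsB (T : topologicalType) (f g : T -> R) :
  continuous f -> continuous g -> continuous (fun t => f t - g t).
Proof. by move=> cf cg t; exact: (cvgB (cf t) (cg t)). Qed.

Lemma ctsM (T : topologicalType) (f g : T -> R) :
  continuous f -> continuous g -> continuous (fun t => f t * g t).
Proof. by move=> cf cg t; exact: (cvgM (cf t) (cg t)). Qed.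

Lemma ctsV (T : topologicalType) (f : T -> R) :
  (forall t, f t != 0) -> continuous f -> continuous (fun t => (f t)^-1).
Proof. by move=> f0 cf t; exact: (cvgV (f0 t) (cf t)). Qed.

Definition orth_path A B := exists c : I -> 'M[R]_3,
  [/\ forall i j, continuous (fun t => c t i j), forall t, orth (c t),
      c (endpoint R false) = A & c (endpoint R true) = B].

Lemma orth_path_refl A : orth A -> orth_path A A.
Proof. by move=> oA; exists (fun=> A); split => // i j; exact: cst_continuous. Qed.

Lemma orth_pathM A B A' B' :
  orth_path A B -> orth_path A' B' -> orth_path (A *m A') (B *m B').
Proof.
move=> [c [cc oc <- <-]] [d [cd od <- <-]]; exists (fun t => c t *m d t); split => //.
  move=> i j.
  have -> : (fun t => (c t *m d t) i j) =
      (fun t => c t i 0 * d t 0 j + c t i 1 * d t 1 j + c t i 2 * d t 2 j).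
    by apply/funext => t; rewrite mxE sum3.
  by do ?apply: ctsD; apply: ctsM.
by move=> t; exact: orthM.
Qed.

Definition refl_mx n : 'M[R]_3 := 1%:M - (2 / dot n n) *: (n *m n^T).

Lemma refl_mxE n i j : refl_mx n i j = (i == j)%:R - 2 / dot n n * (n i 0 * n j 0).
Proof. by rewrite /refl_mx !mxE big_ord1 !mxE. Qed.

Lemma refl_mxZ a n : a != 0 -> refl_mx (a *: n) = refl_mx n.
Proof.
move=> a0; apply/matrixP => i j; rewrite !refl_mxE dotZl dotZr !mxE.
have [-> |n0] := eqVneq n 0; first by rewrite !mxE !mulr0.
have d0 : dot n n != 0 by rewrite dot_eq0.
by congr (_ - _); field; rewrite d0 a0.
Qed.

Lemma refl_mx_mul n x : refl_mx n *m x = x - (2 / dot n n * dot n x) *: n.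
Proof.
rewrite mulmxBl mul1mx -scalemxAl -mulmxA; congr (_ - _).
apply/matrixP => i j; rewrite !mxE !big_ord1 -!mulrA; congr (_ * _); congr (_ * _).
by rewrite !ord1 mulrC dot_mx.
Qed.

Lemma refl_mxT n : (refl_mx n)^T = refl_mx n.
Proof. by apply/matrixP => i j; rewrite mxE !refl_mxE eq_sym [n j 0 * _]mulrC. Qed.

Lemma refl_mxK n : n != 0 -> refl_mx n *m refl_mx n = 1%:M.
Proof.
rewrite -dot_eq0 => n0; rewrite [X in _ *m X]/refl_mx mulmxBr mulmx1 -scalemxAr mulmxA refl_mx_mul.
rewrite divfK // -[2]/(1 + 1) scalerDl scale1r opprD addrA subrr sub0r mulNmx scalerN opprK.
by rewrite /refl_mx -[2]/(1 + 1) subrK.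
Qed.

Lemma refl_mx_orth n : n != 0 -> orth (refl_mx n).
Proof. by move=> n0; rewrite /orth refl_mxT refl_mxK. Qed.

Lemma refl_mx_det n : n != 0 -> \det (refl_mx n) = - 1.
Proof.
rewrite -dot_eq0 dotE => n0; rewrite det3 !refl_mxE dotE /=.
by field.
Qed.

(** A normal can be replaced by its negative, so the two may be taken at an angle of at most pi / 2.
    The segment between them then avoids 0, and reflections do not depend on the length of the
    normal. *)
Lemma refl_mx_path n n' : n != 0 -> n' != 0 -> orth_path (refl_mx n) (refl_mx n').
Proof.
wlog nn : n' / 0 <= dot n n'.
  move=> H n0 n0'; have [nn|nn] := leP 0 (dot n n'); first exact: H.
  by rewrite -(@refl_mxZ (-1) n') ?oppr_eq0 ?oner_eq0 // scaleN1r; apply: H;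
    rewrite ?oppr_eq0 // dotNr oppr_ge0 ltW.
move=> n0 n0'.
pose v (t : I) := (1 - val t) *: n + val t *: n'.
have v0 t : 0 < dot (v t) (v t).
  have := valP t; rewrite inE => /andP[t0 t1].
  rewrite /v !dotE_lin (dotC n').
  rewrite -!dot_gt0 in n0 n0'.
  have [t0'|t0'] := eqVneq (val t) 0; first by rewrite t0'; nra.
  have tp : 0 < val t by rewrite lt_def t0' t0.
  have h1 : 0 <= (1 - val t) * ((1 - val t) * dot n n).
    by rewrite !mulr_ge0 ?subr_ge0 // ltW.
  have h2 : 0 <= (1 - val t) * (val t * dot n n').
    by rewrite !mulr_ge0 ?subr_ge0 // ltW.
  have h3 : 0 < val t * (val t * dot n' n') by rewrite !mulr_gt0.
  have h4 : val t * ((1 - val t) * dot n n') = (1 - val t) * (val t * dot n n') by ring.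
  by rewrite h4; lra.
have cv k : continuous (fun t => v t k 0).
  have -> : (fun t => v t k 0) = (fun t => (1 - val t) * n k 0 + val t * n' k 0).
    by apply/funext => t; rewrite !mxE.
  apply: ctsD; apply: ctsM; try exact: cst_continuous.
    by apply: ctsB; [exact: cst_continuous | exact: initial_continuous].
  exact: initial_continuous.
exists (fun t => refl_mx (v t)); split.
- move=> i j; rewrite (eq_fun (fun t => refl_mxE (v t) i j)).
  apply: ctsB; first exact: cst_continuous.
  apply: ctsM; last by apply: ctsM; exact: cv.
  apply: ctsM; first exact: cst_continuous.
  apply: ctsV; first by move=> t; rewrite gt_eqF.
  rewrite (eq_fun (fun t => dotE (v t) (v t))).
  by do ?apply: ctsD; apply: ctsM; exact: cv.
- by move=> t; apply: refl_mx_orth; rewrite -dot_gt0.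
- by rewrite /v /= subr0 scale1r scale0r addr0.
- by rewrite /v /= subrr scale1r scale0r add0r.
Qed.

Definition axis (i : 'I_3) : 'cV[R]_3 := delta_mx i 0.

Lemma mulmx_axis A i : A *m axis i = col i A.
Proof. by rewrite /axis colE. Qed.

Lemma axis_neq0 i : axis i != 0.
Proof.
by apply/eqP => /matrixP/(_ i 0); rewrite !mxE !eqxx /= => /eqP; rewrite oner_eq0.
Qed.

Lemma axis_dot i j : dot (axis i) (axis j) = (i == j)%:R.
Proof. by elim/ord3P: i; elim/ord3P: j; rewrite dotE !mxE /=; ring. Qed.

(** The reflection in the y-coordinate reverses the longitude of the spherical cube and fixes the
    basepoint, which lies on the x-axis. *)
Definition orth_std (b : bool) : 'M[R]_3 := if b then refl_mx (axis 1) else 1%:M.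

Definition orth_deform A := exists b : bool, \det A = (-1) ^+ b /\ orth_path A (orth_std b).

Lemma orth_deform1 : orth_deform 1%:M.
Proof. by exists false; split; [exact: det1 | exact: orth_path_refl (orth1 _)]. Qed.

Lemma orth_deform_refl n : n != 0 -> orth_deform (refl_mx n).
Proof.
by move=> n0; exists true; split; [exact: refl_mx_det | apply: refl_mx_path; rewrite ?axis_neq0].
Qed.

Lemma orth_deformM A B : orth_deform A -> orth_deform B -> orth_deform (A *m B).
Proof.
move=> [b [db pb]] [d [dd pd]]; exists (b (+) d); split.
  by rewrite det_mulmx db dd signr_addb.
have -> : orth_std (b (+) d) = orth_std b *m orth_std d.
  by case: b d {db pb dd pd} => [] []; rewrite /orth_std /= ?mulmx1 ?mul1mx ?refl_mxK ?axis_neq0.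
exact: orth_pathM.
Qed.

(** The last clause is what keeps axes that are already straightened in place. *)
Lemma orth_swap_refl x y : dot x x = dot y y -> exists H,
  [/\ H *m x = y, orth_deform H, H *m H = 1%:M & forall z, dot z x = dot z y -> H *m z = z].
Proof.
move=> xy; have [->|nxy] := eqVneq x y.
  by exists 1%:M; split; rewrite ?mul1mx //; [exact: orth_deform1 | move=> z _; rewrite mul1mx].
have n0 : x - y != 0 by rewrite subr_eq0.
exists (refl_mx (x - y)); split.
- rewrite refl_mx_mul.
  have -> : dot (x - y) (x - y) = 2 * dot (x - y) x by rewrite !dotE_lin (dotC x y) -xy; ring.
  have d0 : dot (x - y) x != 0.
    apply: contraNneq n0 => d0; rewrite -dot_eq0.
    have -> : dot (x - y) (x - y) = 2 * dot (x - y) x by rewrite !dotE_lin (dotC x y) -xy; ring.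
    by rewrite d0 mulr0.
  set d := dot _ x in d0 *; have -> : 2 / (2 * d) * d = 1 by field.
  by rewrite scale1r opprB addrC subrK.
- exact: orth_deform_refl.
- exact: refl_mxK.
- move=> z zxy; rewrite refl_mx_mul (_ : dot (x - y) z = 0) ?mulr0 ?scale0r ?subr0 //.
  by rewrite dotC !dotE_lin zxy subrr.
Qed.

(* Cartan-Dieudonne: reflections straighten the images of the axes one after the
   other, so A is a product of reflections. *)
Lemma orth_deformP A : orth A -> orth_deform A.
Proof.
move=> oA.
have step B x : orth B -> dot x x = 1 -> exists H, [/\ H *m (B *m x) = x, orth_deform H,
    H *m H = 1%:M & forall z, B *m z = z -> dot z x = 0 -> H *m z = z].
  move=> oB x1; have [|H [H1 H2 H3 H4]] := @orth_swap_refl (B *m x) x.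
    by rewrite orth_dot.
  by exists H; split => // z Bz zx; apply: H4; rewrite -{1}Bz orth_dot.
have invol H : orth_deform H -> H *m H = 1%:M -> orth H.
  by move=> [b [_ [c [_ oc <- _]]]] _; exact: oc.
have [H0 [e0 D0 K0 _]] := step A (axis 0) oA ltac:(by rewrite axis_dot).
have o0 := invol _ D0 K0.
rewrite mulmxA in e0; have oA0 := orthM o0 oA.
have [H1 [e1 D1 K1 F1]] := step _ (axis 1) oA0 ltac:(by rewrite axis_dot).
have o1 := invol _ D1 K1.
have oA1 := orthM o1 oA0; rewrite mulmxA in e1.
have e01 : H1 *m (H0 *m A) *m axis 0 = axis 0.
  by rewrite -mulmxA e0; apply: F1; rewrite ?axis_dot.
have [H2 [e2 D2 K2 F2]] := step _ (axis 2) oA1 ltac:(by rewrite axis_dot).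
rewrite mulmxA in e2.
have E : H2 *m (H1 *m (H0 *m A)) = 1%:M.
  apply/matrixP => i j.
  have C B : B i j = (B *m axis j) i 0 by rewrite mulmx_axis mxE.
  rewrite C [RHS]C mul1mx; set B := _ *m _; suff -> : B = axis j by [].
  rewrite {}/B; move: (j) => k; elim/ord3P: k.
  - by rewrite -mulmxA e01; apply: F2; rewrite ?axis_dot.
  - by rewrite -mulmxA e1; apply: F2; rewrite ?axis_dot.
  - exact: e2.
have -> : A = H0 *m (H1 *m H2).
  rewrite -[LHS]mul1mx -K0 -(mulmxA H0) -[X in H0 *m X]mul1mx -K1 -(mulmxA H1).
  by rewrite -[X in H1 *m X]mul1mx -K2 -(mulmxA H2) E mulmx1.
by apply: orth_deformM => //; exact: orth_deformM.
Qed.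

End OrthogonalPaths.

(** * Homology classes of orthogonally moved factors *)

Section OrthFactor.
Local Open Scope classical_set_scope.
Local Open Scope ring_scope.
Variable R : realType.
Local Notation I := (set_type (@unit_interval R)).
Local Notation S2 := (set_type (@sphere R)).
Implicit Types (A B : 'M[R]_3) (x y : S2).

Lemma in_sphere (v : 'cV[R]_3) : (v \in @sphere R) <-> dot v v = 1.
Proof.
by rewrite inE /sphere /= /dot; under eq_bigr do rewrite expr2.
Qed.

Lemma dot_sphere x : dot (val x) (val x) = 1.
Proof. by apply/in_sphere; exact: valP. Qed.

Lemma orth_act_subproof A (oA : orth A) x : A *m val x \in @sphere R.
Proof. by apply/in_sphere; rewrite orth_dot // dot_sphere. Qed.

Definition orth_act A (oA : orth A) x : S2 := SigSub (orth_act_subproof oA x).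

Lemma orth_act_continuous (T : topologicalType) (A : T -> 'M[R]_3) (oA : forall t, orth (A t))
    (u : T -> S2) : (forall i j, continuous (fun t => A t i j)) -> continuous u ->
  continuous (fun t => orth_act (oA t) (u t)).
Proof.
move=> cA cu.
apply: (@continuous_comp_initial _ _ _ (@set_val _ (@sphere R)) (fun t => orth_act (oA t) (u t))).
have -> : @set_val _ (@sphere R) \o (fun t => orth_act (oA t) (u t)) = (fun t => A t *m val (u t)).
  by apply/funext.
apply: mx_continuous => i j.
have -> : (fun t => (A t *m val (u t)) i j) =
    (fun t => A t i 0 * val (u t) 0 0 + A t i 1 * val (u t) 1 0 + A t i 2 * val (u t) 2 0).
  by apply/funext => t; rewrite mxE sum3 !ord1.
have cv k : continuous (fun t => val (u t) k 0).
  move=> t; apply: (@continuous_comp _ _ _ u (fun x : S2 => val x k 0)); first exact: cu.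
  apply: (@continuous_comp _ _ _ (@set_val _ (@sphere R)) (fun v : 'cV[R]_3 => v k 0)).
    exact: initial_continuous.
  exact: coord_continuous.
by do ?apply: ctsD; apply: ctsM.
Qed.

Lemma orth_act_reverse (oA : orth (orth_std R true)) (t : cube R 2) :
  orth_act oA (spherical t) = spherical (reverse t).
Proof.
apply: val_inj; rewrite /= /spherical_vec.
have -> : val (reverse t 1) = 1 - val (t 1).
  rewrite /reverse /= clampr_id //; have := valP (t 1); rewrite inE => /andP[t0 t1].
  by rewrite subr_ge0 t1 gerBl.
rewrite mulrBr mulr1 addrC cosD2pi sinD2pi cosN sinN refl_mx_mul axis_dot divr1.
by apply: cV3P; rewrite !mxE dotE !mxE /=; ring.
Qed.

Definition pair_swap (i : 'I_2) (x y : S2) : S2xS2 R := if i == 0 then (x, y) else (y, x).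

Lemma pair_swap_continuous (T : topologicalType) (i : 'I_2) (u v : T -> S2) :
  continuous u -> continuous v -> continuous (fun t => pair_swap i (u t) (v t)).
Proof.
move=> cu cv t; rewrite /pair_swap; case: (i == 0).
  apply: (@cvg_pair _ _ _ (nbhs t) (nbhs (u t)) (nbhs (v t)));
    by [exact: (nbhs_filter t) | exact: cu | exact: cv].
apply: (@cvg_pair _ _ _ (nbhs t) (nbhs (v t)) (nbhs (u t)));
  by [exact: (nbhs_filter t) | exact: cv | exact: cu].
Qed.

(** A and B are deformed simultaneously to their standard forms. Either standard form of B fixes the
    basepoint, and that of A is the identity or the reversal of the longitude. *)
Lemma orth_factor_homology (i : 'I_2) A B (oA : orth A) (oB : orth B) (b : bool)
    (f : @singular_cube R 2 (S2xS2 R)) : \det A = (-1) ^+ b ->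
  (forall t, f t = pair_swap i (orth_act oA (spherical t)) (orth_act oB (basepoint R))) ->
  homologous << f >> ((-1) ^+ b *: factor_class R i).
Proof.
move=> dA fE.
have [b' [dA' [c [cc oc c0 c1]]]] := orth_deformP oA.
have bb : b' = b.
  by move: dA'; rewrite dA => /eqP; rewrite (inj_eq (@signr_inj R)) => /eqP.
rewrite {b' dA'}bb in c1.
have [b' [_ [d [cd od d0 d1]]]] := orth_deformP oB.
pose F (z : I * S2) := pair_swap i (orth_act (oc z.1) z.2) (orth_act (od z.1) (basepoint R)).
have cfst (T U : topologicalType) : continuous (@fst T U) by move=> z; exact: cvg_fst.
have csnd (T U : topologicalType) : continuous (@snd T U) by move=> z; exact: cvg_snd.
have cF : continuous F.
  apply: pair_swap_continuous.
    apply: (@orth_act_continuous _ (fun z : I * S2 => c z.1)); last exact: csnd.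
    move=> k l z; by apply: (@continuous_comp _ _ _ fst (fun t => c t k l)); [exact: cfst |
      exact: cc].
  apply: (@orth_act_continuous _ (fun z : I * S2 => d z.1)); last exact: cst_continuous.
  move=> k l z; by apply: (@continuous_comp _ _ _ fst (fun t => d t k l)); [exact: cfst |
    exact: cd].
pose s1 : @singular_cube R 2 (S2xS2 R) := mkcts (@factor_incl_continuous R i) \o @spherical R.
have o1 : orth (orth_std R b) by rewrite -c1.
have cs : continuous (fun t => factor_incl i (orth_act o1 (spherical t))).
  move=> t; apply: (@continuous_comp _ _ _ (fun t => orth_act o1 (spherical t)) (factor_incl i)).
    apply: orth_act_continuous; last exact: spherical_continuous.
    by move=> k l; exact: cst_continuous.
  exact: factor_incl_continuous.
pose s2 : @singular_cube R 2 (S2xS2 R) := mkcts cs.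
have H : homologous (<< f >> : chain 2 _) << s2 >>.
  apply: (homotopy_homologous cF) => t.
    by rewrite fE /F /=; congr (pair_swap i _ _); apply: val_inj; rewrite /= ?c0 ?d0.
  have E1 : orth_act (oc (endpoint R true)) (spherical t) = orth_act o1 (spherical t).
    by apply: val_inj; rewrite /= c1.
  have E2 : orth_act (od (endpoint R true)) (basepoint R) = basepoint R.
    apply: val_inj; rewrite /= d1 /orth_std; case: (b'); last exact: mul1mx.
    rewrite refl_mx_mul; have -> : delta_mx 0 0 = axis R 0 by [].
    by rewrite !axis_dot /= mulr0 scale0r subr0.
  by rewrite /F E1 E2.
apply: homologous_trans H _.
have -> : factor_class R i = << s1 >>.
  rewrite /factor_class /sphere_class /pushforward liftU scale1r.
  by congr << _ >>; apply/continuousEP.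
case: b {dA} c1 o1 cs @s2 => c1 o1 cs /=.
  rewrite expr1 scaleN1r; apply: (@reverse_homologous _ _ (factor_incl i)) => //.
    exact: factor_incl_continuous.
  by move=> t; congr (factor_incl i); exact: orth_act_reverse.
rewrite expr0 scale1r; set s2 := << _ >>.
suff -> : s2 = << s1 >> by exact: homologous_refl.
congr << _ >>; apply/continuousEP => t; congr (factor_incl i).
by apply: val_inj; exact: mul1mx.
Qed.

End OrthFactor.

(** * Linear maps of S^2 x S^2 *)

Section LinearActions.
Local Open Scope classical_set_scope.
Local Open Scope ring_scope.
Variable R : realType.
Local Notation S2 := (set_type (@sphere R)).
Implicit Types (A B C D : 'M[R]_3) (x y : S2) (s : bool).

Definition lin_act s A D (oA : orth A) (oD : orth D) (p : S2xS2 R) : S2xS2 R :=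
  if s then (orth_act oA p.2, orth_act oD p.1) else (orth_act oA p.1, orth_act oD p.2).

Definition lin_mx s A D : 'M[R]_(3 + 3) :=
  if s then block_mx 0 A D 0 else block_mx A 0 0 D.

Lemma lin_actE s A D (oA : orth A) (oD : orth D) p :
  in_R6 (lin_act s oA oD p) = lin_mx s A D *m in_R6 p.
Proof.
by rewrite /in_R6 /lin_act /lin_mx; case: s; rewrite mul_block_col !mul0mx ?addr0 ?add0r.
Qed.

Lemma lin_mx_orth s A D : orth A -> orth D -> (lin_mx s A D)^T *m lin_mx s A D = 1%:M.
Proof.
move=> oA oD; rewrite /lin_mx; case: s; rewrite tr_block_mx mulmx_block !trmx0 !mul0mx !mulmx0
  ?addr0 ?add0r oA oD -scalar_mx_block //.
Qed.

Lemma lin_act_continuous s A D (oA : orth A) (oD : orth D) :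
  continuous (@lin_act s A D oA oD).
Proof.
have cfst : continuous (@fst S2 S2) by move=> z; exact: cvg_fst.
have csnd : continuous (@snd S2 S2) by move=> z; exact: cvg_snd.
have cA (B : 'M[R]_3) (oB : orth B) (u : S2xS2 R -> S2) :
    continuous u -> continuous (fun p => orth_act oB (u p)).
  move=> cu; apply: (@orth_act_continuous R _ (fun=> B) (fun=> oB)) => // i j;
    exact: cst_continuous.
move=> p; rewrite /lin_act; case: s.
  exact: (@pair_swap_continuous R _ 0 _ _ (cA _ oA _ csnd) (cA _ oD _ cfst)).
exact: (@pair_swap_continuous R _ 0 _ _ (cA _ oA _ cfst) (cA _ oD _ csnd)).
Qed.

Definition swap2 : 'M[R]_(1 + 1) := block_mx 0 1%:M 1%:M 0.

Lemma det_antidiag n : \det (block_mx 0 1%:M 1%:M 0 : 'M[R]_(n + n)) = (- 1) ^+ n.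
Proof.
have -> : block_mx 0 1%:M 1%:M 0 = block_mx 1%:M 1%:M 0 1%:M *m block_mx 1%:M 0 (- 1%:M) 1%:M
   *m block_mx 1%:M 1%:M 0 1%:M *m block_mx (- 1%:M) 0 0 1%:M :> 'M[R]_(n + n).
  rewrite !mulmx_block !mul0mx !mulmx0 !mulmx1 !mul1mx !addr0 !add0r !subrr.
  by rewrite mul0mx add0r mulNmx mulmxN mul1mx opprK addNr.
rewrite !det_mulmx !det_ublock !det_lblock !det1 !mul1r mulr1.
by rewrite -scaleN1r detZ det1 mulr1.
Qed.

Lemma det_lin_mx s A D : \det (lin_mx s A D) = (-1) ^+ s * (\det A * \det D).
Proof.
case: s; rewrite /lin_mx; last by rewrite det_ublock expr0 mul1r.
have -> : block_mx 0 A D 0 = block_mx 0 1%:M 1%:M 0 *m block_mx D 0 0 A.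
  by rewrite mulmx_block !mul0mx !mulmx0 !mul1mx !addr0 !add0r.
by rewrite det_mulmx det_antidiag det_ublock -signr_odd /= (mulrC (\det D)).
Qed.

Lemma lin_normal_frame s A D (oA : orth A) (oD : orth D) p :
  lin_mx s A D *m normal_frame p = normal_frame (lin_act s oA oD p) *m (if s then swap2 else 1%:M).
Proof.
rewrite /lin_mx /normal_frame /lin_act /swap2; case: s; last first.
  by rewrite mulmx1 mulmx_block !mul0mx !mulmx0 !addr0 !add0r.
by rewrite !mulmx_block !mul0mx !mulmx0 !mulmx1 !addr0 !add0r.
Qed.

(** A swap contributes the sign -1 both to the determinant on R^6 and to the normal frame, and these
    cancel. *)
Lemma det_lin_frame s A D (oA : orth A) (oD : orth D) p (T : 'M[R]_(3 + 3, 4)) :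
  \det (row_mx (normal_frame (lin_act s oA oD p)) (lin_mx s A D *m T) : 'M[R]_6) =
  \det A * \det D * \det (row_mx (normal_frame p) T : 'M[R]_6).
Proof.
set N := normal_frame _; set M := lin_mx s A D.
pose P : 'M[R]_(1 + 1) := if s then swap2 else 1%:M.
have dP : \det P = (-1) ^+ s.
  by rewrite /P /swap2; case: (s); rewrite ?det1 ?det_antidiag.
have E : (M *m row_mx (normal_frame p) T : 'M[R]_6) =
    (row_mx N (M *m T) : 'M[R]_6) *m (block_mx P 0 0 1%:M : 'M[R]_((1 + 1) + 4)).
  rewrite mul_mx_row lin_normal_frame -/N -/P (mul_row_block N) !mulmx0 mulmx1.
  by rewrite addr0 add0r.
have dB : \det (block_mx P 0 0 1%:M : 'M[R]_((1 + 1) + 4)) = (-1) ^+ s.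
  by rewrite det_ublock det1 mulr1.
have E1 : \det (M *m row_mx (normal_frame p) T : 'M[R]_6) =
    \det M * \det (row_mx (normal_frame p) T : 'M[R]_6).
  exact: det_mulmx.
have E2 : \det (M *m row_mx (normal_frame p) T : 'M[R]_6) =
    \det (row_mx N (M *m T) : 'M[R]_6) * (-1) ^+ s.
  by rewrite -dB E; exact: det_mulmx.
have := E1; rewrite E2 det_lin_mx => E'.
by apply: (mulIf (_ : (-1) ^+ s != 0 :> R)); rewrite ?signr_eq0 // E'; ring.
Qed.

Lemma lin_act_positive s A D (oA : orth A) (oD : orth D) p T :
  0 < \det A * \det D -> positive_frame p T ->
  positive_frame (lin_act s oA oD p) (lin_mx s A D *m T).
Proof.
move=> AD [pT dT]; split; last by rewrite det_lin_frame mulr_gt0.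
rewrite /tangent; set N := normal_frame _.
have E : N = lin_mx s A D *m normal_frame p *m (if s then swap2 else 1%:M).
  rewrite lin_normal_frame -/N -mulmxA; case: (s); rewrite ?mulmx1 // /swap2.
  by rewrite mulmx_block !mul0mx !mulmx0 !mulmx1 !addr0 !add0r -scalar_mx_block mulmx1.
by rewrite E !trmx_mul -!mulmxA (mulmxA (lin_mx _ _ _)^T) lin_mx_orth // mul1mx [X in _ *m X]pT
  mulmx0.
Qed.

(** It makes the orientation clause of [is_linear] testable: one positive frame decides the sign of
    det A * det D. *)
Lemma positive_frame_exists : exists T, positive_frame (basepoint R, basepoint R) T.
Proof.
pose E : 'M[R]_(3, 2) := \matrix_(i, j) (i == j.+1 :> nat)%:R.
pose x : 'M[R]_(3, 1) := delta_mx 0 0.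
have xx : x^T *m x = 1%:M.
  by apply/matrixP => i j; rewrite !ord1 !mxE sum3 !mxE /= !(mul0r, mulr0, mulr1, addr0).
have xE : x^T *m E = 0.
  by apply/matrixP => i j; rewrite !ord1 !mxE sum3 !mxE /= !(mul0r, mulr0, mulr1, addr0).
have EE : E^T *m E = 1%:M.
  apply/matrixP => i j; rewrite !mxE sum3 !mxE.
  by case: i j => [[|[|//]] Hi] [[|[|//]] Hj]; rewrite /= !(mul0r, mulr0, mulr1, addr0, add0r).
pose T : 'M[R]_(3 + 3, 2 + 2) := block_mx E 0 0 E.
set p := (basepoint R, basepoint R).
have NT : (normal_frame p)^T *m T = 0.
  rewrite /normal_frame /T tr_block_mx mulmx_block !trmx0 !mul0mx !mulmx0 !addr0 !add0r.
  rewrite [X in block_mx X]xE [X in block_mx _ _ _ X]xE.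
  by rewrite -[RHS](block_mx0).
pose U : 'M[R]_6 := row_mx (normal_frame p) T.
have dU : \det U != 0.
  have UU : U^T *m U = 1%:M.
    have N1 : (normal_frame p)^T *m normal_frame p = 1%:M.
      rewrite /normal_frame tr_block_mx mulmx_block !trmx0 !mul0mx !mulmx0 !addr0 !add0r.
      by rewrite [X in block_mx X]xx [X in block_mx _ _ _ X]xx -scalar_mx_block.
    have T1 : T^T *m T = 1%:M.
      rewrite /T tr_block_mx mulmx_block !trmx0 !mul0mx !mulmx0 !addr0 !add0r.
      by rewrite EE -scalar_mx_block.
    have TN : T^T *m normal_frame p = 0 by apply: trmx_inj; rewrite trmx_mul trmxK NT trmx0.
    have H : (row_mx (normal_frame p) T)^T *m row_mx (normal_frame p) T = 1%:M.
      by rewrite tr_row_mx mul_col_row N1 T1 TN NT -scalar_mx_block.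
    exact: H.
  by apply/eqP => d0; have := congr1 determinant UU; rewrite det_mulmx d0 mulr0 det1 => /eqP;
    rewrite eq_sym oner_eq0.
have [d0|d0] := ltrP 0 (\det U); first by exists T.
pose F : 'M[R]_(1 + 3) := block_mx (- 1%:M) 0 0 1%:M.
(* F negates one tangent vector and so corrects the orientation. *)
exists (T *m F); split; first by rewrite /tangent mulmxA NT mul0mx.
have E' : (row_mx (normal_frame p) (T *m F) : 'M[R]_6) =
    U *m (block_mx 1%:M 0 0 F : 'M[R]_((1 + 1) + 4)).
  by rewrite /U (mul_row_block (normal_frame p)) !mulmx0 mulmx1 addr0 add0r.
have dF : \det (block_mx 1%:M 0 0 F : 'M[R]_((1 + 1) + 4)) = -1.
  have dF0 : \det F = -1.
    by rewrite /F det_ublock det1 mulr1 -scaleN1r detZ det1 mulr1.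
  transitivity (\det (1%:M : 'M[R]_(1 + 1)) * \det F); first exact: det_ublock.
  by rewrite dF0 det1 mul1r.
have E2 : \det (row_mx (normal_frame p) (T *m F) : 'M[R]_6) = \det U * -1.
  by rewrite -dF E'; exact: det_mulmx.
by rewrite E2 mulrN1 oppr_gt0 lt_def eq_sym dU.
Qed.

(** Replacing y by its antipode removes the mixed term, so the images of A and B are orthogonal and
    A scales all unit vectors by the same factor, which is zero or not. *)
Lemma bilinear_sphere A B :
  (forall x y, dot (A *m val x + B *m val y) (A *m val x + B *m val y) = 1) ->
  [/\ A^T *m B = 0 & A = 0 \/ A \in unitmx].
Proof.
move=> H.
have S2oppP (y : S2) : - val y \in @sphere R.
  by apply/in_sphere; rewrite dotNl dotNr opprK dot_sphere.
have H0 x y : dot (A *m val x) (B *m val y) = 0 /\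
    dot (A *m val x) (A *m val x) + dot (B *m val y) (B *m val y) = 1.
  have h1 := H x y; have h2 := H x (SigSub (S2oppP y)).
  move: h2; rewrite /= mulmxN; move: h1.
  by rewrite !dotE_lin (dotC (B *m val y)) => h1 h2; split; lra.
have unitP (v : 'cV[R]_3) : v != 0 -> exists x, exists2 c, c != 0 & v = c *: val x.
  move=> v0; have u1 : unitize v \in @sphere R by apply/in_sphere; exact: dot_unitize.
  exists (SigSub u1), (Num.sqrt (dot v v)); first by rewrite sqrtr_eq0 -ltNge dot_gt0.
  by rewrite /= /unitize scalerA divff ?scale1r // sqrtr_eq0 -ltNge dot_gt0.
split.
  have G (v w : 'cV[R]_3) : dot (A *m v) (B *m w) = 0.
    have [->|v0] := eqVneq v 0; first by rewrite mulmx0 -(scale0r 0) dotZl mul0r.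
    have [->|w0] := eqVneq w 0; first by rewrite mulmx0 -(scale0r 0) dotZr mul0r.
    have [x [a _ ->]] := unitP v v0; have [y [b _ ->]] := unitP w w0.
    by rewrite -!scalemxAr dotZl dotZr (H0 x y).1 !mulr0.
  apply/matrixP => i j; have := G (axis R i) (axis R j).
  rewrite !mulmx_axis mxE /dot => E; rewrite mxE -[RHS]E.
  by apply: eq_bigr => k _; rewrite !mxE.
pose e := basepoint R; pose al := dot (A *m val e) (A *m val e).
have alE x : dot (A *m val x) (A *m val x) = al.
  by have := (H0 x e).2; have := (H0 e e).2; rewrite /al => h1 h2; lra.
have [al0|al0] := eqVneq al 0; [left|right].
  apply/matrixP => i j.
  have ax1 : axis R j \in @sphere R by apply/in_sphere; rewrite axis_dot eqxx.
  have := alE (SigSub ax1); rewrite al0 /= => /eqP;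
    rewrite dot_eq0 mulmx_axis => /eqP/matrixP/(_ i 0).
  by rewrite !mxE.
rewrite unitmxE unitfE -det_tr; apply/negP => /det0P[v v0 vA].
have v0' : v^T != 0 by apply: contraNneq v0 => h; rewrite -(trmxK v) h trmx0.
have [x [c c0 vE]] := unitP _ v0'.
have := congr1 trmx vA; rewrite trmx_mul trmxK trmx0 vE -scalemxAr => /eqP.
rewrite scaler_eq0 (negbTE c0) /= -dot_eq0 alE; exact/negP.
Qed.

(** If the upper left block vanishes, the map swaps the factors; if it is invertible, the upper
    right block vanishes. Orthogonality of M settles the lower blocks. *)
Lemma lin_blocks (M : 'M[R]_(3 + 3)) (f : S2xS2 R -> S2xS2 R) : M^T *m M = 1%:M ->
  (forall p, in_R6 (f p) = M *m in_R6 p) ->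
  exists s A D (oA : orth A) (oD : orth D),
    M = lin_mx s A D /\ forall p, f p = lin_act s oA oD p.
Proof.
move=> MM fM; rewrite -(submxK M).
set A := ulsubmx M; set B := ursubmx M; set C := dlsubmx M; set D := drsubmx M.
have [e1 e2 e3 e4] : [/\ A^T *m A + C^T *m C = 1%:M, A^T *m B + C^T *m D = 0,
    B^T *m A + D^T *m C = 0 & B^T *m B + D^T *m D = 1%:M].
  move: MM; rewrite -(submxK M) -/A -/B -/C -/D tr_block_mx mulmx_block.
  by rewrite scalar_mx_block => /eq_block_mx.
have fE x y : val (f (x, y)).1 = A *m val x + B *m val y /\
    val (f (x, y)).2 = C *m val x + D *m val y.
  by have := fM (x, y); rewrite -(submxK M) /in_R6 mul_block_col => /eq_col_mx.
have [AB [A0|uA]] : [/\ A^T *m B = 0 & A = 0 \/ A \in unitmx].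
  by apply: bilinear_sphere => x y; rewrite -(fE x y).1 dot_sphere.
- have oC : orth C by rewrite /orth -e1 A0 trmx0 mul0mx add0r.
  have D0 : D = 0.
    rewrite -[D]mul1mx -(orth_trmx oC) -mulmxA.
    by move: e2; rewrite AB add0r => ->; rewrite mulmx0.
  have oB : orth B by rewrite /orth -e4 D0 trmx0 mul0mx addr0.
  exists true, B, C, oB, oC; rewrite /lin_mx A0 D0; split => // -[x y].
  have [f1 f2] := fE x y; rewrite A0 D0 !mul0mx ?addr0 ?add0r in f1 f2.
  by rewrite [f _]surjective_pairing; congr pair; exact: val_inj.
- have B0 : B = 0.
    have uAT : A^T \in unitmx by rewrite unitmx_tr.
    by rewrite -[B](mulKmx uAT) AB mulmx0.
  have oD : orth D by rewrite /orth -e4 B0 trmx0 mul0mx add0r.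
  have C0 : C = 0.
    rewrite -[C]mul1mx -(orth_trmx oD) -mulmxA.
    by move: e3; rewrite B0 trmx0 mul0mx add0r => ->; rewrite mulmx0.
  have oA : orth A by rewrite /orth -e1 C0 trmx0 mul0mx addr0.
  exists false, A, D, oA, oD; rewrite /lin_mx B0 C0; split => // -[x y].
  have [f1 f2] := fE x y; rewrite B0 C0 !mul0mx ?addr0 ?add0r in f1 f2.
  by rewrite [f _]surjective_pairing; congr pair; exact: val_inj.
Qed.

Lemma is_linearP (G : finGroupType) (act : G -> continuousType (S2xS2 R) (S2xS2 R)) :
  is_linear act <-> forall g, exists s A D (oA : orth A) (oD : orth D),
    \det A = \det D /\ forall p, act g p = lin_act s oA oD p.
Proof.
split=> H g.
  have [M [MM fM pM]] := H g.
  have [s [A [D [oA [oD [ME fE]]]]]] := lin_blocks MM fM.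
  exists s, A, D, oA, oD; split => //.
  have [T pT] := positive_frame_exists; have := pM _ _ pT.
  rewrite fE ME => -[_]; rewrite det_lin_frame; case: pT => _ pT.
  rewrite pmulr_lgt0 //; case: (orth_det oA) => ->; case: (orth_det oD) => -> //;
  by rewrite ?(mulr1, mul1r) ltr0N1.
have [s [A [D [oA [oD [AD fE]]]]]] := H g.
exists (lin_mx s A D); split; first exact: lin_mx_orth.
  by move=> p; rewrite fE lin_actE.
move=> p T; rewrite fE; apply: lin_act_positive.
by rewrite AD -expr2 exprn_even_gt0 //=; case: (orth_det oD) => ->; rewrite ?oppr_eq0 oner_eq0.
Qed.

Definition hom_mx (s b : bool) : 'M[int]_2 := (-1) ^+ b *: (if s then mat_b else 1%:M).

(** The homology matrix is computed on both factor classes; its uniqueness is their independence. *)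
Lemma hom_mxP s (b : bool) (A D : 'M[R]_3) (oA : orth A) (oD : orth D)
    (f : continuousType (S2xS2 R) (S2xS2 R))
    (M : 'M[int]_2) : \det A = (-1) ^+ b -> \det D = (-1) ^+ b ->
  (forall p, f p = lin_act s oA oD p) ->
  (forall j, homologous (pushforward f (factor_class R j)) (\sum_i M i j *: factor_class R i))
  <-> M = hom_mx s b.
Proof.
move=> dA dD fE.
have H j : homologous (pushforward f (factor_class R j))
    (\sum_i hom_mx s b i j *: factor_class R i).
  have -> : \sum_i hom_mx s b i j *: factor_class R i =
      (-1) ^+ b *: factor_class R (if s then (1 - j)%R else j).
    rewrite !big_ord_recl big_ord0 addr0 /hom_mx !mxE.
    by case: j => [[|[|//]] Hj]; case: s {fE};
      rewrite !mxE /= !(mulr0, scale0r, mulr1, addr0, add0r);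
      congr (_ *: factor_class R _); exact: val_inj.
  rewrite /factor_class /sphere_class /pushforward !liftU !scale1r !liftU !scale1r.
  set t := << _ >>.
  have -> : << (factor_incl (R:=R) (if s then 1 - j else j) \o spherical (R:=R) :
      singular_cube 2 _) >> =
    factor_class R (if s then (1 - j)%R else j).
    by rewrite /factor_class /sphere_class /pushforward !liftU !scale1r.
  rewrite {}/t.
  have fact i C D' (oC : orth C) (oD' : orth D') : \det C = (-1) ^+ b ->
      (forall t, f (factor_incl j (spherical t)) =
        pair_swap i (orth_act oC (spherical t)) (orth_act oD' (basepoint R))) ->
      homologous << f \o (factor_incl j \o spherical (R:=R)) : singular_cube 2 _ >>
        ((-1) ^+ b *: factor_class R i).
    by move=> dC E; apply: (@orth_factor_homology R i C D' oC oD').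
  have [j0|j1] : j = 0 \/ j = 1.
    by case: (j) => [[|[|//]] Hj]; [left | right]; exact: val_inj.
  - rewrite j0 in fact *; case: s fE => fE.
      by apply: (fact _ D A oD oA) => // t; rewrite fE.
    by apply: (fact _ A D oA oD) => // t; rewrite fE.
  - rewrite j1 in fact *; case: s fE => fE.
      by apply: (fact _ A D oA oD) => // t; rewrite fE.
    by apply: (fact _ D A oD oA) => // t; rewrite fE.
split=> [HM|-> //].
apply/matrixP => i j; apply: (@factor_class_indep R (M^~ j) (hom_mx s b ^~ j)).
exact: homologous_trans (homologous_sym (HM j)) (H j).
Qed.

End LinearActions.

(** * Pseudofree actions *)

Section SphereSets.
Local Open Scope classical_set_scope.
Local Open Scope ring_scope.
Variable R : realType.
Local Notation S2 := (set_type (@sphere R)).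
Implicit Types (A B : 'M[R]_3) (x y : S2) (p q : 'cV[R]_3).

Lemma seq_infinite (T : Type) (F : set T) (f : nat -> T) :
  injective f -> (forall n, F (f n)) -> ~ finite_set F.
Proof.
move=> fi Ff fF.
have : finite_set (f @^-1` F) by apply: finite_preimage => // i j _ _; exact: fi.
have -> : f @^-1` F = setT by apply/seteqP; split => // n _; exact: Ff.
exact: infinite_nat.
Qed.

Lemma sphere_ext A B : (forall x, A *m val x = B *m val x) -> A = B.
Proof.
move=> AB; apply/matrixP => i j.
have ax1 : axis R j \in @sphere R by apply/in_sphere; rewrite axis_dot eqxx.
by have := AB (SigSub ax1); rewrite /= !mulmx_axis => /matrixP/(_ i 0); rewrite !mxE.
Qed.

(** A circle enters the argument only as an infinite set: the points are p + n q, normalized. *)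
Lemma circle_seq p q : dot p p = 1 -> dot q q = 1 -> dot p q = 0 ->
  exists2 f : nat -> S2, injective f & forall n, exists a b, val (f n) = a *: p + b *: q.
Proof.
move=> p1 q1 pq.
have E n : dot (p + n%:R *: q) p = 1 /\ dot (p + n%:R *: q) q = n%:R.
  by rewrite !dotE_lin (dotC q p) p1 q1 pq; split; ring.
have n0 n : p + n%:R *: q != 0.
  by apply: contra_eq_neq (E n).1 => ->; rewrite -(scale0r 0) dotZl mul0r eq_sym oner_eq0.
have u1 n : unitize (p + n%:R *: q) \in @sphere R by apply/in_sphere; exact: dot_unitize.
exists (fun n => SigSub (u1 n)); last first.
  by move=> n; rewrite /= /unitize; set c := _^-1; exists c, (c * n%:R); rewrite scalerDr scalerA.
move=> m n /(congr1 val) /=; rewrite /unitize.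
set a := _^-1; set b := _^-1 => ab.
have a0 : a != 0 by rewrite invr_eq0 sqrtr_eq0 -ltNge dot_gt0.
have hp := congr1 (fun v => @dot R v p) ab; have hq := congr1 (fun v => @dot R v q) ab.
rewrite /= !dotZl !(E _).1 !mulr1 in hp; rewrite /= !dotZl !(E _).2 -hp in hq.
by apply/eqP; rewrite -(@eqr_nat R); apply/eqP; exact: (mulfI a0).
Qed.

Lemma rot_fix_finite A : orth A -> \det A = 1 -> A <> 1%:M ->
  finite_set [set x : S2 | A *m val x = val x].
Proof.
move=> oA dA nA.
have [[u Au]|no] := pselect (exists u : S2, A *m val u = val u); last first.
  suff -> : [set x : S2 | A *m val x = val x] = set0 by exact: finite_set0.
  by apply/seteqP; split => // x Ax; apply: no; exists x.
have Nu : - val u \in @sphere R by apply/in_sphere; rewrite dotNl dotNr opprK dot_sphere.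
apply: (@sub_finite_set _ _ [set u; SigSub Nu]); last exact: finite_set2.
move=> x /= Ax; have := rot_fix2 oA dA (dot_sphere u) (dot_sphere x) Au Ax.
by case=> [//|[xu|xu]]; [left | right]; exact: val_inj.
Qed.

End SphereSets.

(** * Actions as cocycles: the characters [ss] (swap) and [dd] (determinant -1) *)

Section Core.
Local Open Scope ring_scope.
Variables (R : realType) (G : finGroupType) (ss dd : G -> bool).
Hypotheses (ssM : forall g h, ss (g * h)%g = ss g (+) ss h)
           (ddM : forall g h, dd (g * h)%g = dd g (+) dd h).
Variables K Ga : {group G}.
Hypotheses (memK : forall g, (g \in K) = ~~ ss g && ~~ dd g)
           (memGa : forall g, (g \in Ga) = ~~ ss g).
Local Notation S2 := (set_type (@sphere R)).
Implicit Types (g h : G) (x : S2).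

Let ss1 : ss 1%g = false.
Proof. by have := ssM 1 1; rewrite mulg1 addbb. Qed.

Let dd1 : dd 1%g = false.
Proof. by have := ddM 1 1; rewrite mulg1 addbb. Qed.

Let ssV g : ss g^-1%g = ss g.
Proof. by have := ssM g g^-1; rewrite mulgV ss1; case: (ss g); case: (ss _). Qed.

Let ddV g : dd g^-1%g = dd g.
Proof. by have := ddM g g^-1; rewrite mulgV dd1; case: (dd g); case: (dd _). Qed.

Let sKGa : K \subset Ga.
Proof. by apply/fintype.subsetP => g; rewrite memK memGa => /andP[]. Qed.

Let memGaK g : g \in Ga -> (g \notin K) = dd g.
Proof. by rewrite memGa memK => ->; rewrite negbK. Qed.

Let iGaK : (exists2 z, z \in Ga & z \notin K) -> #|Ga : K|%g = 2%N.
Proof.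
move=> [z Gaz nKz].
have E : finset.setD Ga K = (z *: K)%g.
  apply/setP => g; rewrite inE mem_lcoset.
  rewrite !memK !memGa ssM ddM ssV ddV; move: Gaz nKz; rewrite memGa memK.
  by case: (ss z); case: (dd z); case: (ss g); case: (dd g).
have := cardsID K Ga; rewrite E card_lcoset (finset.setIidPr sKGa) => oGa.
by rewrite -divgS // -oGa addnn -muln2 mulKn.
Qed.

(* A and D are the components of a family of linear maps indexed by G; these are
   the conditions for it to be an action. *)
Definition cocycle (A D : G -> 'M[R]_3) :=
  (forall g h, A (g * h)%g = A g *m (if ss g then D h else A h)) /\
  (forall g h, D (g * h)%g = D g *m (if ss g then A h else D h)).

Section Obstruction.
Variables (act : G -> continuousType (S2xS2 R) (S2xS2 R)) (A D : G -> 'M[R]_3).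
Hypotheses (oA : forall g, orth (A g)) (oD : forall g, orth (D g)).
Hypotheses (dA : forall g, \det (A g) = (-1) ^+ dd g) (dD : forall g, \det (D g) = (-1) ^+ dd g).
Hypothesis actE : forall g p, act g p = lin_act (ss g) (oA g) (oD g) p.
Hypotheses (acts : Defs.is_action act) (pf : is_pseudofree act).

Let coc : cocycle A D.
Proof.
have E x y g h : val (act (g * h)%g (x, y)).1 = val (act g (act h (x, y))).1 /\
    val (act (g * h)%g (x, y)).2 = val (act g (act h (x, y))).2 by rewrite acts.2.
by split => g h; apply: sphere_ext => x; have := E x x g h; rewrite !actE /lin_act ssM;
  case: (ss g); case: (ss h) => /= -[]; rewrite !mulmxA.
Qed.

Let A1 : A 1%g = 1%:M.
Proof. by apply: sphere_ext => x; have := acts.1 (x, x);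
  rewrite actE /lin_act ss1 mul1mx => /(congr1 fst)/(congr1 val). Qed.

Let D1 : D 1%g = 1%:M.
Proof. by apply: sphere_ext => x; have := acts.1 (x, x);
  rewrite actE /lin_act ss1 mul1mx => /(congr1 snd)/(congr1 val). Qed.

(** A fixed circle in one factor and a fixed point in the other give infinitely many fixed
    points. *)
Let free_plane g : ss g = false -> g != 1%g -> forall p q y,
  dot p p = 1 -> dot q q = 1 -> dot p q = 0 -> dot y y = 1 ->
  ~ (A g *m p = p /\ A g *m q = q /\ D g *m y = y) /\
  ~ (D g *m p = p /\ D g *m q = q /\ A g *m y = y).
Proof.
move=> sg g1 p q y p1 q1 pq y1; have [f fi fE] := circle_seq p1 q1 pq.
have yS : y \in @sphere R by apply/in_sphere.
split=> -[gp [gq gy]].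
  apply: (@seq_infinite _ _ (fun n => (f n, SigSub yS : S2))) pf.
    by move=> m n [] /fi.
  move=> n; exists g => //; rewrite actE /lin_act sg; congr pair; apply: val_inj => //=.
  by have [a [b ->]] := fE n; rewrite mulmxDr -!scalemxAr gp gq.
apply: (@seq_infinite _ _ (fun n => (SigSub yS : S2, f n))) pf.
  by move=> m n [] /fi.
move=> n; exists g => //; rewrite actE /lin_act sg; congr pair; apply: val_inj => //=.
by have [a [b ->]] := fE n; rewrite mulmxDr -!scalemxAr gp gq.
Qed.

(** A swapping involution fixes the graph of all points (A x, x). *)
Let free_swap g : ss g -> (g ^+ 2)%g != 1%g.
Proof.
move=> sg; apply/negP => /eqP g2.
have DA : D g *m A g = 1%:M by have := coc.2 g g; rewrite sg -(expgS g 1) g2 D1.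
have [f fi _] := circle_seq (axis_dot R 0 0) (axis_dot R 1 1) (axis_dot R 0 1).
apply: (@seq_infinite _ _ (fun n => (orth_act (oA g) (f n), f n))) pf.
  by move=> m n [] _ /fi.
move=> n; exists g; first by apply: contraTneq sg => ->; rewrite ss1.
rewrite actE /lin_act sg; congr pair; apply: val_inj => //=.
by rewrite mulmxA DA mul1mx.
Qed.

(** If A g = 1, then D g has determinant 1 and so an axis; together with any circle in the first
    factor this contradicts pseudofreeness. *)
Let repA : orth_rep Ga A.
Proof.
split=> [g h Gag Gah|g _|g Gag Ag]; first 2 [exact: oA].
  by rewrite coc.1; move: Gag; rewrite memGa => /negbTE ->.
apply/eqP/negPn/negP => g1; move: Gag; rewrite memGa => /negbTE sg.
have dg : \det (D g) = 1 by rewrite dD -dA Ag det1.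
have [y [y1 Dy]] := rot_axis (oD g) dg.
have [H _] := free_plane sg g1 (axis_dot R 0 0) (axis_dot R 1 1) (axis_dot R 0 1) y1.
by apply: H; rewrite Ag !mul1mx.
Qed.

Let repD : orth_rep Ga D.
Proof.
split=> [g h Gag Gah|g _|g Gag Dg]; first 2 [exact: oD].
  by rewrite coc.2; move: Gag; rewrite memGa => /negbTE ->.
apply/eqP/negPn/negP => g1; move: Gag; rewrite memGa => /negbTE sg.
have dg : \det (A g) = 1 by rewrite dA -dD Dg det1.
have [y [y1 Ay]] := rot_axis (oA g) dg.
have [_ H] := free_plane sg g1 (axis_dot R 0 0) (axis_dot R 1 1) (axis_dot R 0 1) y1.
by apply: H; rewrite Dg !mul1mx.
Qed.

Let invol g : ss g = false -> dd g -> (g ^+ 2 = 1)%g -> A g = - 1%:M \/ D g = - 1%:M.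
Proof.
move=> sg dg g2.
have [?|nA] := pselect (A g = - 1%:M); [by left | right].
have [//|nD] := pselect (D g = - 1%:M).
have AA : A g *m A g = 1%:M by have := coc.1 g g; rewrite sg -(expgS g 1) g2 A1.
have DD : D g *m D g = 1%:M by have := coc.2 g g; rewrite sg -(expgS g 1) g2 D1.
have [p [q [p1 q1 pq Ap Aq]]] := refl_invol_plane (oA g) (etrans (dA g) ltac:(by rewrite dg)) AA nA.
have [y [_ [y1 _ _ Dy _]]] := refl_invol_plane (oD g) (etrans (dD g) ltac:(by rewrite dg)) DD nD.
have g1 : g != 1%g by apply: contraTneq dg => ->; rewrite dd1.
by have [H _] := free_plane sg g1 p1 q1 pq y1; case: H.
Qed.

Lemma obstruction :
  [/\ polyhedral K,
      (exists g, ~~ ss g && dd g) -> abelian Ga /\ cyclic K,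
      (exists g, ss g) -> ~ [splits [set: G], over Ga]%g
    & forall qa qb, ~~ ss qa && dd qa -> ss qb && ~~ dd qb -> (qa ^+ 2 = 1)%g -> ~ commute qa qb].
Proof.
have rotA : rot_rep K A.
  split; first exact: orth_repS repA.
  by move=> g; rewrite memK => /andP[_ /negbTE]; rewrite dA => ->.
split.
- exact: rot_rep_polyhedral rotA.
- move=> [g /andP[sg dg]]; apply: (orth_reps_cyclic sKGa _ repA repD).
  + by apply: iGaK; exists g; rewrite ?memGa // memK dg andbF.
  + by move=> h; rewrite memK => /andP[_ /negbTE]; rewrite dA => ->.
  + by move=> h; rewrite memK => /andP[_ /negbTE]; rewrite dD => ->.
  + move=> h; rewrite memGa memK => sh; rewrite sh /= negbK => dh.
    by apply: invol; rewrite ?(negbTE sh).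
(* A complement contains a swapping element h. Its square lies in G_a and in the complement, so h is
   an involution. *)
- move=> [g sg] /splitsP[H /complP[IH MH]].
  have : g \in (Ga * H)%g by rewrite MH inE.
  case/mulsgP => a h Gaa Hh gE.
  have sh : ss h.
    by move: sg; rewrite gE ssM; move: Gaa; rewrite memGa => /negbTE ->.
  have := free_swap sh; have : (h ^+ 2)%g \in (Ga :&: H)%g.
    by rewrite inE memGa expgS expg1 ssM addbb groupM.
  by rewrite IH => /set1gP ->; rewrite eqxx.
- move=> qa qb /andP[/negbTE sa da] /andP[sb /negbTE db] a2 cab.
  have AB : A qa *m A qb = A qb *m D qa.
    by have := coc.1 qa qb; rewrite sa => <-; rewrite cab coc.1 sb.
  (* Commutation makes A qa and D qa conjugate under A qb, so if one of them is -1, both are. *)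
  have [Aa Da] : A qa = - 1%:M /\ D qa = - 1%:M.
    have [E|E] := invol sa da a2; split => //.
      rewrite -[D qa]mul1mx -(oA qb) -mulmxA -AB E mulNmx mul1mx mulmxN.
      by rewrite (oA qb).
    rewrite -[A qa]mulmx1 -(orth_trmx (oA qb)) mulmxA AB E mulmxN mulmx1 mulNmx.
    by rewrite orth_trmx.
  have ssX k : ss (qb ^+ k)%g = odd k.
    by elim: k => [|k IH]; rewrite ?expg0 // expgS ssM IH sb.
  have ddX k : dd (qb ^+ k)%g = false.
    by elim: k => [|k IH]; rewrite ?expg0 // expgS ddM IH db.
  have od : odd #[qb]%g = false by rewrite -ssX expg_order.
  (* An odd power of qb swaps the factors, so the order of qb is even and h is an involution; it
     lies in K because no involution swaps. *)
  pose h := (qb ^+ #[qb]%g./2)%g.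
  have h2 : (h ^+ 2)%g = 1%g.
    by rewrite -expgM muln2 -[RHS](expg_order qb) -[in RHS](odd_double_half #[qb]%g) od.
  have h1 : h != 1%g.
    rewrite -order_dvdn; apply/negP => /dvdn_leq.
    have := order_gt0 qb; have := odd_double_half #[qb]%g; rewrite od.
    by move: #[qb]%g => n; lia.
  have sh : ss h = false by apply/negP => /free_swap; rewrite h2 eqxx.
  have dh : dd h = false by exact: ddX.
  have cah : commute qa h by exact: commuteX.
  have g2 : ((qa * h) ^+ 2)%g = 1%g by rewrite expgMn // a2 h2 mulg1.
  have Gah : h \in Ga by rewrite memGa sh.
  (* The involution qa h is -1 on some factor, where qa is -1 too, so h is trivial there, against
     faithfulness. *)
  have [|||E|E] := @invol (qa * h)%g; rewrite ?ssM ?ddM ?sa ?da ?sh ?dh //.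
    case/eqP: h1; apply: (rep_inj repA Gah).
    by move: E; rewrite coc.1 sa Aa mulNmx mul1mx => /oppr_inj.
  case/eqP: h1; apply: (rep_inj repD Gah).
  by move: E; rewrite coc.2 sa Da mulNmx mul1mx => /oppr_inj.
Qed.

End Obstruction.

Definition realizable := exists act : G -> continuousType (S2xS2 R) (S2xS2 R),
  [/\ Defs.is_action act, is_pseudofree act
    & exists A D (oA : forall g, orth (A g)) (oD : forall g, orth (D g)),
      [/\ forall g, \det (A g) = (-1) ^+ dd g, forall g, \det (D g) = (-1) ^+ dd g
        & forall g p, act g p = lin_act (ss g) (oA g) (oD g) p]].

Lemma cocycle_realizable (A D : G -> 'M[R]_3) :
  (forall g, orth (A g)) -> (forall g, orth (D g)) ->
  (forall g, \det (A g) = (-1) ^+ dd g) -> (forall g, \det (D g) = (-1) ^+ dd g) ->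
  cocycle A D ->
  (forall g, g \in K -> A g = 1%:M -> g = 1%g) -> (forall g, g \in K -> D g = 1%:M -> g = 1%g) ->
  (forall g, ~~ ss g && dd g -> (g ^+ 2 = 1)%g -> A g = - 1%:M \/ D g = - 1%:M) ->
  (forall g, ss g -> (g ^+ 2 != 1)%g) ->
  realizable.
Proof.
move=> oA oD dA dD [cA cD] injA injD invol noswap.
pose act g : continuousType (S2xS2 R) (S2xS2 R) :=
  mkcts (@lin_act_continuous R (ss g) _ _ (oA g) (oD g)).
exists act; split; last by exists A, D, oA, oD.
- split=> [p|g h p].
    have A1 : A 1%g = 1%:M.
      have := cA 1%g 1%g; rewrite mulg1 ss1 => /(congr1 (mulmx (A 1%g)^T)).
      by rewrite mulmxA oA mul1mx.
    have D1 : D 1%g = 1%:M.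
      have := cD 1%g 1%g; rewrite mulg1 ss1 => /(congr1 (mulmx (D 1%g)^T)).
      by rewrite mulmxA oD mul1mx.
    change (lin_act (ss 1%g) (oA 1%g) (oD 1%g) p = p); rewrite /lin_act ss1.
    by case: p => x y; congr pair; apply: val_inj; rewrite /= ?A1 ?D1 mul1mx.
  change (lin_act (ss (g * h)%g) (oA (g * h)%g) (oD (g * h)%g) p =
    lin_act (ss g) (oA g) (oD g) (lin_act (ss h) (oA h) (oD h) p)).
  rewrite /lin_act ssM; have := cA g h; have := cD g h.
  by case: (ss g); case: (ss h) => /= EA ED; congr pair; apply: val_inj; rewrite /= ?EA ?ED mulmxA.
- rewrite /is_pseudofree.
  have -> : ([set p | exists2 g, g != 1%g & act g p = p] =
      \bigcup_(g in [set g : G | g != 1%g]) [set p | lin_act (ss g) (oA g) (oD g) p = p])%classic.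
    by apply/seteqP; split => p [g g1 gp]; exists g.
  apply: bigcup_finite; first exact: finite_finset.
  move=> g /= g1; case: (boolP (ss g)) => sg.
    (* A fixed point (x, y) of a swap is determined by x, and x is fixed by the nontrivial rotation
       A (g^2). *)
    have DA : A g *m D g = A (g ^+ 2)%g by rewrite expgS expg1 cA sg.
    have Kg2 : (g ^+ 2)%g \in K by rewrite memK expgS expg1 ssM ddM !addbb.
    have F : finite_set [set x : S2 | A (g ^+ 2)%g *m val x = val x]%classic.
      apply: rot_fix_finite => //; first by rewrite dA; move: Kg2;
        rewrite memK => /andP[_ /negbTE ->].
      by move/(injA _ Kg2)/eqP; apply/negP; exact: noswap.
    apply: sub_finite_set (finite_image (fun x : S2 => (x, orth_act (oD g) x)) F).
    move=> [x y] /= /pair_equal_spec[Ey Ex]; exists x; last by rewrite Ex.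
    by rewrite -DA -mulmxA -[in RHS]Ey -[in RHS]Ex.
  case: (boolP (dd g)) => dg; last first.
    have Kg : g \in K by rewrite memK sg.
    have FA : finite_set [set x : S2 | A g *m val x = val x]%classic.
      by apply: rot_fix_finite => //; [rewrite dA (negbTE dg) | move/(injA _ Kg)/eqP; apply/negP].
    have FD : finite_set [set x : S2 | D g *m val x = val x]%classic.
      by apply: rot_fix_finite => //; [rewrite dD (negbTE dg) | move/(injD _ Kg)/eqP; apply/negP].
    apply: sub_finite_set (finite_setX FA FD).
    move=> [x y] /= /pair_equal_spec[Ex Ey]; split => /=.
      by rewrite -[in RHS]Ex.
    by rewrite -[in RHS]Ey.
  suff -> : [set p | lin_act false (oA g) (oD g) p = p]%classic = set0 by exact: finite_set0.
  apply/seteqP; split => // -[x y] /= /pair_equal_spec[/(congr1 val)/= Ex /(congr1 val)/= Ey].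
  (* A reflection-type g with a fixed point has A g of order 2, hence is an involution, hence -1 on
     a factor, where it has no fixed points. *)
  have AA := refl_fix (oA g) (etrans (dA g) ltac:(by rewrite dg)) (dot_sphere x) Ex.
  have g2 : (g ^+ 2)%g = 1%g.
    apply: injA; first by rewrite memK expgS expg1 ssM ddM !addbb.
    by rewrite expgS expg1 cA (negbTE sg).
  have [|E|E] := invol g _ g2; first by rewrite sg dg.
    by have /eqP[] := unit_neqN (dot_sphere x); rewrite /= -[LHS]Ex E mulNmx mul1mx.
  by have /eqP[] := unit_neqN (dot_sphere y); rewrite /= -[LHS]Ey E mulNmx mul1mx.
Qed.

Let sgn_rep (rho : G -> 'M[R]_3) :=
  orth_rep Ga rho /\ forall g, g \in Ga -> \det (rho g) = (-1) ^+ dd g.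

Let sign_repE rho : sign_rep Ga K rho -> sgn_rep rho.
Proof. by move=> [rG dG]; split => // g Gag; rewrite dG // memGaK. Qed.

(** Multiplication by z carries the other involutions of G_a outside K to involutions of the cyclic
    group K, of which there is at most one. *)
Let involutions3 z z' g : abelian Ga -> cyclic K ->
  (forall h, h \in [:: z; z'; g] -> [/\ h \in Ga, dd h & (h ^+ 2 = 1)%g]) -> z != z' ->
  g = z \/ g = z'.
Proof.
move=> abG cK H zz'.
have [Gz dz z2] := H z ltac:(by rewrite inE eqxx).
have [Gz' dz' z2'] := H z' ltac:(by rewrite !inE eqxx orbT).
have [Gg dg g2] := H g ltac:(by rewrite !inE eqxx !orbT).
have cm h : h \in Ga -> commute z h by move=> Gh; exact: (centsP abG).
have zz h : (z * (z * h) = h)%g by rewrite mulgA -(expgS z 1) z2 mul1g.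
have P h : h \in Ga -> dd h -> (h ^+ 2 = 1)%g -> (z * h)%g \in K /\ ((z * h) ^+ 2 = 1)%g.
  move=> Gh dh h2; split; last by rewrite expgMn ?z2 ?h2 ?mulg1 //; exact: cm.
  by rewrite memK ssM ddM dz dh; move: Gz Gh; rewrite !memGa => /negbTE -> /negbTE ->.
have [gz|gz] := eqVneq g z; [by left | right].
have [K1 s1] := P g Gg dg g2; have [K2 s2] := P z' Gz' dz' z2'.
have n h : h != z -> (z * h)%g != 1%g.
  by apply: contraNneq => E; rewrite -(zz h) E mulg1.
by have /mulgI := cyclic_involution_uniq cK K1 K2 s1 s2 (n g gz) (n z' ltac:(by rewrite eq_sym)).
Qed.

Let sgn_rep_trivial : polyhedral K -> (forall g, g \in Ga -> dd g = false) ->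
  exists rho, sgn_rep rho.
Proof.
move=> pK nd.
have GK : Ga = K.
  by apply/val_inj/setP => g /=; rewrite memK -memGa; case: (boolP (g \in Ga)) => // /nd ->.
have [rho [rK dK]] := polyhedral_rot_rep R pK.
by exists rho; split; rewrite GK // => g Kg; rewrite dK // nd // GK.
Qed.

(** Each of the at most two involutions outside K needs a factor on which it is -1. If there are
    fewer than two, one representation serves both factors. *)
Let realize_split : polyhedral K ->
  ((exists g, ~~ ss g && dd g) -> abelian Ga /\ cyclic K) -> (forall g, ss g = false) -> realizable.
Proof.
move=> pK ab ns.
have Ga_all g : g \in Ga by rewrite memGa ns.
suff [r1 [r2 [[R1 d1] [R2 d2] inv]]] : exists r1 r2, [/\ sgn_rep r1, sgn_rep r2 &
    forall g, dd g -> (g ^+ 2 = 1)%g -> r1 g = - 1%:M \/ r2 g = - 1%:M].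
  apply: (@cocycle_realizable r1 r2).
  - by move=> g; exact: (rep_orth R1).
  - by move=> g; exact: (rep_orth R2).
  - by move=> g; exact: d1.
  - by move=> g; exact: d2.
  - by split => g h; rewrite ns; [exact: (repM R1) | exact: (repM R2)].
  - by move=> g _; exact: (rep_inj R1).
  - by move=> g _; exact: (rep_inj R2).
  - by move=> g /andP[_]; exact: inv.
  - by move=> g; rewrite ns.
have [[z0 dz0]|nd] := pselect (exists g, dd g); last first.
  have nd' g : dd g = false by apply/negP => dg; apply: nd; exists g.
  have [rho rP] := sgn_rep_trivial pK (fun g _ => nd' g).
  by exists rho, rho; split => // g; rewrite nd'.
have [abG cK] : abelian Ga /\ cyclic K by apply: ab; exists z0; rewrite ns.
have iK : #|Ga : K|%g = 2%N by apply: iGaK; exists z0; rewrite ?memGaK.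
have [[z [dz z2]]|nz] := pselect (exists z, dd z /\ (z ^+ 2 = 1)%g); last first.
  have [g Gg nKg|rho /sign_repE rP] := sign_rep_free R sKGa iK abG cK.
    by apply/negP => /eqP g2; apply: nz; exists g; rewrite -memGaK.
  by exists rho, rho; split => // g dg g2; case: nz; exists g.
have inv z1 : dd z1 -> (z1 ^+ 2 = 1)%g -> exists2 rho, sgn_rep rho & rho z1 = - 1%:M.
  move=> dz1 z12; have [|rho /sign_repE] := sign_rep_involution R sKGa iK abG cK (Ga_all z1) _ z12.
    by rewrite memGaK.
  by exists rho.
have [r1 R1 E1] := inv z dz z2.
have [[z' [dz' z2' zz']]|nz] := pselect (exists z', [/\ dd z', (z' ^+ 2 = 1)%g & z != z']);
  last first.
  exists r1, r1; split => // g dg g2; left; have [->//|gz] := eqVneq g z.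
  by case: nz; exists g; rewrite eq_sym.
have [r2 R2 E2] := inv z' dz' z2'.
exists r1, r2; split => // g dg g2.
have [h|->|->] := involutions3 (g := g) abG cK _ zz'; [|by left|by right].
by rewrite !inE => /or3P[] /eqP ->.
Qed.

Let realize_swap (q : G) : ss q -> dd q = false -> polyhedral K ->
  ((exists g, ~~ ss g && dd g) -> abelian Ga /\ cyclic K) ->
  ~ [splits [set: G], over Ga]%g ->
  (forall qa, ~~ ss qa && dd qa -> (qa ^+ 2 = 1)%g -> ~ commute qa q) -> realizable.
Proof.
move=> sq dq pK ab nspl ncomm.
have sqV : ss q^-1%g by rewrite ssV.
have dqV : dd q^-1%g = false by rewrite ddV.
suff [rho [[rG dG] inv]] : exists rho, sgn_rep rho /\
    forall g, ~~ ss g && dd g -> (g ^+ 2 = 1)%g -> rho g = - 1%:M \/ rho (q^-1 * g * q)%g = - 1%:M.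
  (* This is the representation of G induced from rho, in the blocks given by the coset
     representatives 1 and q. *)
  pose A g := if ss g then rho (g * q)%g else rho g.
  pose D g := if ss g then rho (q^-1 * g)%g else rho (q^-1 * g * q)%g.
  have GA g : (if ss g then g * q else g)%g \in Ga.
    by case: (boolP (ss g)) => sg; rewrite memGa ?ssM ?sg ?sq.
  have GD g : (if ss g then q^-1 * g else q^-1 * g * q)%g \in Ga.
    by case: (boolP (ss g)) => sg; rewrite memGa !ssM ?sqV ?sg ?(negbTE sg) ?sq.
  have AE g : A g = rho (if ss g then g * q else g)%g by rewrite /A; case: ifP.
  have DE g : D g = rho (if ss g then q^-1 * g else q^-1 * g * q)%g by rewrite /D; case: ifP.
  apply: (@cocycle_realizable A D).
  - by move=> g; rewrite AE; exact: (rep_orth rG).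
  - by move=> g; rewrite DE; exact: (rep_orth rG).
  - by move=> g; rewrite AE dG //; case: ifP; rewrite ?ddM ?dq ?addbF.
  - by move=> g; rewrite DE dG //; case: ifP; rewrite !ddM ?dq ?dqV ?addbF.
  - split=> g h; have := GA g; have := GA h; have := GD g; have := GD h; rewrite !AE !DE ssM.
      case: (ss g); case: (ss h) => /= Dh Dg Ah Ag; rewrite -(repM rG) //; congr rho;
      by rewrite ?mulgA // mulgK.
    case: (ss g); case: (ss h) => /= Dh Dg Ah Ag; rewrite -(repM rG) //; congr rho;
    by rewrite ?mulgA // mulgK.
  - move=> g; rewrite memK AE => /andP[/negbTE sg _]; rewrite sg.
    by apply: (rep_inj rG); rewrite memGa sg.
  - move=> g Kg; rewrite DE; have := GD g; move: Kg; rewrite memK => /andP[/negbTE -> _] /= Gg E.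
    have := rep_inj rG Gg E; rewrite -mulgA => /(congr1 (mulg q)); rewrite mulKVg mulg1.
    by move/(congr1 (mulg^~ q^-1)%g); rewrite mulgK mulgV.
  - move=> g sd g2; rewrite AE DE; case/andP: (sd) => /negbTE -> _; exact: inv.
  (* A swapping involution would generate a complement of G_a. *)
  - move=> g sg; apply/negP => /eqP g2; apply: nspl.
    apply/splitsP; exists <[g]>%G; apply/complP.
    have g1 : g != 1%g by apply: contraTneq sg => ->; rewrite ss1.
    have cg : <[g]>%g = [set 1%g; g]%SET by rewrite cycle2g //; apply: nt_prime_order.
    split.
      apply/setP => h; rewrite !inE /= cg !inE memGa.
      have [->|h1] := eqVneq h 1%g; first by rewrite ss1.
      by have [->|] := eqVneq h g; rewrite ?sg ?andbF.
    apply/setP => h; rewrite !inE; apply/mulsgP.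
    case: (boolP (ss h)) => sh.
      exists (h * g)%g g; rewrite ?memGa ?ssM ?sh ?sg ?cycle_id //.
      by rewrite -mulgA -(expgS g 1) g2 mulg1.
    by exists h 1%g; rewrite ?memGa ?sh ?group1 ?mulg1.
have [[z0 /andP[sz0 dz0]]|nd] := pselect (exists g, ~~ ss g && dd g); last first.
  have [g|rho rP] := sgn_rep_trivial pK _.
    by rewrite memGa => sg; apply/negP => dg; apply: nd; exists g; rewrite sg.
  by exists rho; split => // g sd; case: nd; exists g.
have [abG cK] : abelian Ga /\ cyclic K by apply: ab; exists z0; rewrite sz0.
have iK : #|Ga : K|%g = 2%N by apply: iGaK; exists z0; rewrite ?memGaK ?memGa.
have [[z [sz dz z2]]|nz] := pselect (exists z, [/\ ~~ ss z, dd z & (z ^+ 2 = 1)%g]); last first.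
  have [g Gg nKg|rho /sign_repE rP] := sign_rep_free R sKGa iK abG cK.
    by apply/negP => /eqP g2; apply: nz; exists g; rewrite -memGaK // -memGa.
  by exists rho; split => // g /andP[sg dg] g2; case: nz; exists g.
have Gz : z \in Ga by rewrite memGa.
have [|rho /sign_repE rP rz] := sign_rep_involution R sKGa iK abG cK Gz _ z2;
  first by rewrite memGaK.
exists rho; split => // g /andP[sg dg] g2.
pose z' := (q^-1 * z * q)%g.
have zz' : z != z'.
  apply/eqP => E; apply: (ncomm z); rewrite ?sz //.
  by rewrite /commute {2}E /z' !mulgA mulgV mul1g.
have sz' : ~~ ss z' by rewrite /z' !ssM sqV sq (negbTE sz).
have dz' : dd z' by rewrite /z' !ddM dqV dq dz.
have z2' : (z' ^+ 2 = 1)%g.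
  by rewrite /z' -mulgA -/(z ^ q)%g -conjXg z2 conj1g.
have [h|->|->] := involutions3 (g := g) abG cK _ zz'; [|by left|right].
  by rewrite !inE => /or3P[] /eqP ->; split; rewrite ?memGa.
(* Conjugation by q also carries z' back to z, because q^2 lies in the abelian group G_a. *)
have E : (q^-1 * z' * q = z)%g.
  have Gq2 : (q * q)%g \in Ga by rewrite memGa ssM addbb.
  have c : (z * (q * q) = q * q * z)%g by exact: (centsP abG).
  by rewrite /z' -!mulgA c !mulgA mulgKV mulVg mul1g.
by rewrite E.
Qed.

(** The hypothesis says that the image of [phi] contains b as soon as some element swaps the
    factors, which excludes the diagonal subgroup <ab>. *)
Lemma realizableP :
  ((exists g, ss g) -> exists2 q, ss q & dd q = false) ->
  realizable <->
  [/\ polyhedral K,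
      (exists g, ~~ ss g && dd g) -> abelian Ga /\ cyclic K,
      (exists g, ss g) -> ~ [splits [set: G], over Ga]%g
    & forall qa qb, ~~ ss qa && dd qa -> ss qb && ~~ dd qb -> (qa ^+ 2 = 1)%g -> ~ commute qa qb].
Proof.
move=> hq; split.
  by move=> [act [acts pf [A [D [oA [oD [dA dD actE]]]]]]]; exact: (obstruction dA dD actE acts pf).
move=> [pK ab nspl ncomm].
have [sw|nsw] := pselect (exists g, ss g).
  have [q sq dq] := hq sw; apply: (realize_swap sq dq pK ab (nspl sw)) => qa sd.
  by apply: ncomm => //; rewrite sq dq.
by apply: realize_split => // g; apply/negP => sg; apply: nsw; exists g.
Qed.

End Core.

(** * The group <a> x <b> as pairs of signs *)

Section Encoding.
Local Open Scope ring_scope.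

Lemma mat_bK : mat_b *m mat_b = 1%:M.
Proof.
apply/matrixP => i j; rewrite !mxE !big_ord_recl big_ord0 !mxE.
by case: i j => [[|[|//]] Hi] [[|[|//]] Hj].
Qed.

Lemma hom_mxM s b s' b' : hom_mx s b *m hom_mx s' b' = hom_mx (s (+) s') (b (+) b').
Proof.
rewrite /hom_mx -scalemxAl -scalemxAr scalerA -signr_addb; congr (_ *: _).
by case: s s' => [] []; rewrite /= ?mulmx1 ?mul1mx ?mat_bK.
Qed.

Lemma hom_mx_inj s b s' b' : hom_mx s b = hom_mx s' b' -> s = s' /\ b = b'.
Proof.
move=> /matrixP E; have := E 0 0; have := E 0 1; rewrite /hom_mx !mxE.
by case: s b s' b' {E} => [] [] [] []; rewrite !mxE.
Qed.

Lemma mat_aE : mat_a = hom_mx false true.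
Proof. by apply/matrixP => i j; rewrite /hom_mx !mxE /= expr1 mulNrn mulN1r. Qed.

Lemma mat_bE : mat_b = hom_mx true false.
Proof. by rewrite /hom_mx expr0 scale1r. Qed.

Lemma mat_1E : 1%:M = hom_mx false false.
Proof. by rewrite /hom_mx expr0 scale1r. Qed.

Lemma powers_hom s b M : powers (hom_mx s b) M <-> M = 1%:M \/ M = hom_mx s b.
Proof.
set A := hom_mx s b; have A2 : A * A = 1 by have := hom_mxM s b s b; rewrite !addbb -mat_1E.
have An n : A ^+ n = 1 \/ A ^+ n = A.
  by elim: n => [|n [] IH]; [left | right | left]; rewrite ?expr0 // exprS IH ?mulr1.
have AV : A^-1 = A.
  have uA : A \is a GRing.unit by apply/unitrP; exists A.
  by rewrite -[LHS]mulr1 -A2 mulKr.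
split.
  move=> [[n|n] ->]; first exact: An.
  have -> : A ^ Negz n = (A ^+ n.+1)^-1 by [].
  by have [->|->] := An n.+1; rewrite ?invr1 ?AV; [left | right].
by move=> [->|->]; [exists 0 | exists 1].
Qed.

Lemma subgroup_ab_hom M : subgroup_ab M -> exists s b, M = hom_mx s b.
Proof.
move=> [i [j ->]].
have /powers_hom[->|->] : powers (hom_mx false true) (mat_a ^ i) by exists i; rewrite mat_aE.
all: have /powers_hom[->|->] : powers (hom_mx true false) (mat_b ^ j) by exists j; rewrite mat_bE.
all: by rewrite ?mat_1E hom_mxM; eexists; eexists.
Qed.

Lemma homology_realizable (R : realType) (G : finGroupType) (phi : G -> 'M[int]_2)
    (ss dd : G -> bool) :
  (forall g, phi g = hom_mx (ss g) (dd g)) ->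
  admits_linear_pseudofree_action R phi <-> realizable R ss dd.
Proof.
move=> phiE; split.
  move=> [act [acts /is_linearP lin pf hom]].
  (* Matrices are chosen without their proofs of orthogonality, so the formula for the action is
     stated for all such proofs. *)
  have /choice[AD P] : forall g, exists AD : 'M[R]_3 * 'M[R]_3,
      [/\ orth AD.1, orth AD.2, \det AD.1 = (-1) ^+ dd g, \det AD.2 = (-1) ^+ dd g
        & forall (oA : orth AD.1) (oD : orth AD.2) p, act g p = lin_act (ss g) oA oD p].
    move=> g; have [s [A [D [oA [oD [AD E]]]]]] := lin g.
    have [b dA] : exists b : bool, \det A = (-1) ^+ b.
      by case: (orth_det oA) => ->; [exists false; rewrite expr0 | exists true; rewrite expr1].
    have dD : \det D = (-1) ^+ b by rewrite -AD.
    have := (hom_mxP _ dA dD E).1 (hom g); rewrite phiE => /hom_mx_inj[sE bE].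
    exists (A, D); rewrite /= dA dD bE; split => // oA' oD' p.
    by rewrite E sE (Prop_irrelevance oA oA') (Prop_irrelevance oD oD').
  exists act; split => //.
  exists (fun g => (AD g).1), (fun g => (AD g).2).
  have oA g : orth (AD g).1 by case: (P g).
  have oD g : orth (AD g).2 by case: (P g).
  by exists oA, oD; split => g; case: (P g).
move=> [act [acts pf [A [D [oA [oD [dA dD E]]]]]]].
exists act; split => //.
  by apply/is_linearP => g; exists (ss g), (A g), (D g), (oA g), (oD g); rewrite dA dD.
by move=> g; apply: (hom_mxP (phi g) (dA g) (dD g) (E g)).2.
Qed.

End Encoding.

Local Open Scope ring_scope.

(* The range of phi is the subgroup Q of <a> x <b>. The diagonal subgroup
   Q = <ab> is conjugate to <b> by reversing the orientation of one factor and
   is not in the standard position that the tuple (G, K, G_a, G_b) describes: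
   there K = G_a = G_b <> G, and for G of order 2 the conditions hold, although
   the involution (x, y) |-> (A y, A^-1 x) fixes a 2-sphere. *)
Theorem corollary3p10 (R : realType) (G : finGroupType) (phi : G -> 'M[int]_2)
    (phiM : forall x y : G, phi (x * y)%g = phi x *m phi y)
    (phi_ab : (range phi `<=` subgroup_ab)%classic)
    (phi_ncycab : range phi <> powers (mat_a *m mat_b)) :
  let K := tuple_K phi in let Ga := tuple_a phi in let Gb := tuple_b phi in
  admits_linear_pseudofree_action R phi <->
  [/\ polyhedral K,
      Ga <> K -> abelian Ga /\ cyclic K,
      Gb <> K -> ~ [splits [set: G], over Ga]%g
    & forall qa qb : G, phi qa = mat_a -> phi qb = mat_b -> (qa ^+ 2 = 1)%g ->
        ~ commute qa qb].
Proof.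
have /choice[sd sdE] : forall g, exists sd : bool * bool, phi g = hom_mx sd.1 sd.2.
  move=> g; have [s [b E]] := subgroup_ab_hom (phi_ab _ (ex_intro2 _ _ g I erefl)).
  by exists (s, b).
have [ss [dd phiE]] : exists ss dd : G -> bool, forall g, phi g = hom_mx (ss g) (dd g).
  by exists (fun g => (sd g).1), (fun g => (sd g).2).
have sdM g h : ss (g * h)%g = ss g (+) ss h /\ dd (g * h)%g = dd g (+) dd h.
  by apply: hom_mx_inj; rewrite -phiE phiM !phiE hom_mxM.
have ssM g h := (sdM g h).1; have ddM g h := (sdM g h).2.
have inK g : (g \in tuple_K phi) = ~~ ss g && ~~ dd g.
  rewrite inE phiE mat_1E; apply/eqP/idP => [/hom_mx_inj[-> ->] //|].
  by case: (ss g); case: (dd g).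
have inGa g : (g \in tuple_a phi) = ~~ ss g.
  rewrite inE; apply/asboolP/idP.
    by rewrite mat_aE phiE => /powers_hom; rewrite mat_1E => -[] /hom_mx_inj[-> _].
  rewrite mat_aE phiE; case: (ss g); case: (dd g) => // _; apply/powers_hom; [by right|].
  by left; rewrite mat_1E.
have inGb g : (g \in tuple_b phi) = ~~ dd g.
  rewrite inE; apply/asboolP/idP.
    by rewrite mat_bE phiE => /powers_hom; rewrite mat_1E => -[] /hom_mx_inj[_ ->].
  rewrite mat_bE phiE; case: (ss g); case: (dd g) => // _; apply/powers_hom; [by right|].
  by left; rewrite mat_1E.
have ss1 : ss 1%g = false by have := ssM 1%g 1%g; rewrite mulg1 addbb.
have dd1 : dd 1%g = false by have := ddM 1%g 1%g; rewrite mulg1 addbb.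
have gK : group_set (tuple_K phi).
  apply/group_setP; split; first by rewrite inK ss1 dd1.
  by move=> g h; rewrite !inK ssM ddM => /andP[/negbTE -> /negbTE ->].
have gGa : group_set (tuple_a phi).
  apply/group_setP; split; first by rewrite inGa ss1.
  by move=> g h; rewrite !inGa ssM => /negbTE ->.
have hq : (exists g, ss g) -> exists2 q, ss q & dd q = false.
  move=> [g0 sg0]; have [[q sq dq]|nq] := pselect (exists2 q, ss q & dd q = false).
    by exists q.
  (* If every swapping element also had determinant sign -1, multiplying by g0 would give [ss = dd],
     and the image of [phi] would be exactly <ab>. *)
  have swd q : ss q -> dd q by move=> sq; apply/negPn/negP => /negbTE dq; apply: nq; exists q.
  have sdd g : ss g = dd g.
    case: (boolP (ss g)) => sg; first by rewrite swd.
    have := swd (g * g0)%g; rewrite ssM ddM (negbTE sg) sg0 (swd g0 sg0) addbT.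
    by move=> /(_ isT); case: (dd g).
  case: phi_ncycab; apply/seteqP; rewrite mat_aE mat_bE hom_mxM /=; split.
    move=> _ [g _ <-]; apply/powers_hom; rewrite phiE -sdd mat_1E.
    by case: (ss g); [right | left].
  move=> M /powers_hom[] ->.
    by exists 1%g => //; rewrite phiE ss1 dd1 mat_1E.
  by exists g0 => //; rewrite phiE -sdd sg0.
move=> K Ga Gb.
have GaK : Ga <> K <-> exists g, ~~ ss g && dd g.
  split=> [GK|[g /andP[sg dg]] /setP/(_ g)]; last by rewrite inGa inK sg dg.
  apply/not_existsP => no; apply: GK; apply/setP => g; rewrite inGa inK.
  by have /negP := no g; case: (ss g); case: (dd g).
have GbK : Gb <> K <-> exists g, ss g.
  split=> [GK|/hq[g sg dg] /setP/(_ g)]; last by rewrite inGb inK sg dg.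
  apply/not_existsP => no; apply: GK; apply/setP => g; rewrite inGb inK.
  by have /negP := no g; case: (ss g).
have := realizableP R ssM ddM (K := Group gK) (Ga := Group gGa) inK inGa hq.
rewrite -(homology_realizable R phiE) => H.
apply: (iff_trans H); split=> -[h1 h2 h3 h4]; split => //.
- by move=> /GaK/h2.
- by move=> /GbK/h3.
- by move=> qa qb; rewrite mat_aE mat_bE !phiE => /hom_mx_inj[sa da] /hom_mx_inj[sb db];
    apply: h4; rewrite ?sa ?da ?sb ?db.
- by move=> /GaK/h2.
- by move=> /GbK/h3.
- move=> qa qb /andP[/negbTE sa da] /andP[sb /negbTE db]; apply: h4.
    by rewrite phiE sa da mat_aE.
  by rewrite phiE sb db mat_bE.
Qed.
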